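(* Let $k\geq 2$ be an integer and $i$ an integer with $0\leq i\leq 2k$. Put $$\alpha_k=\frac{-4k}{(2^{2k}-1)(3^{2k}-1)B_{2k}}.$$ Then for every positive integer $n$, $$N(1^{4k-2i},3^{2i};n)=\sum_{r\mid 12} b_{(r,i,k)}\,\sigma_{2k-1}(n/r)+\sum_{1\leq j\leq 4k-5} a_{(j,i,k)}\,c_{j,2k}(n),$$ where $r$ runs over the positive divisors $1,2,3,4,6,12$ of $12$, \begin{align*} b_{(1,i,k)}&=(-1)^{k}\,(3^{2k-i}+(-1)^{i+1})\,\alpha_k,\\ b_{(2,i,k)}&=(-1)^{i+1}(1+(-1)^{i+k})(3^{2k-i}+(-1)^{i+1})\,\alpha_k,\\ b_{(3,i,k)}&=(-1)^{i+k}\,3^{2k-i}(3^{i}+(-1)^{i+1})\,\alpha_k,\\ b_{(4,i,k)}&=(-1)^{i}\,2^{2k}(3^{2k-i}+(-1)^{i+1})\,\alpha_k,\\ b_{(6,i,k)}&=-(1+(-1)^{i+k})\,3^{2k-i}(3^{i}+(-1)^{i+1})\,\alpha_k,\\ b_{(12,i,k)}&=2^{2k}\,3^{2k-i}(3^{i}+(-1)^{i+1})\,\alpha_k, \end{align*} and, for $1\leq j\leq 4k-5$, recursively $$a_{(j,i,k)}= N(1^{4k-2i},3^{2i};j) - \sum_{r\mid 12} b_{(r,i,k)}\,\sigma_{2k-1}(j/r) - \sum_{1\leq l\leq j-1} a_{(l,i,k)}\, c_{l,2k}(j).$$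
   Context: $N(1^{4k-2i},3^{2i};n)$ is the number of $(x_1,\ldots,x_{4k})\in\mathbb{Z}^{4k}$ with $n = x_1^2+\cdots+x_{4k-2i}^2+3x_{4k-2i+1}^2+\cdots+3x_{4k}^2$. The Bernoulli numbers $B_n$ are defined by $\frac{x}{e^x-1}=\sum_{n=0}^\infty\frac{B_nx^n}{n!}$. For positive integers $m,n$, $\sigma_m(n)=\sum_{d\mid n,\,d\geq1} d^m$, and $\sigma_m(n)=0$ if $n$ is not a positive integer. For $z\in\mathbb{C}$ with $\mathrm{Im}(z)>0$ let $q=e^{2\pi i z}$ and let $\eta(z)=e^{\pi i z/12}\prod_{n=1}^\infty(1-e^{2\pi i n z})$ be the Dedekind eta function (in these exponentials $i$ is the imaginary unit; elsewhere $i$ is the integer parameter). For integers $j,k$ define $$C_{j,k}(z)= \Big(\frac{\eta^{10}(2z)\, \eta^{5}(3z)\, \eta(4z)\, \eta^{2}(6z)}{\eta^{15}(z)\, \eta^{3}(12z)}\Big)\Big(\frac{\eta^{2}(2z)\, \eta(3z)\, \eta^{3}(12z)}{\eta^{3}(z)\, \eta(4z)\, \eta^{2}(6z)}\Big)^{j}\Big(\frac{\eta^{6}(z)\,\eta(6z)}{\eta^{3}(2z)\, \eta^{2}(3z)}\Big)^{k},$$ and let $c_{j,k}(n)$ denote the coefficient of $q^n$ in its $q$-expansion, which has the form $C_{j,k}(z)=q^j+\sum_{n=j+1}^\infty c_{j,k}(n)q^n$; thus $c_{j,k}(j)=1$ and $c_{j,k}(n)=0$ for $n<j$. (The statement uses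 $c_{j,2k}$, i.e. the second index is replaced by $2k$.) *)

(* Defs.v *)
From Stdlib Require Import Reals ZArith Arith List Finite_sets ClassicalEpsilon.
From Coquelicot Require Import Coquelicot.
Import ListNotations.

(** ** Representation numbers *)

(** [epsilon] picks the cardinality when [A] is finite; nothing is known about
    the value otherwise. *)
Definition card {T : Type} (A : T -> Prop) : nat :=
  epsilon (inhabits 0%nat) (fun m => cardinal T A m).

Definition zsum (l : list Z) : Z := fold_right Z.add 0%Z l.

(** [Nrep a b n] is N(1^a,3^b;n); tuples in Z^(a+b) are lists of length a+b. *)
Definition Nrep (a b n : nat) : nat :=
  card (fun x : list Z =>
    length x = (a + b)%nat /\
    Z.of_nat n = (zsum (map (fun t => t ^ 2) (firstn a x)) +
                  zsum (map (fun t => 3 * t ^ 2) (skipn a x)))%Z).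

(** ** Arithmetic functions *)

Definition divisor_sigma (m n : nat) : nat :=
  list_sum (map (fun d => (d ^ m)%nat)
                (filter (fun d => (n mod d =? 0)%nat) (seq 1 n))).

(** sigma_m(n/r), which is 0 unless n/r is an integer. *)
Definition sigma_div (m n r : nat) : nat :=
  if (n mod r =? 0)%nat then divisor_sigma m (n / r) else 0%nat.

Definition is_bernoulli (B : nat -> R) : Prop :=
  exists rho : R, (0 < rho)%R /\
    forall x : R, x <> 0%R -> (Rabs x < rho)%R ->
      is_series (fun n => B n * x ^ n / INR (fact n))%R (x / (exp x - 1))%R.

(** The Bernoulli numbers: coefficients of a convergent power series are
    determined by its sum, so [is_bernoulli] holds of a single sequence. *)
Definition bernoulli : nat -> R :=
  epsilon (inhabits (fun _ => 0%R)) is_bernoulli.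

(** ** Eta quotients *)

Definition Cexp (z : C) : C :=
  (exp (Re z) * cos (Im z), exp (Re z) * sin (Im z))%R.

Definition Cpowz (z : C) (n : Z) : C :=
  match n with
  | Z0 => 1
  | Zpos p => (z ^ Pos.to_nat p)%C
  | Zneg p => (/ (z ^ Pos.to_nat p))%C
  end.

Definition Clim_seq (u : nat -> C) : C :=
  (real (Lim_seq (fun n => Re (u n))), real (Lim_seq (fun n => Im (u n)))).

Fixpoint eta_partial (z : C) (N : nat) : C :=
  match N with
  | O => 1
  | S N' => (eta_partial z N' * (1 - Cexp (2 * PI * Ci * INR (S N') * z)))%C
  end.

Definition eta (z : C) : C :=
  (Cexp (PI * Ci * z / 12) * Clim_seq (eta_partial z))%C.

Definition Cjk (j k : Z) (z : C) : C :=
  ((eta (2 * z) ^ 10 * eta (3 * z) ^ 5 * eta (4 * z) * eta (6 * z) ^ 2)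
     / (eta z ^ 15 * eta (12 * z) ^ 3)
   * Cpowz ((eta (2 * z) ^ 2 * eta (3 * z) * eta (12 * z) ^ 3)
              / (eta z ^ 3 * eta (4 * z) * eta (6 * z) ^ 2)) j
   * Cpowz ((eta z ^ 6 * eta (6 * z))
              / (eta (2 * z) ^ 3 * eta (3 * z) ^ 2)) k)%C.

(** [c] is the family of coefficients of a q-expansion of [F], q = e^(2 pi i z),
    having no terms of degree less than [j]. *)
Definition is_q_expansion (F : C -> C) (j : Z) (c : Z -> C) : Prop :=
  (forall n : Z, (n < j)%Z -> c n = 0) /\
  forall z : C, (0 < Im z)%R ->
    is_series (fun m : nat =>
                 let n := (j + Z.of_nat m)%Z in
                 (c n * Cpowz (Cexp (2 * PI * Ci * z)) n)%C)
              (F z).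

(** As for [bernoulli], at most one family satisfies the specification. *)
Definition cjk (j k : Z) : Z -> C :=
  epsilon (inhabits (fun _ => RtoC 0)) (is_q_expansion (Cjk j k) j).

(** ** The explicit coefficients *)

Definition alpha (k : nat) : R :=
  ((- 4 * INR k) /
     ((2 ^ (2 * k) - 1) * (3 ^ (2 * k) - 1) * bernoulli (2 * k)))%R.

Definition bcoef (r i k : nat) : R :=
  match r with
  | 1 => (-1) ^ k * (3 ^ (2 * k - i) + (-1) ^ (i + 1)) * alpha k
  | 2 => (-1) ^ (i + 1) * (1 + (-1) ^ (i + k))
           * (3 ^ (2 * k - i) + (-1) ^ (i + 1)) * alpha k
  | 3 => (-1) ^ (i + k) * 3 ^ (2 * k - i) * (3 ^ i + (-1) ^ (i + 1)) * alpha k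
  | 4 => (-1) ^ i * 2 ^ (2 * k)
           * (3 ^ (2 * k - i) + (-1) ^ (i + 1)) * alpha k
  | 6 => - (1 + (-1) ^ (i + k)) * 3 ^ (2 * k - i)
           * (3 ^ i + (-1) ^ (i + 1)) * alpha k
  | 12 => 2 ^ (2 * k) * 3 ^ (2 * k - i) * (3 ^ i + (-1) ^ (i + 1)) * alpha k
  | _ => 0
  end%R.

Definition eisenstein_part (i k n : nat) : R :=
  fold_right Rplus 0%R
    (map (fun r => bcoef r i k * INR (sigma_div (2 * k - 1) n r))%R
         [1; 2; 3; 4; 6; 12]%nat).

(* Main.v *)
Require Import Defs.
From Stdlib Require Import Reals ZArith Arith List Lia Lra Psatz Ensembles Finite_sets
  ClassicalEpsilon FunctionalExtensionality PropExtensionality Permutation.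
From Coquelicot Require Import Coquelicot.
Import ListNotations.
Open Scope R_scope.

(** All forms involved are treated as formal power series in q. Both sides are polynomials of
    degree at most 4k in the Hauptmodul t of X_0(12), multiplied by A^(2k) for one weight-one eta
    quotient A, and the C_(j,2k) with 1 <= j <= 4k-5 are exactly the products of A^(2k) with t^j
    and a quartic, so that they span the polynomials vanishing at the six cusps; it remains to
    compare values at the cusps, and the recursion for the a_j is triangular.

    No valence formula is needed for the polynomial expressions. A system of differential
    equations defines formal series t, A, B; explicit combinations of them satisfy Ramanujan's
    differential equations, whose solutions are determined by finitely many coefficients, hence
    they are the series E_2(q^r), E_4(q^r) for r | 12. Since E_2(q^r) is the logarithmic derivative
    of eta(rz)^24, all identities between eta quotients follow by comparing logarithmic
    derivatives. The Ramanujan equations themselves, and the recursion expressing every E_(2k)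
    through lower weights and a Serre derivative, come from an elementary bijection on the
    solutions of ax + by = n; the Serre derivative acts on values at the cusps by a scalar, which
    gives these values for all k. *)

(** * Formal power series *)

(** Modular forms are only the heuristic; every form is a real power series in q. What is usually
    deduced from a finite-dimensional space must here come from uniqueness for a recursion:
    logarithmic derivatives determine eta quotients, and Ramanujan's system determines E_2, E_4,
    E_6. The latter has a resonance at q^r, hence the exact coefficients up to q^12. The degree 4k
    is the number of zeros of a form of weight 2k on Gamma_0(12), of index 24; six conditions at the
    cusps leave 4k - 5 free coefficients, the range of j. The b_r satisfy six linear equations, one
    for each cusp, with matrix entries [rho r c ^ k] and the cusp values of theta(q)^(4k-2i)
    theta(q^3)^(2i) on the right. As alpha_k divides by B_2k, the sign of the Bernoulli numbers is
    needed too. Analysis enters because [eta], [bernoulli] and [cjk] are defined by limits or by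
    choice: they are identified with formal objects through absolute convergence in the unit disc
    and uniqueness of power series coefficients. *)

Notation fps := (nat -> R).
Declare Scope fps_scope.
Delimit Scope fps_scope with fp.

Definition fC (c : R) : fps := fun n => match n with O => c | S _ => 0 end.
Definition fadd (f g : fps) : fps := fun n => f n + g n.
Definition fopp (f : fps) : fps := fun n => - f n.
Definition fsub (f g : fps) : fps := fun n => f n - g n.
Definition fscal (c : R) (f : fps) : fps := fun n => c * f n.
Definition ftail (f : fps) : fps := fun n => f (S n).

(** Peeling off the constant term of the first factor lets the ring laws follow by induction on the
    coefficient with that factor generalised; [fmul_Sr] is the mirror rule, [fmul_sumL] the usual
    convolution. *)
Fixpoint fmul (f g : fps) (n : nat) : R :=
  match n with
  | O => f O * g O
  | S m => f O * g (S m) + fmul (ftail f) g m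
  end.

Fixpoint fpow (f : fps) (n : nat) : fps :=
  match n with O => fC 1 | S m => fmul f (fpow f m) end.

Infix "+" := fadd : fps_scope.
Infix "-" := fsub : fps_scope.
Infix "*" := fmul : fps_scope.
Notation "- x" := (fopp x) : fps_scope.
Infix "^" := fpow : fps_scope.

Lemma fps_ext (f g : fps) : (forall n, f n = g n) -> f = g.
Proof. apply functional_extensionality. Qed.

Lemma fmul_congr (f g f' g' : fps) n :
  (forall i, (i <= n)%nat -> f i = f' i) -> (forall i, (i <= n)%nat -> g i = g' i) ->
  fmul f g n = fmul f' g' n.
Proof.
  revert f f'; induction n as [|n IH]; intros f f' Hf Hg; simpl.
  - rewrite Hf, Hg by lia; reflexivity.
  - rewrite (Hf O), (Hg (S n)) by lia. f_equal.
    apply IH; intros i Hi; [apply Hf | apply Hg]; lia.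
Qed.

Lemma fmul_addl f g h n : fmul (f + g)%fp h n = fmul f h n + fmul g h n.
Proof.
  revert f g; induction n as [|n IH]; intros f g; simpl; [unfold fadd; ring|].
  change (ftail (f + g)%fp) with (ftail f + ftail g)%fp. rewrite IH. unfold fadd; ring.
Qed.

Lemma fmul_scall c f g n : fmul (fscal c f) g n = c * fmul f g n.
Proof.
  revert f; induction n as [|n IH]; intros f; simpl; [unfold fscal; ring|].
  change (ftail (fscal c f)) with (fscal c (ftail f)). rewrite IH. unfold fscal; ring.
Qed.

Lemma fmul_zerol g n : fmul (fun _ => 0) g n = 0.
Proof.
  induction n as [|n IH]; simpl; [ring|].
  change (ftail (fun _ => 0)) with (fun _ : nat => 0). rewrite IH; ring.
Qed.

Lemma fmul_C c g : (fC c * g)%fp = fscal c g.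
Proof.
  apply fps_ext; intros [|n]; simpl; [reflexivity|].
  change (ftail (fC c)) with (fun _ : nat => 0). rewrite fmul_zerol. unfold fscal; ring.
Qed.

Lemma fmul_assoc_coef f g h n : fmul (fmul f g) h n = fmul f (fmul g h) n.
Proof.
  revert f; induction n as [|n IH]; intros f; simpl; [ring|].
  change (ftail (fmul f g)) with (fscal (f O) (ftail g) + ftail f * g)%fp.
  rewrite fmul_addl, fmul_scall, IH. ring.
Qed.

Lemma fmul_Sr f g n : fmul f g (S n) = f (S n) * g O + fmul f (ftail g) n.
Proof.
  revert f; induction n as [|n IH]; intros f; [simpl; unfold ftail; ring|].
  change (fmul f g (S (S n))) with (f O * g (S (S n)) + fmul (ftail f) g (S n)).
  rewrite IH. cbn [fmul]. change (ftail f (S n)) with (f (S (S n))). change (ftail g (S n)) with (g (S (S n))). ring.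
Qed.

Lemma fmul_comm_coef f g n : fmul f g n = fmul g f n.
Proof.
  revert f; induction n as [|n IH]; intros f; [simpl; ring|].
  rewrite (fmul_Sr g f). cbn [fmul]. rewrite IH. ring.
Qed.

Lemma fps_ring_theory :
  ring_theory (fC 0) (fC 1) fadd fmul fsub fopp (@eq fps).
Proof.
  constructor; intros; apply fps_ext; intros n.
  - unfold fadd; destruct n; simpl; ring.
  - unfold fadd; ring.
  - unfold fadd; ring.
  - rewrite fmul_C. unfold fscal; ring.
  - apply fmul_comm_coef.
  - symmetry; apply fmul_assoc_coef.
  - rewrite fmul_addl. reflexivity.
  - unfold fsub, fadd, fopp; ring.
  - unfold fadd, fopp; destruct n; simpl; ring.
Qed.

(** The integers are the coefficient ring handed to [ring], which thus computes with numerals.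
    Fractions such as [fC (1/24)] remain atoms, hence the manual clearing of denominators further
    on. *)
Definition fZ (z : Z) : fps := fC (IZR z).

Lemma fC_add a b : fC (a + b) = (fC a + fC b)%fp.
Proof. apply fps_ext; intros [|n]; unfold fadd; simpl; ring. Qed.
Lemma fC_mul a b : fC (a * b) = (fC a * fC b)%fp.
Proof. rewrite fmul_C. apply fps_ext; intros [|n]; unfold fscal; simpl; ring. Qed.
Lemma fC_opp a : fC (- a) = (- fC a)%fp.
Proof. apply fps_ext; intros [|n]; unfold fopp; simpl; ring. Qed.
Lemma fC_sub a b : fC (a - b) = (fC a - fC b)%fp.
Proof. apply fps_ext; intros [|n]; unfold fsub; simpl; ring. Qed.

Lemma fZ_morph :
  ring_morph (fC 0) (fC 1) fadd fmul fsub fopp (@eq fps)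
             0%Z 1%Z Z.add Z.mul Z.sub Z.opp Z.eqb fZ.
Proof.
  unfold fZ; constructor; try reflexivity; intros.
  - rewrite plus_IZR; apply fC_add.
  - rewrite minus_IZR; apply fC_sub.
  - rewrite mult_IZR; apply fC_mul.
  - rewrite opp_IZR; apply fC_opp.
  - apply Z.eqb_eq in H; subst; reflexivity.
Qed.

Lemma fps_power_theory : power_theory (fC 1) fmul (@eq fps) N.to_nat fpow.
Proof.
  constructor. intros r [|p]; [reflexivity|]. simpl.
  induction p using Pos.peano_ind.
  - simpl. rewrite (fps_ring_theory.(Rmul_comm)), (fps_ring_theory.(Rmul_1_l)). reflexivity.
  - rewrite Pos2Nat.inj_succ. simpl. rewrite IHp.
    symmetry. apply pow_pos_succ.
    + split; red; congruence.
    + intros a b -> c d ->; reflexivity.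
    + intros; apply (fps_ring_theory.(Rmul_assoc)).
Qed.

Ltac fps_cst t :=
  match t with
  | fZ ?z => match isZcst z with true => z | _ => constr:(InitialRing.NotConstant) end
  | fC (IZR ?z) => match isZcst z with true => z | _ => constr:(InitialRing.NotConstant) end
  | _ => constr:(InitialRing.NotConstant)
  end.
Ltac fps_pow_cst t :=
  match isnatcst t with
  | true => constr:(N.of_nat t)
  | _ => constr:(InitialRing.NotConstant)
  end.

Add Ring fps_ring : fps_ring_theory
  (morphism fZ_morph, constants [fps_cst], power_tac fps_power_theory [fps_pow_cst]).

Lemma fpow_add f m n : (f ^ (m + n) = f ^ m * f ^ n)%fp.
Proof. induction m as [|m IH]; simpl; [ring|]. rewrite IH; ring. Qed.
Lemma fpow_mul f m n : (f ^ (m * n) = (f ^ m) ^ n)%fp.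
Proof.
  induction n as [|n IH]; [rewrite Nat.mul_0_r; reflexivity|].
  rewrite Nat.mul_succ_r, Nat.add_comm, fpow_add, IH. reflexivity.
Qed.
Lemma fpow_mull f g n : ((f * g) ^ n = f ^ n * g ^ n)%fp.
Proof. induction n as [|n IH]; simpl; [ring|]. rewrite IH; ring. Qed.

Lemma fscalE c f : fscal c f = (fC c * f)%fp.
Proof. symmetry; apply fmul_C. Qed.

Lemma fmul_0 f g : (f * g)%fp O = f O * g O.
Proof. reflexivity. Qed.
Lemma fpow_0 f n : (f ^ n)%fp O = f O ^ n.
Proof. induction n as [|n IH]; simpl; [reflexivity|]. rewrite IH; reflexivity. Qed.

Definition fD (f : fps) : fps := fun n => INR n * f n.

Lemma fD_add f g : fD (f + g)%fp = (fD f + fD g)%fp.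
Proof. apply fps_ext; intros n; unfold fD, fadd; ring. Qed.
Lemma fD_sub f g : fD (f - g)%fp = (fD f - fD g)%fp.
Proof. apply fps_ext; intros n; unfold fD, fsub; ring. Qed.
Lemma fD_C c : fD (fC c) = fC 0.
Proof. apply fps_ext; intros [|n]; unfold fD; simpl; ring. Qed.
Lemma ftail_fD f : ftail (fD f) = (fD (ftail f) + ftail f)%fp.
Proof. apply fps_ext; intros n; cbv beta delta [ftail fadd fD]. rewrite S_INR; ring. Qed.

Lemma fD_mul f g : fD (f * g)%fp = (fD f * g + f * fD g)%fp.
Proof.
  apply fps_ext; intros n. unfold fadd. revert f.
  induction n as [|n IH]; intros f; [unfold fD; simpl; ring|].
  change (fD (f * g)%fp (S n)) with (INR (S n) * (f O * g (S n) + fmul (ftail f) g n)).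
  cbn [fmul]. rewrite ftail_fD, fmul_addl.
  assert (E := IH (ftail f)). unfold fD at 1 in E.
  change (fD f 0%nat) with (0 * f O). change (fD g (S n)) with (INR (S n) * g (S n)). rewrite S_INR.
  rewrite Rmult_plus_distr_r, Rmult_1_l, !Rmult_plus_distr_l, E. ring.
Qed.

Lemma fD_pow f n : fD (f ^ n)%fp = (fC (INR n) * f ^ (n - 1) * fD f)%fp.
Proof.
  induction n as [|n IH]; [simpl; rewrite fD_C; ring|].
  cbn [fpow]. rewrite fD_mul, IH, S_INR, fC_add.
  destruct n as [|n]; [simpl; change (INR 0) with 0; ring|].
  replace (S (S n) - 1)%nat with (S n) by lia. replace (S n - 1)%nat with n by lia.
  simpl fpow. ring.
Qed.

Definition fX (r : nat) : fps := fun n => if (n =? r)%nat then 1 else 0.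

Lemma ftail_fX r : ftail (fX (S r)) = fX r.
Proof. reflexivity. Qed.

Lemma fX0 : fX 0 = fC 1.
Proof. apply fps_ext; intros [|n]; reflexivity. Qed.

Lemma fX_mul r g n : (fX r * g)%fp n = if (n <? r)%nat then 0 else g (n - r)%nat.
Proof.
  revert n; induction r as [|r IH]; intros n.
  - rewrite fX0, fmul_C. unfold fscal. rewrite Nat.sub_0_r. simpl. ring.
  - destruct n as [|n]; simpl; [unfold fX; simpl; ring|].
    rewrite ftail_fX, IH. change (fX (S r) O) with 0.
    change (S n <? S r)%nat with (n <? r)%nat. ring.
Qed.

Lemma fX_add r s : (fX r * fX s = fX (r + s))%fp.
Proof.
  apply fps_ext; intros n. rewrite fX_mul. unfold fX.
  destruct (Nat.ltb_spec n r); destruct (Nat.eqb_spec n (r + s)); try lia; try reflexivity;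
  destruct (Nat.eqb_spec (n - r) s); try lia; reflexivity.
Qed.

Lemma fX_pow r n : (fX r ^ n = fX (r * n))%fp.
Proof.
  induction n as [|n IH]; simpl; [rewrite Nat.mul_0_r, fX0; reflexivity|].
  rewrite IH, fX_add. f_equal; lia.
Qed.

Lemma fX1_S g n : (fX 1 * g)%fp (S n) = g n.
Proof. rewrite fX_mul. simpl. rewrite Nat.sub_0_r. reflexivity. Qed.

Lemma fD_X r : fD (fX r) = (fC (INR r) * fX r)%fp.
Proof.
  rewrite fmul_C. apply fps_ext; intros n. unfold fD, fscal, fX.
  destruct (Nat.eqb_spec n r); subst; ring.
Qed.

(** * Congruence modulo q^N *)

Definition eqm (N : nat) (f g : fps) : Prop := forall n, (n < N)%nat -> f n = g n.

Lemma eqm_refl N f : eqm N f f.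
Proof. intros n _; reflexivity. Qed.
Lemma eqm_sym N f g : eqm N f g -> eqm N g f.
Proof. intros H n Hn; symmetry; auto. Qed.
Lemma eqm_trans N f g h : eqm N f g -> eqm N g h -> eqm N f h.
Proof. intros H K n Hn; rewrite H, K; auto. Qed.
Lemma eqm_add N f g f' g' : eqm N f f' -> eqm N g g' -> eqm N (f + g)%fp (f' + g')%fp.
Proof. intros H K n Hn; unfold fadd; rewrite H, K; auto. Qed.
Lemma eqm_sub N f g f' g' : eqm N f f' -> eqm N g g' -> eqm N (f - g)%fp (f' - g')%fp.
Proof. intros H K n Hn; unfold fsub; rewrite H, K; auto. Qed.
Lemma eqm_mul N f g f' g' : eqm N f f' -> eqm N g g' -> eqm N (f * g)%fp (f' * g')%fp.
Proof. intros H K n Hn; apply fmul_congr; intros; [apply H | apply K]; lia. Qed.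
Lemma eqm_pow N f f' k : eqm N f f' -> eqm N (f ^ k)%fp (f' ^ k)%fp.
Proof. intros H; induction k; simpl; [apply eqm_refl | apply eqm_mul; auto]. Qed.
Lemma eqm_le M N f g : (M <= N)%nat -> eqm N f g -> eqm M f g.
Proof. intros L H n Hn; apply H; lia. Qed.
Lemma eqm_X1 N f f' : eqm N f f' -> eqm (S N) (fX 1 * f)%fp (fX 1 * f')%fp.
Proof.
  intros H [|n] Hn; [rewrite !fX_mul; reflexivity|]. rewrite !fX1_S. apply H; lia.
Qed.
Lemma eqm_Xmul N r f : (N <= r)%nat -> eqm N (fX r * f)%fp (fC 0).
Proof.
  intros H n Hn. rewrite fX_mul. destruct (Nat.ltb_spec n r); [|lia]. destruct n; reflexivity.
Qed.
Lemma eqm_all f g : (forall N, eqm N f g) -> f = g.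
Proof. intros H; apply fps_ext; intros n; apply (H (S n)); lia. Qed.

(** * Fixed points of strictly causal operators *)

(** The n-th entry of the N-th iterate no longer changes once N > n, so the diagonal of the iterates
    is a fixed point. *)
Lemma causal_fixpoint (T : Type) (x0 : nat -> T) (Phi : (nat -> T) -> (nat -> T)) :
  (forall n x y, (forall i, (i < n)%nat -> x i = y i) -> Phi x n = Phi y n) ->
  exists x, forall n, x n = Phi x n.
Proof.
  intros H.
  set (it := fun N => Nat.iter N Phi x0).
  assert (St : forall n N M, (n < N)%nat -> (n < M)%nat -> it N n = it M n).
  { induction n as [n IH] using (well_founded_induction lt_wf).
    intros [|N] [|M] HN HM; try lia. apply (H n). intros i Hi. apply IH; lia. }
  exists (fun n => it (S n) n). intros n. apply (H n).
  intros i Hi. apply St; lia.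
Qed.

Lemma finv_exists f : f O <> 0 -> exists g, (f * g)%fp = fC 1.
Proof.
  intros Hf.
  destruct (causal_fixpoint R (fC 1)
    (fun g n => match n with O => / f O | S m => - / f O * fmul (ftail f) g m end)) as [g Hg].
  - intros [|n] x y Hxy; [reflexivity|]. f_equal. apply fmul_congr; [reflexivity|].
    intros i Hi; apply Hxy; lia.
  - exists g. apply fps_ext; intros [|n]; simpl; rewrite Hg; field; auto.
Qed.

(** * Logarithmic derivatives *)

(** The product form avoids dividing by f, and the constant coefficient 1 makes L determine f. *)
Definition LD (f L : fps) : Prop := f O = 1 /\ fD f = (f * L)%fp.

Lemma LD_0 f L : LD f L -> L O = 0.
Proof.
  intros [H0 H]. apply (f_equal (fun g : fps => g O)) in H. simpl in H.
  unfold fD in H. simpl in H. rewrite H0 in H. lra.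
Qed.

(** Because L has constant coefficient 0, the equation expresses n f_n through f_0, ..., f_(n-1). *)
Lemma LD_unique f g L : LD f L -> LD g L -> f = g.
Proof.
  intros Hf Hg. assert (L0 := LD_0 _ _ Hf). destruct Hf as [f0 Hf], Hg as [g0 Hg].
  apply fps_ext. intros n. induction n as [n IH] using (well_founded_induction lt_wf).
  destruct n as [|n]; [congruence|].
  apply (f_equal (fun h : fps => h (S n))) in Hf, Hg.
  rewrite fmul_Sr, L0, Rmult_0_r, Rplus_0_l in Hf, Hg. unfold fD in Hf, Hg.
  rewrite (fmul_congr f (ftail L) g (ftail L)) in Hf by (intros; auto; apply IH; lia).
  apply (Rmult_eq_reg_l (INR (S n))); [congruence | apply not_0_INR; lia].
Qed.

Lemma LD_1 : LD (fC 1) (fC 0).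
Proof. split; [reflexivity | rewrite fD_C; ring]. Qed.
Lemma LD_mul f g L M : LD f L -> LD g M -> LD (f * g)%fp (L + M)%fp.
Proof.
  intros [f0 Hf] [g0 Hg]; split; [simpl; rewrite f0, g0; ring|].
  rewrite fD_mul, Hf, Hg; ring.
Qed.
Lemma LD_pow f L n : LD f L -> LD (f ^ n)%fp (fC (INR n) * L)%fp.
Proof.
  intros Hf; induction n as [|n IH].
  - replace (fC (INR 0) * L)%fp with (fC 0) by (change (INR 0) with 0; ring). apply LD_1.
  - rewrite S_INR, fC_add. replace ((fC (INR n) + fC 1) * L)%fp with (L + fC (INR n) * L)%fp by ring.
    apply LD_mul; auto.
Qed.
Lemma LD_inv f g L : LD f L -> (f * g)%fp = fC 1 -> LD g (- L)%fp.
Proof.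
  intros [f0 Hf] H; split.
  - apply (f_equal (fun h : fps => h O)) in H. simpl in H. rewrite f0 in H. lra.
  - assert (E := f_equal fD H). rewrite fD_mul, fD_C, Hf in E.
    replace (fD g) with (fC 1 * fD g)%fp by ring. rewrite <- H.
    replace (f * g * fD g)%fp with (g * (f * L * g + f * fD g) - (f * g) * (L * g))%fp by ring.
    rewrite E, H. ring.
Qed.
Lemma LD_ext f L M : LD f L -> L = M -> LD f M.
Proof. intros H <-; exact H. Qed.

(** * The uniformizing system *)

Definition ev (l : list R) (t : fps) : fps :=
  fold_right (fun c (acc : fps) => (fC c + t * acc)%fp) (fC 0) l.

(** In the language of modular forms t is the Hauptmodul of X_0(12) vanishing at infinity, with
    the values -1/2, -1/3, -1/4, -1/6 and its pole at the other cusps, A = eta(z)^6 eta(6z) /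
    (eta(2z)^3 eta(3z)^2) and B = q A'/A. The differential system [q t' = t (pre t) A^2],
    [q A' = A B], [q B' = B^2 - A^4 (spol t)] was found by comparing q-expansions. *)
Definition pre (t : fps) : fps :=
  ((fZ 1 + fZ 2 * t) * (fZ 1 + fZ 3 * t) * (fZ 1 + fZ 4 * t) * (fZ 1 + fZ 6 * t))%fp.

Definition spol (t : fps) : fps :=
  (t * pre t * (fZ 6 + fZ 96 * t + fZ 432 * t ^ 2 + fZ 576 * t ^ 3))%fp.

(** The inverse of D + 1. It arises from D(q x) = q (D x + x): once a factor q is removed, each
    equation has the form D x + x = h. *)
Definition idiv (h : fps) : fps := fun n => h n / INR (S n).

Lemma idiv_spec h : (fD (idiv h) + idiv h)%fp = h.
Proof.
  apply fps_ext; intros n. unfold fadd, fD, idiv. rewrite S_INR.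
  assert (0 <= INR n) by apply pos_INR. field. lra.
Qed.

Lemma eqm_idiv N h h' : eqm N h h' -> eqm N (idiv h) (idiv h').
Proof. intros H n Hn; unfold idiv; rewrite H; auto. Qed.

(** The system is solved for [b], [a], [v] where [B = q b], [A = 1 + q a] and
    [t = q (1 + q v)]: with these shifts it becomes strictly causal. *)
Definition stepb (b a v : fps) : fps :=
  let t := (fX 1 * (fZ 1 + fX 1 * v))%fp in
  idiv (fX 1 * b ^ 2 - (fZ 1 + fX 1 * a) ^ 4 * (fZ 1 + fX 1 * v) * pre t
          * (fZ 6 + fZ 96 * t + fZ 432 * t ^ 2 + fZ 576 * t ^ 3))%fp.
Definition stepa (b a : fps) : fps := idiv ((fZ 1 + fX 1 * a) * b)%fp.
(** The argument of [idiv] is u (pre(t) A^2 - 1)/q, written without division: 2a + q a^2 is (A^2 -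
    1)/q, the cubic is (pre(t) - 1)/t, and t = q u. *)
Definition stepv (a v : fps) : fps :=
  let u := (fZ 1 + fX 1 * v)%fp in let t := (fX 1 * u)%fp in
  idiv (u * ((fZ 2 * a + fX 1 * a ^ 2) * pre t
          + u * (fZ 15 + fZ 80 * t + fZ 180 * t ^ 2 + fZ 144 * t ^ 3)))%fp.

Ltac eqm_tac :=
  repeat match goal with
  | H : eqm ?n ?f ?g |- eqm ?n ?f ?g => exact H
  | |- eqm _ ?f ?f => apply eqm_refl
  | |- eqm (S _) (fX 1 * _)%fp _ => apply eqm_X1
  | |- eqm _ (idiv _) _ => apply eqm_idiv
  | |- eqm _ (_ + _)%fp _ => apply eqm_add
  | |- eqm _ (_ - _)%fp _ => apply eqm_sub
  | |- eqm _ (_ * _)%fp _ => apply eqm_mul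
  | |- eqm _ (_ ^ _)%fp _ => apply eqm_pow
  end.

Lemma stepb_causal n b a v b' a' v' :
  eqm n b b' -> eqm n a a' -> eqm n v v' -> eqm (S n) (stepb b a v) (stepb b' a' v').
Proof. intros; unfold stepb, pre; cbv zeta; eqm_tac. Qed.
Lemma stepa_causal n b a b' a' :
  eqm (S n) b b' -> eqm n a a' -> eqm (S n) (stepa b a) (stepa b' a').
Proof. intros; unfold stepa; eqm_tac. Qed.
Lemma stepv_causal n a v a' v' :
  eqm (S n) a a' -> eqm n v v' -> eqm (S n) (stepv a v) (stepv a' v').
Proof.
  intros Ha Hv. assert (Ha' := eqm_le n (S n) _ _ (Nat.le_succ_diag_r n) Ha).
  unfold stepv, pre; cbv zeta; eqm_tac.
Qed.

(** In [stepa] the series b, and in [stepv] the series a, occurs without a factor q. The operator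
    therefore feeds the new b into a and the new a into v, which restores strict causality. *)
Lemma system_exists : exists b a v : fps,
  b = stepb b a v /\ a = stepa b a /\ v = stepv a v.
Proof.
  set (p1 := fun (x : nat -> R * R * R) n => fst (fst (x n))).
  set (p2 := fun (x : nat -> R * R * R) n => snd (fst (x n))).
  set (p3 := fun (x : nat -> R * R * R) n => snd (x n)).
  set (nb := fun x => stepb (p1 x) (p2 x) (p3 x)).
  set (na := fun x => stepa (nb x) (p2 x)).
  set (nv := fun x => stepv (na x) (p3 x)).
  destruct (causal_fixpoint (R * R * R) (fun _ => (0, 0, 0))
    (fun x n => (nb x n, na x n, nv x n))) as [x Hx].
  - intros n x y H.
    assert (E1 : eqm n (p1 x) (p1 y)) by (intros i Hi; unfold p1; rewrite H; auto).
    assert (E2 : eqm n (p2 x) (p2 y)) by (intros i Hi; unfold p2; rewrite H; auto).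
    assert (E3 : eqm n (p3 x) (p3 y)) by (intros i Hi; unfold p3; rewrite H; auto).
    assert (F1 : eqm (S n) (nb x) (nb y)) by (apply stepb_causal; auto).
    assert (F2 : eqm (S n) (na x) (na y)) by (apply stepa_causal; auto).
    assert (F3 : eqm (S n) (nv x) (nv y)) by (apply stepv_causal; auto).
    rewrite F1, F2, F3 by lia. reflexivity.
  - assert (E1 : p1 x = nb x) by (apply fps_ext; intros n; unfold p1; rewrite Hx; reflexivity).
    assert (E2 : p2 x = na x) by (apply fps_ext; intros n; unfold p2; rewrite Hx; reflexivity).
    assert (E3 : p3 x = nv x) by (apply fps_ext; intros n; unfold p3; rewrite Hx; reflexivity).
    exists (p1 x), (p2 x), (p3 x). split; [exact E1|]. split.
    + rewrite E2 at 1. unfold na. rewrite <- E1. reflexivity.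
    + rewrite E3 at 1. unfold nv. rewrite <- E2. reflexivity.
Qed.

(** * Exact integer computation of the first coefficients *)

Fixpoint zmul (f g : nat -> Z) (n : nat) : Z :=
  match n with
  | O => f O * g O
  | S m => f O * g (S m) + zmul (fun i => f (S i)) g m
  end%Z.
Definition zco (l : list Z) (n : nat) : Z := nth n l 0%Z.
Definition ztab (N : nat) (f : nat -> Z) : list Z := map f (seq 0 N).
Definition zladd (N : nat) (l m : list Z) : list Z := ztab N (fun n => zco l n + zco m n)%Z.
Definition zlsub (N : nat) (l m : list Z) : list Z := ztab N (fun n => zco l n - zco m n)%Z.
(** A proposed result of [idiv] is tested by multiplying back with n + 1, so the computation stays
    in the integers. *)
Definition zcheck (N : nat) (l m : list Z) : bool :=
  forallb (fun n => (zco l n =? Z.of_nat (S n) * zco m n)%Z) (seq 0 N).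
(** Beyond the end of the list [zco] is 0, so a short list stands for a polynomial and N alone fixes
    the precision. *)
Definition rep (N : nat) (f : fps) (l : list Z) : Prop :=
  forall n, (n < N)%nat -> f n = IZR (zco l n).

Lemma zco_tab N f n : (n < N)%nat -> zco (ztab N f) n = f n.
Proof.
  intros H. unfold zco, ztab. rewrite (nth_indep _ 0%Z (f O)) by (rewrite length_map, length_seq; auto).
  rewrite map_nth, seq_nth by auto. reflexivity.
Qed.

Lemma IZR_zmul f g n : IZR (zmul f g n) = fmul (fun i => IZR (f i)) (fun i => IZR (g i)) n.
Proof.
  revert f; induction n as [|n IH]; intros f; simpl.
  - apply mult_IZR.
  - rewrite plus_IZR, mult_IZR, IH. reflexivity.
Qed.

Lemma rep_mul N f g l m : rep N f l -> rep N g m ->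
  rep N (f * g)%fp (ztab N (zmul (zco l) (zco m))).
Proof.
  intros Hf Hg n Hn. rewrite zco_tab, IZR_zmul by auto.
  apply fmul_congr; intros; [apply Hf | apply Hg]; lia.
Qed.
Lemma rep_add N f g l m : rep N f l -> rep N g m ->
  rep N (f + g)%fp (zladd N l m).
Proof. intros Hf Hg n Hn. unfold zladd. rewrite zco_tab, plus_IZR by auto. unfold fadd. rewrite Hf, Hg; auto. Qed.
Lemma rep_sub N f g l m : rep N f l -> rep N g m ->
  rep N (f - g)%fp (zlsub N l m).
Proof. intros Hf Hg n Hn. unfold zlsub. rewrite zco_tab, minus_IZR by auto. unfold fsub. rewrite Hf, Hg; auto. Qed.
Lemma rep_C N z : rep N (fC (IZR z)) [z].
Proof. intros [|[|n]] Hn; reflexivity. Qed.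
Lemma rep_X1 N f l : rep N f l -> rep (S N) (fX 1 * f)%fp (0%Z :: l).
Proof.
  intros H [|n] Hn; rewrite fX_mul; [reflexivity|]. simpl. rewrite Nat.sub_0_r. apply H; lia.
Qed.
Lemma rep_le M N f l : (M <= N)%nat -> rep N f l -> rep M f l.
Proof. intros L H n Hn; apply H; lia. Qed.
Fixpoint zpow (N : nat) (l : list Z) (k : nat) : list Z :=
  match k with O => [1%Z] | S j => ztab N (zmul (zco l) (zco (zpow N l j))) end.
Lemma rep_pow N f l k : rep N f l -> rep N (f ^ k)%fp (zpow N l k).
Proof. intros H; induction k; [apply rep_C | apply rep_mul; auto]. Qed.
Lemma rep_idiv N f l m : rep N f l ->
  zcheck N l m = true -> rep N (idiv f) m.
Proof.
  intros H E n Hn. unfold zcheck in E. rewrite forallb_forall in E.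
  assert (En := E n ltac:(apply in_seq; lia)). apply Z.eqb_eq in En.
  unfold idiv. rewrite H, En, mult_IZR, <- INR_IZR_INZ by auto. field. apply not_0_INR; lia.
Qed.

Ltac rep_tac :=
  repeat match goal with
  | H : rep ?n ?f ?l |- rep ?n ?f _ => exact H
  | |- rep (S _) (fX 1 * _)%fp _ => apply rep_X1
  | H : rep ?m ?f ?l |- rep ?n ?f _ => apply (rep_le n m f l); [repeat constructor | exact H]
  | |- rep _ (fC (IZR _)) _ => apply rep_C
  | |- rep _ (fZ _) _ => apply rep_C
  | |- rep _ (_ + _)%fp _ => apply rep_add
  | |- rep _ (_ - _)%fp _ => apply rep_sub
  | |- rep _ (_ * _)%fp _ => apply rep_mul
  | |- rep _ (_ ^ _)%fp _ => apply rep_pow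
  end.

Definition bhat : list Z := [-6; -12; -18; -24; -36; -36; -48; -48; -54; -72; -72; -72]%Z.
Definition ahat : list Z := [-6; 12; -6; -6; 0; 12; -12; 12; -6; 0; 0; -6]%Z.
Definition vhat : list Z := [3; 7; 15; 30; 57; 104; 183; 313; 522; 852; 1365; 2150]%Z.

(** These coefficients are needed because the Ramanujan system determines E_2(q^r), for r up to
    12, only up to its coefficient of q^r. *)
Lemma system_coefs b a v : b = stepb b a v -> a = stepa b a -> v = stepv a v ->
  rep 12 b bhat /\ rep 12 a ahat /\ rep 12 v vhat.
Proof.
  intros Hb Ha Hv.
  set (F := fun (l : list Z) (n : nat) => IZR (zco l n)).
  assert (R0 : forall N l, rep N (F l) l) by (intros N l n Hn; reflexivity).
  assert (Rb := R0 12%nat bhat). assert (Ra := R0 12%nat ahat). assert (Rv := R0 12%nat vhat).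
  assert (Sb : rep 12 (stepb (F bhat) (F ahat) (F vhat)) bhat).
  { unfold stepb, pre; cbv zeta. eapply rep_idiv; [rep_tac | vm_compute; reflexivity]. }
  assert (Sa : rep 12 (stepa (F bhat) (F ahat)) ahat).
  { unfold stepa; cbv zeta. eapply rep_idiv; [rep_tac | vm_compute; reflexivity]. }
  assert (Sv : rep 12 (stepv (F ahat) (F vhat)) vhat).
  { unfold stepv, pre; cbv zeta. eapply rep_idiv; [rep_tac | vm_compute; reflexivity]. }
  (* The lists, extended by zeros, satisfy the three equations modulo q^12; causality then carries
     the agreement with the true solution from n to n + 1 coefficients, again in the order b, a,
     v. *)
  assert (M : forall n, (n <= 12)%nat -> eqm n b (F bhat) /\ eqm n a (F ahat) /\ eqm n v (F vhat)).
  { induction n as [|n IH]; intros Hn; [repeat split; intros i Hi; lia|].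
    destruct IH as [E1 [E2 E3]]; [lia|].
    assert (Cut : forall f l, rep 12 f l -> eqm (S n) f (F l)) by (intros f l K i Hi; apply K; lia).
    assert (G1 : eqm (S n) b (F bhat)).
    { rewrite Hb. eapply eqm_trans; [apply stepb_causal; eassumption | auto]. }
    assert (G2 : eqm (S n) a (F ahat)).
    { rewrite Ha. eapply eqm_trans; [apply stepa_causal; eassumption | auto]. }
    repeat split; auto.
    rewrite Hv. eapply eqm_trans; [apply stepv_causal; eassumption | auto]. }
  destruct (M 12%nat (le_n _)) as [E1 [E2 E3]]. repeat split; assumption.
Qed.

(** Candidates for r E_2(q^r) = 12 B + A^2 (e2pol r)(t), r^2 E_4(q^r) = A^4 (e4pol r)(t) and
    r^3 E_6(q^r) = A^6 (e6pol r)(t), again read off from q-expansions. *)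
Definition e2pol (r : nat) : list R :=
  match r with
  | 1 => [1; 60; 552; 1728; 1728]
  | 2 => [2; 96; 840; 2592; 2592]
  | 3 => [3; 108; 936; 2880; 2880]
  | 4 => [4; 120; 984; 3024; 3024]
  | 6 => [6; 144; 1080; 3168; 3168]
  | 12 => [12; 216; 1368; 3600; 3312]
  | _ => []
  end.
Definition e4pol (r : nat) : list R :=
  match r with
  | 1 => [1; 264; 7440; 89856; 587520; 2239488; 4976640; 5971968; 2985984]
  | 2 => [4; 96; 1920; 22464; 146880; 559872; 1244160; 1492992; 746496]
  | 3 => [9; 216; 2160; 13824; 69120; 248832; 552960; 663552; 331776]
  | 4 => [16; 384; 3840; 20736; 69120; 165888; 311040; 373248; 186624]
  | 6 => [36; 864; 8640; 46656; 146880; 269568; 276480; 165888; 82944]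
  | 12 => [144; 3456; 34560; 186624; 587520; 1078272; 1071360; 456192; 20736]
  | _ => []
  end.
Definition e6pol (r : nat) : list R :=
  match r with
  | 1 => [1; (-468); (-32688); (-857952); (-12350880); (-111787776); (-677693952); (-2830712832); (-8187568128); (-16124313600); (-20639121408); (-15479341056); (-5159780352)]
  | 2 => [8; 288; 576; (-77760); (-1446336); (-13810176); (-84602880); (-353839104); (-1023446016); (-2015539200); (-2579890176); (-1934917632); (-644972544)]
  | 3 => [27; 972; 15552; 132192; 520992; (-559872); (-17293824); (-95551488); (-298598400); (-597196800); (-764411904); (-573308928); (-191102976)]
  | 4 => [64; 2304; 36864; 345600; 2073600; 7962624; 17293824; 6718464; (-75022848); (-228427776); (-322486272); (-241864704); (-80621568)]
  | 6 => [216; 7776; 124416; 1166400; 7107264; 29486592; 84602880; 165722112; 208272384; 134369280; (-11943936); (-71663616); (-23887872)]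
  | 12 => [1728; 62208; 995328; 9331200; 56858112; 235892736; 677693952; 1341453312; 1778526720; 1482541056; 677818368; 116453376; (-2985984)]
  | _ => []
  end.

(** The last clause holds the initial data of r E_2(q^r) = r - 24 r q^r - ..., namely the constant
    and the resonant coefficient. The quotient u = t/q is recorded because a logarithmic derivative
    requires constant coefficient 1. *)
Lemma uniformizer_exists : exists B A u t : fps,
  t = (fX 1 * u)%fp /\ u O = 1 /\ A O = 1 /\ B O = 0 /\
  fD B = (B ^ 2 - A ^ 4 * spol t)%fp /\ fD A = (A * B)%fp /\ fD t = (t * pre t * A ^ 2)%fp /\
  fD u = (u * (pre t * A ^ 2 - fZ 1))%fp /\
  forall r, List.In r [1; 2; 3; 4; 6; 12]%nat ->
    (fZ 12 * B + A ^ 2 * ev (e2pol r) t)%fp O = INR r /\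
    (fZ 12 * B + A ^ 2 * ev (e2pol r) t)%fp r = - 24 * INR r.
Proof.
  destruct system_exists as [b [a [v [Hb [Ha Hv]]]]].
  destruct (system_coefs b a v Hb Ha Hv) as [Rb [Ra Rv]].
  exists (fX 1 * b)%fp, (fZ 1 + fX 1 * a)%fp, (fZ 1 + fX 1 * v)%fp, (fX 1 * (fZ 1 + fX 1 * v))%fp.
  assert (DX : fD (fX 1) = fX 1) by (rewrite fD_X; change (INR 1) with 1; ring).
  assert (St : forall x h : fps, x = idiv h -> (fD x + x)%fp = h) by (intros x h ->; apply idiv_spec).
  assert (Eb := St _ _ Hb). assert (Ea := St _ _ Ha). assert (Ev := St _ _ Hv).
  assert (Du : fD (fZ 1 + fX 1 * v)%fp = ((fZ 1 + fX 1 * v)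
     * (pre (fX 1 * (fZ 1 + fX 1 * v)) * (fZ 1 + fX 1 * a) ^ 2 - fZ 1))%fp).
  { rewrite fD_add, fD_mul, DX. unfold fZ at 1. rewrite fD_C.
    replace (fC 0 + (fX 1 * v + fX 1 * fD v))%fp with (fX 1 * (fD v + v))%fp by ring.
    rewrite Ev. unfold pre. ring. }
  repeat match goal with |- _ /\ _ => split end; auto.
  - unfold fadd; rewrite fX_mul; simpl; ring.
  - unfold fadd; rewrite fX_mul; simpl; ring.
  - rewrite fX_mul; reflexivity.
  - rewrite fD_mul, DX. replace (fX 1 * b + fX 1 * fD b)%fp with (fX 1 * (fD b + b))%fp by ring.
    rewrite Eb. unfold spol. ring.
  - rewrite fD_add, fD_mul, DX. unfold fZ at 1. rewrite fD_C.
    replace (fC 0 + (fX 1 * a + fX 1 * fD a))%fp with (fX 1 * (fD a + a))%fp by ring.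
    rewrite Ea. ring.
  - rewrite fD_mul, DX, Du. ring.
  - assert (K : forall N (f : fps) l n z, rep N f l -> (n < N)%nat -> (zco l n = z)%Z -> f n = IZR z)
      by (intros N f l n z H1 H2 <-; auto).
    intros r Hr. simpl in Hr. rewrite INR_IZR_INZ, <- mult_IZR.
    repeat destruct Hr as [<-|Hr]; try contradiction; cbn [ev fold_right e2pol]; split;
      (* Twelve coefficients of b, a, v give thirteen of B, A, t, each being shifted by a factor q;
         this just reaches q^12. *)
      (eapply (K 13%nat); [rep_tac | lia | vm_compute; reflexivity]).
Qed.

(** * Ramanujan's differential equations for (E_2, E_4, E_6) *)

Definition ramanujan_system (Q F H : fps) : Prop :=
  (fZ 12 * fD Q = Q ^ 2 - F /\ fZ 3 * fD F = Q * F - H /\ fZ 2 * fD H = Q * H - F ^ 2)%fp.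

(** The Euler operator t d/dt on coefficient lists; n is the degree of the head coefficient. *)
Fixpoint dl_from (n : nat) (l : list R) : list R :=
  match l with [] => [] | c :: l' => (INR n * c) :: dl_from (S n) l' end.
Definition dl (l : list R) : list R := dl_from 0 l.

Lemma ev_dl_from n l t : ev (dl_from n l) t = (fC (INR n) * ev l t + ev (dl_from 0 l) t)%fp.
Proof.
  revert n; induction l as [|c l IH]; intros n; cbn [dl_from ev fold_right]; [ring|].
  fold (ev l t) (ev (dl_from (S n) l) t) (ev (dl_from 1 l) t).
  rewrite (IH (S n)), (IH 1%nat), (S_INR n), !fC_mul, fC_add. change (INR 0) with 0. change (INR 1) with 1.
  ring.
Qed.

Lemma fD_ev l t w : fD t = (t * w)%fp -> fD (ev l t) = (ev (dl l) t * w)%fp.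
Proof.
  intros Ht. unfold dl. induction l as [|c l IH]; simpl; [rewrite fD_C; ring|].
  fold (ev l t) (ev (dl_from 1 l) t).
  rewrite fD_add, fD_mul, fD_C, IH, Ht, (ev_dl_from 1), fC_mul. change (INR 1) with 1. change (fC 0) with (fZ 0). ring.
Qed.

Ltac each_divisor Hr :=
  simpl in Hr; repeat destruct Hr as [<-|Hr]; try contradiction.
Ltac expand_ev :=
  cbn [ev fold_right e2pol e4pol e6pol dl dl_from]; rewrite ?INR_IZR_INZ; cbn [Z.of_nat Pos.of_succ_nat Pos.succ];
  rewrite <- ?mult_IZR;
  repeat match goal with |- context [IZR (?a * ?b)] =>
    let c := eval vm_compute in (a * b)%Z in change (IZR (a * b)) with (IZR c) end.

(** Substituting Q = 12 B + A^2 p(t) into 12 D Q = Q^2 - F, all terms containing B cancel and F/A^4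
    is left as a polynomial in t. The next two identities arise in the same way from the other two
    equations. *)
Lemma e4pol_eq t r : List.In r [1; 2; 3; 4; 6; 12]%nat ->
  ev (e4pol r) t = (ev (e2pol r) t ^ 2 + fZ 144 * spol t - fZ 12 * (ev (dl (e2pol r)) t * pre t))%fp.
Proof. intros Hr; each_divisor Hr; unfold spol, pre; expand_ev; ring. Qed.
Lemma e6pol_eq t r : List.In r [1; 2; 3; 4; 6; 12]%nat ->
  ev (e6pol r) t = (ev (e2pol r) t * ev (e4pol r) t - fZ 3 * (ev (dl (e4pol r)) t * pre t))%fp.
Proof. intros Hr; each_divisor Hr; unfold pre; expand_ev; ring. Qed.
Lemma e8pol_eq t r : List.In r [1; 2; 3; 4; 6; 12]%nat ->
  (fZ 2 * (ev (dl (e6pol r)) t * pre t) = ev (e2pol r) t * ev (e6pol r) t - ev (e4pol r) t ^ 2)%fp.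
Proof. intros Hr; each_divisor Hr; unfold pre; expand_ev; ring. Qed.

Lemma uniformized_system B A t :
  fD B = (B ^ 2 - A ^ 4 * spol t)%fp -> fD A = (A * B)%fp -> fD t = (t * pre t * A ^ 2)%fp ->
  forall r, List.In r [1; 2; 3; 4; 6; 12]%nat ->
  ramanujan_system (fZ 12 * B + A ^ 2 * ev (e2pol r) t)%fp
    (A ^ 4 * ev (e4pol r) t)%fp (A ^ 6 * ev (e6pol r) t)%fp.
Proof.
  intros HB HA Ht r Hr.
  assert (Ht' : fD t = (t * (pre t * A ^ 2))%fp) by (rewrite Ht; ring).
  assert (DA : forall n, fD (A ^ n)%fp = (fC (INR n) * A ^ n * B)%fp).
  { intros n. rewrite fD_pow, HA. destruct n as [|n]; [change (INR 0) with 0; ring|].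
    replace (S n - 1)%nat with n by lia. simpl fpow. ring. }
  assert (DP := fD_ev (e2pol r) t _ Ht'). assert (DF := fD_ev (e4pol r) t _ Ht').
  assert (DH := fD_ev (e6pol r) t _ Ht').
  assert (U1 := e4pol_eq t r Hr). assert (U2 := e6pol_eq t r Hr). assert (U3 := e8pol_eq t r Hr).
  set (p := ev (e2pol r) t) in *. set (F := ev (e4pol r) t) in *. set (H := ev (e6pol r) t) in *.
  set (p' := ev (dl (e2pol r)) t) in *. set (F' := ev (dl (e4pol r)) t) in *.
  set (H' := ev (dl (e6pol r)) t) in *.
  repeat split; unfold fZ; rewrite ?fD_add, ?fD_mul, ?DA, ?fD_C, ?DP, ?DF, ?DH, ?HB;
    rewrite ?INR_IZR_INZ; simpl Z.of_nat.
  - clear - U1. clearbody p F p'. subst F. ring.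
  - clear - U2. clearbody p F F' H. subst H. ring.
  - clear - U3. clearbody p F H H'.
    match goal with |- ?L = _ => replace L with (A ^ 8 * (fZ 2 * (H' * pre t)) + fZ 12 * A ^ 6 * B * H)%fp by ring end.
    rewrite U3. ring.
Qed.

(** Differences first appear in the coefficient n + 1, so only the two products with a constant term
    feel them: this is the linearised product. *)
Lemma fmul_perturb f g f' g' n : eqm (S n) f f' -> eqm (S n) g g' ->
  fmul f g (S n) - fmul f' g' (S n)
  = f O * (g (S n) - g' (S n)) + g O * (f (S n) - f' (S n)).
Proof.
  intros Hf Hg. cbn [fmul]. rewrite <- (Hf O) by lia.
  destruct n as [|n].
  - cbn [fmul]. rewrite <- (Hg O) by lia. unfold ftail. ring.
  - rewrite !fmul_Sr. rewrite <- (Hg O) by lia. change (ftail f (S n)) with (f (S (S n))). change (ftail f' (S n)) with (f' (S (S n))).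
    rewrite (fmul_congr (ftail f) (ftail g) (ftail f') (ftail g')); [ring | |];
      intros i Hi; [apply Hf | apply Hg]; lia.
Qed.

(** The linearization at the constant solution (r, r^2, r^3) has the eigenvalues 0, 0 and r,
    so the only free coefficient beyond the constant ones is that of q^r. *)
Lemma ramanujan_unique r Q F H Q' F' H' : (0 < r)%nat ->
  ramanujan_system Q F H -> ramanujan_system Q' F' H' ->
  Q O = INR r -> Q' O = INR r -> F O = INR r ^ 2 -> F' O = INR r ^ 2 ->
  H O = INR r ^ 3 -> H' O = INR r ^ 3 -> Q r = Q' r -> Q = Q' /\ F = F' /\ H = H'.
Proof.
  intros Hr [S1 [S2 S3]] [T1 [T2 T3]] Q0 Q0' F0 F0' H0 H0' Qr.
  assert (K : forall n, Q n = Q' n /\ F n = F' n /\ H n = H' n).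
  { intros n. induction n as [n IH] using (well_founded_induction lt_wf).
    destruct n as [|n]; [rewrite Q0, Q0', F0, F0', H0, H0'; auto|].
    assert (EQ : eqm (S n) Q Q') by (intros i Hi; apply IH; auto).
    assert (EF : eqm (S n) F F') by (intros i Hi; apply IH; auto).
    assert (EH : eqm (S n) H H') by (intros i Hi; apply IH; auto).
    assert (P1 := fmul_perturb Q Q Q' Q' n EQ EQ). assert (P2 := fmul_perturb Q F Q' F' n EQ EF).
    assert (P3 := fmul_perturb Q H Q' H' n EQ EH). assert (P4 := fmul_perturb F F F' F' n EF EF).
    replace (Q ^ 2)%fp with (Q * Q)%fp in * by ring. replace (Q' ^ 2)%fp with (Q' * Q')%fp in * by ring.
    replace (F ^ 2)%fp with (F * F)%fp in * by ring. replace (F' ^ 2)%fp with (F' * F')%fp in * by ring.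
    assert (W : forall (f g : fps), f = g -> f (S n) = g (S n)) by (intros f g ->; auto).
    apply W in S1, S2, S3, T1, T2, T3.
    unfold fZ in S1, S2, S3, T1, T2, T3. rewrite fmul_C in S1, S2, S3, T1, T2, T3.
    unfold fscal, fD, fsub in S1, S2, S3, T1, T2, T3.
    rewrite Q0 in *. rewrite F0 in *. rewrite H0 in *.
    set (x := Q (S n) - Q' (S n)) in *. set (y := F (S n) - F' (S n)) in *.
    set (z := H (S n) - H' (S n)) in *. set (m := INR (S n)) in *. set (c := INR r) in *.
    assert (Y1 : 12 * (m * x) = 2 * c * x - y) by (unfold x, y in *; lra).
    assert (Y2 : 3 * (m * y) = c * y + c ^ 2 * x - z) by (unfold x, y, z in *; lra).
    assert (Y3 : 2 * (m * z) = c * z + c ^ 3 * x - 2 * c ^ 2 * y) by (unfold x, y, z in *; lra).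
    assert (m0 : 0 < m) by (apply lt_0_INR; lia).
    assert (X0 : x = 0).
    (* At n + 1 = r the linear system is singular and the hypothesis on the coefficient of q^r
       decides. *)
    { destruct (Nat.eq_dec (S n) r) as [E|E]; [unfold x; rewrite E, Qr; ring|].
      assert (mc : m - c <> 0) by (intros e; apply E, INR_eq; unfold m, c in e; lra).
      assert (y = (2 * c - 12 * m) * x) by lra.
      assert (z = c * y + c ^ 2 * x - 3 * m * y) by lra. subst z y.
      clearbody x m c.
      (* Eliminating y and z leaves 72 m^2 (m - r) x = 0, in which the eigenvalues 0, 0, r are
         visible. *)
      apply (Rmult_eq_reg_l (72 * m ^ 2 * (m - c))).
      2:{ apply Rmult_integral_contrapositive; split; auto.
          apply Rgt_not_eq. assert (0 < m ^ 2) by nra. lra. }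
      rewrite Rmult_0_r. nra. }
    rewrite X0 in *. assert (Y0 : y = 0) by lra. rewrite Y0 in *. assert (z = 0) by lra.
    unfold x, y, z in *. repeat split; lra. }
  repeat split; apply fps_ext; intros n; apply K.
Qed.

(** * Finite sums over lists *)

Definition sumL {T : Type} (l : list T) (f : T -> R) : R := fold_right (fun x acc => f x + acc) 0 l.

Lemma sumL_cons {T} x (l : list T) f : sumL (x :: l) f = f x + sumL l f.
Proof. reflexivity. Qed.
Lemma sumL_ext {T} (l : list T) f g : (forall x, List.In x l -> f x = g x) -> sumL l f = sumL l g.
Proof.
  induction l as [|x l IH]; intros H; simpl; [reflexivity|].
  rewrite (H x), IH; auto; [intros; apply H; right; auto | left; auto].
Qed.
Lemma sumL_app {T} (l m : list T) f : sumL (l ++ m) f = sumL l f + sumL m f.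
Proof. induction l as [|x l IH]; simpl; [ring | rewrite IH; ring]. Qed.
Lemma sumL_seq_S s n f : sumL (seq s (S n)) f = sumL (seq s n) f + f (s + n)%nat.
Proof. rewrite seq_S, sumL_app. simpl. ring. Qed.
Lemma sumL_map {T U} (h : T -> U) l f : sumL (map h l) f = sumL l (fun x => f (h x)).
Proof. induction l as [|x l IH]; simpl; [reflexivity | rewrite IH; ring]. Qed.
Lemma sumL_add {T} (l : list T) f g : sumL l (fun x => f x + g x) = sumL l f + sumL l g.
Proof. induction l as [|x l IH]; simpl; [ring | rewrite IH; ring]. Qed.
Lemma sumL_scal {T} (l : list T) c f : sumL l (fun x => c * f x) = c * sumL l f.
Proof. induction l as [|x l IH]; simpl; [ring | rewrite IH; ring]. Qed.
Lemma sumL_sub {T} (l : list T) f g : sumL l (fun x => f x - g x) = sumL l f - sumL l g.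
Proof. induction l as [|x l IH]; simpl; [ring | rewrite IH; ring]. Qed.
Lemma sumL_0 {T} (l : list T) f : (forall x, List.In x l -> f x = 0) -> sumL l f = 0.
Proof.
  induction l as [|x l IH]; simpl; intros H; [reflexivity|]. rewrite (H x), IH; auto; ring.
Qed.
Lemma sumL_swap {T U} (l : list T) (m : list U) f :
  sumL l (fun x => sumL m (f x)) = sumL m (fun y => sumL l (fun x => f x y)).
Proof.
  induction l as [|x l IH]; simpl; [symmetry; apply sumL_0; auto | rewrite IH, sumL_add; ring].
Qed.
Lemma sumL_const {T} (l : list T) c : sumL l (fun _ => c) = INR (length l) * c.
Proof. induction l as [|x l IH]; [simpl; ring | cbn [length]; rewrite S_INR; simpl; rewrite IH; ring]. Qed.
Lemma sumL_perm {T} (l m : list T) f : Permutation l m -> sumL l f = sumL m f.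
Proof. induction 1; simpl; try lra. Qed.
Lemma sumL_filter {T} (p : T -> bool) l f :
  sumL l f = sumL (filter p l) f + sumL (filter (fun x => negb (p x)) l) f.
Proof. induction l as [|x l IH]; simpl; [ring|]. rewrite IH. destruct (p x); simpl; ring. Qed.

Lemma sumL_bij {T U} (l : list T) (m : list U) (phi : T -> U) (psi : U -> T) f g :
  NoDup l -> NoDup m ->
  (forall x, List.In x l -> List.In (phi x) m /\ psi (phi x) = x /\ f x = g (phi x)) ->
  (forall y, List.In y m -> List.In (psi y) l /\ phi (psi y) = y) ->
  sumL l f = sumL m g.
Proof.
  intros Nl Nm H K.
  rewrite (sumL_ext l f (fun x => g (phi x))) by (intros; apply H; auto).
  rewrite <- sumL_map. apply sumL_perm, NoDup_Permutation; auto.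
  - clear K Nm. induction Nl as [|x l Hx Nl IH]; simpl; constructor.
    + rewrite in_map_iff. intros [y [E Hy]]. apply Hx.
      destruct (H x) as [_ [E1 _]]; [left; auto|]. destruct (H y) as [_ [E2 _]]; [right; auto|].
      rewrite <- E1, <- E, E2. auto.
    + apply IH. intros y Hy. apply H. right; auto.
  - intros y; rewrite in_map_iff; split.
    + intros [x [<- Hx]]. apply H; auto.
    + intros Hy. exists (psi y). destruct (K y Hy); auto.
Qed.

Definition dep {T U} (D : list T) (L : T -> list U) : list (T * U) :=
  flat_map (fun x => map (pair x) (L x)) D.

Lemma in_dep {T U} (D : list T) (L : T -> list U) x y :
  List.In (x, y) (dep D L) <-> List.In x D /\ List.In y (L x).
Proof.
  unfold dep. rewrite in_flat_map. split.
  - intros [z [Hz H]]. apply in_map_iff in H. destruct H as [w [E Hw]].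
    injection E as -> ->. auto.
  - intros [Hx Hy]. exists x. split; auto. apply in_map; auto.
Qed.
Lemma NoDup_dep {T U} (D : list T) (L : T -> list U) :
  NoDup D -> (forall x, NoDup (L x)) -> NoDup (dep D L).
Proof.
  intros ND NL. induction ND as [|x D Hx ND IH]; [constructor|].
  change (dep (x :: D) L) with (map (pair x) (L x) ++ dep D L). apply NoDup_app; auto.
  - apply FinFun.Injective_map_NoDup; auto. intros y z E; congruence.
  - intros [a b] Ha Hb. apply in_map_iff in Ha. destruct Ha as [w [E _]]. injection E as -> ->.
    apply in_dep in Hb. tauto.
Qed.
Lemma sumL_dep {T U} (D : list T) (L : T -> list U) f :
  sumL (dep D L) f = sumL D (fun x => sumL (L x) (fun y => f (x, y))).
Proof.
  induction D as [|x D IH]; [reflexivity|].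
  change (dep (x :: D) L) with (map (pair x) (L x) ++ dep D L).
  rewrite sumL_app, sumL_map, IH. reflexivity.
Qed.

Lemma fmul_sumL f g n : fmul f g n = sumL (seq 0 (S n)) (fun l => f l * g (n - l)%nat).
Proof.
  revert f; induction n as [|n IH]; intros f; [simpl; ring|].
  cbn [fmul]. rewrite IH. change (seq 0 (S (S n))) with (O :: seq 1 (S n)).
  rewrite <- (seq_shift (S n) 0). cbn [sumL fold_right]. rewrite Nat.sub_0_r. f_equal.
  fold (sumL (map S (seq 0 (S n))) (fun l => f l * g (S n - l)%nat)).
  rewrite sumL_map. reflexivity.
Qed.

(** * Summation over the solutions of ax + by = n *)

Definition divs (n : nat) : list nat := filter (fun d => (n mod d =? 0)%nat) (seq 1 n).

Lemma in_divs d n : List.In d (divs n) <-> (1 <= d /\ exists e, 1 <= e /\ d * e = n)%nat.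
Proof.
  unfold divs. rewrite filter_In, in_seq, Nat.eqb_eq. split.
  - intros [H1 H2]. split; [lia|]. apply Nat.Lcm0.mod_divide in H2. destruct H2 as [e E].
    exists e. nia.
  - intros [H1 [e [H2 E]]]. split; [nia|]. rewrite <- E, Nat.mul_comm. apply Nat.Div0.mod_mul.
Qed.
Lemma NoDup_divs n : NoDup (divs n).
Proof. apply NoDup_filter, seq_NoDup. Qed.

(** The Lambert series with terms g(d) q^d/(1 - q^d); the constant coefficient is 0 since [divs 0]
    is empty. *)
Definition Sg (g : nat -> R) : fps := fun n => sumL (divs n) g.

Definition quads (n : nat) : list ((nat * nat) * (nat * nat)) :=
  filter (fun p => (fst (fst p) * fst (snd p) + snd (fst p) * snd (snd p) =? n)%nat)
    (list_prod (list_prod (seq 1 n) (seq 1 n)) (list_prod (seq 1 n) (seq 1 n))).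

Lemma in_quads a b x y n : List.In ((a, b), (x, y)) (quads n) <->
  (1 <= a /\ 1 <= b /\ 1 <= x /\ 1 <= y /\ a * x + b * y = n)%nat.
Proof.
  unfold quads. rewrite filter_In, !in_prod_iff, !in_seq, Nat.eqb_eq. simpl. split; [lia|].
  intros [Ha [Hb [Hx [Hy E]]]]. assert (a * x <= n)%nat by lia. assert (b * y <= n)%nat by lia.
  repeat split; try lia; nia.
Qed.
Lemma list_prod_dep {T U} (l : list T) (m : list U) : list_prod l m = dep l (fun _ => m).
Proof. induction l as [|x l IH]; [reflexivity|]. simpl. rewrite IH. reflexivity. Qed.
Lemma NoDup_prod {T U} (l : list T) (m : list U) : NoDup l -> NoDup m -> NoDup (list_prod l m).
Proof. intros; rewrite list_prod_dep; apply NoDup_dep; auto. Qed.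
Lemma NoDup_quads n : NoDup (quads n).
Proof. apply NoDup_filter; repeat apply NoDup_prod; apply seq_NoDup. Qed.

(** A divisor a of l with cofactor x and a divisor b of n - l with cofactor y form a solution of ax
    + by = n, from which l = ax is recovered. *)
Lemma Sg_mul g h n :
  fmul (Sg g) (Sg h) n = sumL (quads n) (fun p => g (fst (fst p)) * h (snd (fst p))).
Proof.
  rewrite fmul_sumL.
  rewrite (sumL_ext _ _ (fun l => sumL (list_prod (divs l) (divs (n - l)))
                                     (fun p => g (fst p) * h (snd p)))).
  2:{ intros l _. unfold Sg. rewrite list_prod_dep, sumL_dep. simpl.
      rewrite Rmult_comm, <- sumL_scal. apply sumL_ext. intros a _.
      rewrite Rmult_comm, <- sumL_scal. apply sumL_ext. intros; ring. }
  rewrite <- (sumL_dep _ _ (fun q => g (fst (snd q)) * h (snd (snd q)))).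
  symmetry.
  apply (sumL_bij _ _ (fun p => ((fst (fst p) * fst (snd p))%nat, fst p))
    (fun q => (snd q, ((fst q / fst (snd q))%nat, ((n - fst q) / snd (snd q))%nat)))).
  - apply NoDup_quads.
  - apply NoDup_dep; [apply seq_NoDup|]. intros; apply NoDup_prod; apply NoDup_divs.
  - intros [[a b] [x y]] H. apply in_quads in H. destruct H as [Ha [Hb [Hx [Hy E]]]]. simpl.
    rewrite in_dep, in_prod_iff, !in_divs, in_seq. replace (n - a * x)%nat with (b * y)%nat by lia.
    repeat split; try lia; try (eexists; split; [|reflexivity]; lia).
    rewrite (Nat.mul_comm a), (Nat.mul_comm b), !Nat.div_mul by lia. reflexivity.
  - intros [l [a b]] H. simpl. rewrite in_dep, in_prod_iff, !in_divs, in_seq in H.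
    destruct H as [Hl [[Ha [x [Hx Ex]]] [Hb [y [Hy Ey]]]]]. rewrite <- Ey, in_quads.
    rewrite (Nat.mul_comm b), Nat.div_mul by lia.
    assert (D : (l / a = x)%nat) by (rewrite <- Ex, Nat.mul_comm; apply Nat.div_mul; lia).
    rewrite D. repeat split; try lia. f_equal. exact Ex.
Qed.

(** The bijection (a, b, x, y) -> (a + b, b, x, y - x) between the solutions with y > x and
    those with a > b, and its mirror image, leave only the diagonal terms. *)
Lemma quads_telescope (f : nat -> nat -> R) n :
  (forall u v, f u v = f v u) -> (forall u v, f (u + v)%nat v = f (u + v)%nat u) ->
  sumL (quads n) (fun p => f (fst (fst p) + snd (fst p))%nat (snd (fst p)) - f (fst (fst p)) (snd (fst p)))
  = sumL (filter (fun p => (fst (snd p) =? snd (snd p))%nat) (quads n))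
      (fun p => f (fst (fst p) + snd (fst p))%nat (snd (fst p)))
  - sumL (filter (fun p => (fst (fst p) =? snd (fst p))%nat) (quads n))
      (fun p => f (fst (fst p)) (fst (fst p))).
Proof.
  intros Hs Ht. rewrite sumL_sub.
  rewrite (sumL_filter (fun p => (fst (snd p) =? snd (snd p))%nat) (quads n)
             (fun p => f (fst (fst p) + snd (fst p))%nat (snd (fst p)))).
  rewrite (sumL_filter (fun p => (fst (fst p) =? snd (fst p))%nat) (quads n)
             (fun p => f (fst (fst p)) (snd (fst p)))).
  set (X := filter (fun p => negb (fst (snd p) =? snd (snd p))%nat) (quads n)).
  set (Y := filter (fun p => negb (fst (fst p) =? snd (fst p))%nat) (quads n)).
  assert (E : sumL X (fun p => f (fst (fst p) + snd (fst p))%nat (snd (fst p)))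
            = sumL Y (fun p => f (fst (fst p)) (snd (fst p)))).
  { apply (sumL_bij _ _
      (fun p => let '((a, b), (x, y)) := p in
         if (x <? y)%nat then ((a + b, b), (x, y - x))%nat else ((a, a + b), (x - y, y))%nat)
      (fun p => let '((a, b), (x, y)) := p in
         if (b <? a)%nat then ((a - b, b), (x, x + y))%nat else ((a, b - a), (x + y, y))%nat)).
    - apply NoDup_filter, NoDup_quads.
    - apply NoDup_filter, NoDup_quads.
    - intros [[a b] [x y]] H. unfold X in H. rewrite filter_In, in_quads in H. cbn [fst snd] in H.
      rewrite Bool.negb_true_iff, Nat.eqb_neq in H. destruct H as [[Ha [Hb [Hx [Hy E]]]] N].
      unfold Y. destruct (Nat.ltb_spec x y) as [L|L].
      + rewrite filter_In, in_quads. cbn [fst snd]. rewrite Bool.negb_true_iff, Nat.eqb_neq.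
        repeat split; try lia; try nia.
        destruct (Nat.ltb_spec b (a + b)); [|lia]. repeat f_equal; lia.
      + rewrite filter_In, in_quads. cbn [fst snd]. rewrite Bool.negb_true_iff, Nat.eqb_neq.
        repeat split; try lia; try nia.
        * destruct (Nat.ltb_spec (a + b) a); [lia|]. repeat f_equal; lia.
        * rewrite Ht, Hs. reflexivity.
    - intros [[a b] [x y]] H. unfold Y in H. rewrite filter_In, in_quads in H. cbn [fst snd] in H.
      rewrite Bool.negb_true_iff, Nat.eqb_neq in H. destruct H as [[Ha [Hb [Hx [Hy E]]]] N].
      unfold X. destruct (Nat.ltb_spec b a) as [L|L].
      + rewrite filter_In, in_quads. cbn [fst snd]. rewrite Bool.negb_true_iff, Nat.eqb_neq.
        repeat split; try lia; try nia.
        destruct (Nat.ltb_spec x (x + y)); [|lia]. repeat f_equal; lia.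
      + rewrite filter_In, in_quads. cbn [fst snd]. rewrite Bool.negb_true_iff, Nat.eqb_neq.
        repeat split; try lia; try nia.
        destruct (Nat.ltb_spec (x + y) y); [lia|]. repeat f_equal; lia. }
  rewrite E.
  rewrite (sumL_ext (filter (fun p => (fst (fst p) =? snd (fst p))%nat) (quads n))
    (fun p => f (fst (fst p)) (snd (fst p))) (fun p => f (fst (fst p)) (fst (fst p)))).
  - ring.
  - intros p Hp. apply filter_In in Hp. destruct Hp as [_ Hp]. apply Nat.eqb_eq in Hp.
    rewrite Hp. reflexivity.
Qed.

(** For x = y the equation is (a + b) x = n, so (u, v) = (a + b, b) runs over the divisors u of n
    and 1 <= v < u. *)
Lemma quads_diag_x (h : nat -> nat -> R) n :
  sumL (filter (fun p => (fst (snd p) =? snd (snd p))%nat) (quads n))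
      (fun p => h (fst (fst p) + snd (fst p))%nat (snd (fst p)))
  = Sg (fun u => sumL (seq 1 (u - 1)) (h u)) n.
Proof.
  unfold Sg. rewrite <- (sumL_dep _ (fun u => seq 1 (u - 1)) (fun q => h (fst q) (snd q))).
  apply (sumL_bij _ _ (fun p => ((fst (fst p) + snd (fst p))%nat, snd (fst p)))
    (fun q => ((fst q - snd q, snd q), (n / fst q, n / fst q))%nat)).
  - apply NoDup_filter, NoDup_quads.
  - apply NoDup_dep; [apply NoDup_divs | intros; apply seq_NoDup].
  - intros [[a b] [x y]] H. rewrite filter_In, in_quads in H. cbn [fst snd] in *.
    rewrite Nat.eqb_eq in H. destruct H as [[Ha [Hb [Hx [Hy E]]]] <-].
    rewrite in_dep, in_divs, in_seq. repeat split; try lia.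
    + exists x. nia.
    + replace n with (x * (a + b))%nat by nia. rewrite Nat.div_mul by lia. repeat f_equal; lia.
  - intros [u v] H. rewrite in_dep, in_divs, in_seq in H. destruct H as [[Hu [e [He E]]] Hv].
    cbn [fst snd]. assert (D : (n / u = e)%nat) by (rewrite <- E, Nat.mul_comm; apply Nat.div_mul; lia).
    rewrite D, filter_In, in_quads. cbn [fst snd]. rewrite Nat.eqb_eq.
    repeat split; try lia; try nia. f_equal; lia.
Qed.

(** For a = b the equation a (x + y) = n leaves n/a - 1 choices of x. *)
Lemma quads_diag_a (h : nat -> R) n :
  sumL (filter (fun p => (fst (fst p) =? snd (fst p))%nat) (quads n)) (fun p => h (fst (fst p)))
  = Sg (fun a => (INR (n / a) - 1) * h a) n.
Proof.
  unfold Sg. transitivity (sumL (divs n) (fun a => sumL (seq 1 (n / a - 1)) (fun _ => h a))).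
  2:{ apply sumL_ext. intros a Ha. rewrite sumL_const, length_seq. apply in_divs in Ha.
      destruct Ha as [Ha [e [He E]]]. rewrite <- E, Nat.mul_comm, Nat.div_mul by lia.
      rewrite minus_INR by lia. reflexivity. }
  rewrite <- (sumL_dep _ (fun a => seq 1 (n / a - 1)) (fun q => h (fst q))).
  apply (sumL_bij _ _ (fun p => (fst (fst p), fst (snd p)))
    (fun q => ((fst q, fst q), (snd q, n / fst q - snd q))%nat)).
  - apply NoDup_filter, NoDup_quads.
  - apply NoDup_dep; [apply NoDup_divs | intros; apply seq_NoDup].
  - intros [[a b] [x y]] H. rewrite filter_In, in_quads in H. cbn [fst snd] in *.
    rewrite Nat.eqb_eq in H. destruct H as [[Ha [Hb [Hx [Hy E]]]] <-].
    assert (D : (n / a = x + y)%nat)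
      by (replace n with ((x + y) * a)%nat by nia; apply Nat.div_mul; lia).
    rewrite in_dep, in_divs, in_seq, D. repeat split; try lia.
    + exists (x + y)%nat. nia.
    + repeat f_equal; lia.
  - intros [a x] H. rewrite in_dep, in_divs, in_seq in H. destruct H as [[Ha [e [He E]]] Hx].
    cbn [fst snd]. assert (D : (n / a = e)%nat) by (rewrite <- E, Nat.mul_comm; apply Nat.div_mul; lia).
    rewrite D in *. rewrite filter_In, in_quads. cbn [fst snd]. rewrite Nat.eqb_eq.
    repeat split; try lia; try nia.
Qed.

(** * Bernoulli numbers and the recursion for Eisenstein series *)

(** As series these live in an auxiliary variable x: [fexp a] is e^(ax) and [fexp1 a] is (e^(ax) -
    1)/x. *)
Definition fexp (a : R) : fps := fun n => a ^ n / INR (fact n).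
Definition fexp1 (a : R) : fps := fun n => a ^ S n / INR (fact (S n)).

Lemma fact_neq n : INR (fact n) <> 0.
Proof. apply not_0_INR, fact_neq_0. Qed.
Lemma fact_S n : INR (fact (S n)) = (INR n + 1) * INR (fact n).
Proof. rewrite <- S_INR, <- mult_INR. reflexivity. Qed.
Lemma INR1_neq n : INR n + 1 <> 0.
Proof. assert (0 <= INR n) by apply pos_INR. lra. Qed.

Lemma fexp_0 a : fexp a O = 1.
Proof. unfold fexp; simpl; field. Qed.
Lemma fexp_S a n : (INR n + 1) * fexp a (S n) = a * fexp a n.
Proof.
  unfold fexp. rewrite fact_S. simpl. field. split; [apply fact_neq | apply INR1_neq].
Qed.
Lemma LD_fexp a : LD (fexp a) (fC a * fX 1)%fp.
Proof.
  split; [apply fexp_0|]. replace (fexp a * (fC a * fX 1))%fp with (fX 1 * (fC a * fexp a))%fp by ring.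
  rewrite fmul_C. apply fps_ext; intros [|n]; [unfold fD; rewrite fX_mul; simpl; ring|].
  rewrite fX1_S. unfold fD, fscal. rewrite S_INR. apply fexp_S.
Qed.
Lemma fexp_add a b : (fexp a * fexp b)%fp = fexp (a + b).
Proof.
  eapply LD_unique; [|apply LD_fexp]. rewrite fC_add.
  replace ((fC a + fC b) * fX 1)%fp with (fC a * fX 1 + fC b * fX 1)%fp by ring.
  apply LD_mul; apply LD_fexp.
Qed.
Lemma fexp_opp b n : fexp (- b) n = (-1) ^ n * fexp b n.
Proof. unfold fexp. replace (- b) with (-1 * b) by ring. rewrite Rpow_mult_distr. unfold Rdiv; ring. Qed.
Lemma fexp1_X a : (fX 1 * fexp1 a)%fp = (fexp a - fC 1)%fp.
Proof.
  apply fps_ext; intros [|n]; [rewrite fX_mul; unfold fsub; rewrite fexp_0; simpl; ring|].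
  rewrite fX1_S. unfold fsub, fexp, fexp1; simpl; ring.
Qed.

Lemma fX1_cancel f g : (fX 1 * f)%fp = (fX 1 * g)%fp -> f = g.
Proof. intros H; apply fps_ext; intros n. rewrite <- (fX1_S f), <- (fX1_S g), H. reflexivity. Qed.

Lemma sumL_odd (h : nat -> R) m : (forall i, h (2 * i)%nat = 0) ->
  sumL (seq 0 (S (2 * m))) h = sumL (seq 1 m) (fun i => h (2 * i - 1)%nat).
Proof.
  intros H. induction m as [|m IH]; [simpl; rewrite (H O : h O = 0); ring|].
  replace (S (2 * S m)) with (S (S (S (2 * m)))) by lia.
  rewrite (sumL_seq_S 0 (S (S (2 * m)))), (sumL_seq_S 0 (S (2 * m))), IH, (sumL_seq_S 1 m).
  replace (2 * (1 + m) - 1)%nat with (0 + S (2 * m))%nat by lia.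
  replace (0 + S (S (2 * m)))%nat with (2 * S m)%nat by lia. rewrite H. ring.
Qed.
Lemma sumL_even (h : nat -> R) m : (forall i, h (2 * i + 1)%nat = 0) ->
  sumL (seq 1 (2 * m)) h = sumL (seq 1 m) (fun i => h (2 * i)%nat).
Proof.
  intros H. induction m as [|m IH]; [reflexivity|].
  replace (2 * S m)%nat with (S (S (2 * m))) by lia.
  rewrite (sumL_seq_S 1 (S (2 * m))), (sumL_seq_S 1 (2 * m)), IH, (sumL_seq_S 1 m).
  replace (1 + 2 * m)%nat with (2 * m + 1)%nat by lia. rewrite H.
  replace (1 + S (2 * m))%nat with (2 * (1 + m))%nat by lia. ring.
Qed.

Lemma fmul_ends f g n : fmul f g (S n)
  = f O * g (S n) + sumL (seq 1 n) (fun l => f l * g (S n - l)%nat) + f (S n) * g O.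
Proof.
  rewrite fmul_sumL, sumL_seq_S. change (seq 0 (S n)) with (O :: seq 1 n).
  rewrite sumL_cons, Nat.sub_0_r, Nat.add_0_l, Nat.sub_diag. reflexivity.
Qed.

(** The series x/(e^x - 1), characterised as the reciprocal of (e^x - 1)/x. *)
Definition is_beta (beta : fps) : Prop := (fexp1 1 * beta)%fp = fC 1.

Lemma beta_exists : exists beta, is_beta beta.
Proof. apply finv_exists. unfold fexp1; simpl. lra. Qed.

(** The even part of x/(e^x - 1). *)
Definition bev (beta : fps) : fps := (beta + fC (1/2) * fX 1)%fp.

(** Differentiating the defining product gives D beta = beta - beta^2 - x beta; adding x/2 to beta
    completes the square. *)
Lemma bev_riccati beta : is_beta beta ->
  (bev beta ^ 2 = bev beta - fD (bev beta) + fC (1/4) * fX 2)%fp.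
Proof.
  intros H. unfold bev.
  assert (DE : (fX 1 * fD (fexp1 1) = fX 1 * (fC 1 + fX 1 * fexp1 1 - fexp1 1))%fp).
  { assert (E := f_equal fD (fexp1_X 1)).
    rewrite fD_mul, fD_sub, fD_C, fD_X in E. change (INR 1) with 1 in E.
    destruct (LD_fexp 1) as [_ E']. rewrite E' in E.
    replace (fX 1 * fD (fexp1 1))%fp
      with (fC 1 * fX 1 * fexp1 1 + fX 1 * fD (fexp1 1) - fX 1 * fexp1 1)%fp by ring.
    rewrite E. replace (fexp 1) with (fX 1 * fexp1 1 + fC 1)%fp by (rewrite fexp1_X; ring). ring. }
  apply fX1_cancel in DE.
  assert (DB := f_equal fD H). rewrite fD_mul, fD_C, DE in DB.
  assert (E1 : (fD beta = beta - beta ^ 2 - fX 1 * beta)%fp).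
  { replace (fD beta) with (fD beta * fC 1)%fp by ring. unfold is_beta in H. rewrite <- H.
    replace (fD beta * (fexp1 1 * beta))%fp with (beta * (fexp1 1 * fD beta))%fp by ring.
    replace (fexp1 1 * fD beta)%fp with (fC 0 - (fC 1 + fX 1 * fexp1 1 - fexp1 1) * beta)%fp
      by (rewrite <- DB; ring).
    replace (beta * (fC 0 - (fC 1 + fX 1 * fexp1 1 - fexp1 1) * beta))%fp
      with (- beta ^ 2 - fX 1 * (fexp1 1 * beta) * beta + (fexp1 1 * beta) * beta)%fp by ring.
    rewrite H. ring. }
  rewrite fD_add, fD_mul, fD_C, fD_X, E1. change (INR 1) with 1.
  replace (fX 2) with (fX 1 * fX 1)%fp by apply fX_add.
  replace (fC (1/4)) with (fC (1/2) * fC (1/2))%fp by (rewrite <- fC_mul; f_equal; field).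
  replace (fX 1 * beta)%fp with (fC (1/2) * fC 2 * fX 1 * beta)%fp
    by (rewrite <- fC_mul; replace (1/2*2) with 1 by field; ring).
  ring.
Qed.

Lemma beta_0 beta : is_beta beta -> beta O = 1.
Proof.
  intros H. apply (f_equal (fun f : fps => f O)) in H. cbn in H. unfold fexp1 in H. simpl in H. lra.
Qed.
Lemma bev_0 beta : is_beta beta -> bev beta O = 1.
Proof.
  intros H. unfold bev, fadd. rewrite fmul_0, beta_0 by auto. unfold fX; simpl. ring.
Qed.
Lemma bev_rec beta n : is_beta beta ->
  (INR n + 2) * bev beta (S n)
  = (if (n =? 1)%nat then 1/4 else 0)
    - sumL (seq 1 n) (fun l => bev beta l * bev beta (S n - l)%nat).
Proof.
  intros H. assert (E := f_equal (fun f : fps => f (S n)) (bev_riccati beta H)). cbv beta in E.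
  replace (bev beta ^ 2)%fp with (bev beta * bev beta)%fp in E by ring.
  rewrite fmul_ends, bev_0 in E by auto. rewrite fmul_C in E.
  unfold fadd, fsub, fscal, fD, fX in E. fold (bev beta) in E.
  rewrite S_INR in E. change (S n =? 2)%nat with (n =? 1)%nat in E.
  destruct (n =? 1)%nat; lra.
Qed.
(** In the Riccati recursion for an odd index every product contains a factor of smaller odd
    index. *)
Lemma bev_odd beta i : is_beta beta -> bev beta (2 * i + 1)%nat = 0.
Proof.
  intros H. induction i as [i IH] using (well_founded_induction lt_wf).
  replace (2 * i + 1)%nat with (S (2 * i)) by lia.
  assert (E := bev_rec beta (2 * i) H).
  rewrite sumL_0 in E.
  - destruct (Nat.eqb_spec (2 * i) 1); [lia|].
    apply (Rmult_eq_reg_l (INR (2 * i) + 2)); [lra|]. assert (0 <= INR (2 * i)) by apply pos_INR. lra.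
  - intros l Hl. apply in_seq in Hl. destruct (Nat.Even_or_Odd l) as [[j ->]|[j ->]].
    + replace (S (2 * i) - 2 * j)%nat with (2 * (i - j) + 1)%nat by lia. rewrite (IH (i - j)%nat) by lia. ring.
    + rewrite IH by lia. ring.
Qed.
Lemma bev_rec_even beta m : is_beta beta -> (1 <= m)%nat ->
  (2 * INR m + 3) * bev beta (2 * m + 2)%nat
  = - sumL (seq 1 m) (fun i => bev beta (2 * i)%nat * bev beta (2 * (m + 1 - i))%nat).
Proof.
  intros H Hm. assert (E := bev_rec beta (2 * m + 1) H).
  replace (S (2 * m + 1)) with (2 * m + 2)%nat in E by lia.
  destruct (Nat.eqb_spec (2 * m + 1) 1); [lia|].
  replace (2 * m + 1)%nat with (S (2 * m)) in E at 2 by lia.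
  rewrite sumL_seq_S, sumL_even in E.
  - replace (1 + 2 * m)%nat with (2 * m + 1)%nat in E by lia.
    rewrite (bev_odd beta m) in E by auto. rewrite plus_INR, mult_INR in E. simpl (INR 2) in E. simpl (INR 1) in E.
    rewrite (sumL_ext (seq 1 m) _ (fun i => bev beta (2 * i)%nat * bev beta (2 * m + 2 - 2 * i)%nat)).
    + lra.
    + intros i Hi. f_equal. f_equal. lia.
  - intros i. rewrite bev_odd by auto. ring.
Qed.
Lemma bev_2 beta : is_beta beta -> bev beta 2 = 1/12.
Proof.
  intros H. assert (E := bev_rec beta 1 H). simpl in E. assert (O := bev_odd beta 0 H). simpl in O.
  rewrite O in E. lra.
Qed.

Lemma sumL_pos {T} (l : list T) f : l <> [] -> (forall x, List.In x l -> 0 < f x) -> 0 < sumL l f.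
Proof.
  intros Hl H. destruct l as [|x l]; [congruence|]. clear Hl. simpl.
  assert (0 < f x) by (apply H; left; auto).
  assert (0 <= sumL l f); [|lra].
  assert (K : forall y, List.In y l -> 0 < f y) by (intros; apply H; right; auto). clear H.
  induction l as [|y l IH]; simpl; [lra|].
  assert (0 < f y) by (apply K; left; auto). assert (0 <= sumL l f); [|lra].
  apply IH; intros; apply K; right; auto.
Qed.
Lemma pow_m1_sq n : (-1) ^ n * (-1) ^ n = 1.
Proof. rewrite <- Rpow_mult_distr. replace (-1 * -1) with 1 by ring. apply pow1. Qed.
(** All products in the even recursion have the same sign by induction. In particular B_2k is not 0,
    so the denominator of [alpha k] is legitimate. *)
Lemma bev_sign beta k : is_beta beta -> (1 <= k)%nat -> 0 < (-1) ^ (k + 1) * bev beta (2 * k)%nat.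
Proof.
  intros H. induction k as [k IH] using (well_founded_induction lt_wf). intros Hk.
  destruct (Nat.eq_dec k 1) as [->|Hk1]; [simpl; rewrite bev_2 by auto; lra|].
  destruct k as [|m]; [lia|].
  assert (E := bev_rec_even beta m H ltac:(lia)).
  replace (2 * S m)%nat with (2 * m + 2)%nat by lia.
  assert (P : 0 < sumL (seq 1 m) (fun i =>
    (-1) ^ (i + 1) * bev beta (2 * i)%nat * ((-1) ^ (m + 1 - i + 1) * bev beta (2 * (m + 1 - i))%nat))).
  { apply sumL_pos; [destruct m; simpl; congruence|]. intros i Hi. apply in_seq in Hi.
    apply Rmult_lt_0_compat; apply IH; lia. }
  rewrite (sumL_ext _ _ (fun i => (-1) ^ (m + 1) *
     (bev beta (2 * i)%nat * bev beta (2 * (m + 1 - i))%nat))) in P.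
  - rewrite sumL_scal in P. assert (0 <= INR m) by apply pos_INR.
    apply (Rmult_lt_reg_l (2 * INR m + 3)); [lra|]. rewrite Rmult_0_r.
    replace ((2 * INR m + 3) * ((-1) ^ (S m + 1) * bev beta (2 * m + 2)%nat))
      with ((-1) ^ (S m + 1) * ((2 * INR m + 3) * bev beta (2 * m + 2)%nat)) by ring.
    rewrite E. cbn [Nat.add pow]. eapply Rlt_le_trans; [exact P | right; ring].
  - intros i Hi. apply in_seq in Hi.
    replace ((-1) ^ (m + 1)) with ((-1) ^ (i + 1) * (-1) ^ (m + 1 - i + 1)); [ring|].
    rewrite <- pow_add. replace (i + 1 + (m + 1 - i + 1))%nat with (m + 1 + 2)%nat by lia.
    rewrite pow_add. simpl. ring.
Qed.

(** The coefficients are sigma_(2k-1)(n)/(2k-1)!. With this normalisation a sum over i of products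
    of weights 2i and 2(m+1-i) is a coefficient of a product of exponentials. *)
Definition Sh (k : nat) : fps := Sg (fun d => fexp (INR d) (2 * k - 1)).

(** The geometric sum of e^(vx) over v < u equals beta times (e^(ux) - 1)/x; the claim is its
    coefficient of x^(2m), with the odd part -x/2 of beta split off. *)
Lemma psum_bernoulli beta u m : is_beta beta -> (1 <= m)%nat ->
  sumL (seq 0 u) (fun v => fexp (INR v) (2 * m))
  = fexp (INR u) (2 * m + 1) - / 2 * fexp (INR u) (2 * m)
    + sumL (seq 1 m) (fun i => bev beta (2 * i)%nat * fexp (INR u) (2 * (m + 1 - i) - 1)).
Proof.
  intros H Hm.
  assert (T : forall w, ((fun N => sumL (seq 0 w) (fun v => fexp (INR v) N)) * (fexp 1 - fC 1)
                         = fexp (INR w) - fC 1)%fp).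
  { induction w as [|w IH].
    - change (fun N => sumL (seq 0 0) (fun v => fexp (INR v) N)) with (fun _ : nat => 0).
      apply fps_ext; intros n. rewrite fmul_zerol. unfold fsub, fexp, fC. destruct n; simpl; [field|].
      unfold Rdiv; ring.
    - replace (fun N => sumL (seq 0 (S w)) (fun v => fexp (INR v) N))
        with ((fun N => sumL (seq 0 w) (fun v => fexp (INR v) N)) + fexp (INR w))%fp.
      + replace (((fun N => sumL (seq 0 w) (fun v => fexp (INR v) N)) + fexp (INR w)) * (fexp 1 - fC 1))%fp
          with ((fun N => sumL (seq 0 w) (fun v => fexp (INR v) N)) * (fexp 1 - fC 1)
                + (fexp (INR w) * fexp 1 - fexp (INR w)))%fp by ring.
        rewrite IH, fexp_add, S_INR. ring.
      + apply fps_ext; intros n. rewrite sumL_seq_S. reflexivity. }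
  assert (P : (fun N => sumL (seq 0 u) (fun v => fexp (INR v) N)) = (beta * fexp1 (INR u))%fp).
  { set (p := fun N => _). assert (Tu := T u). fold p in Tu. rewrite <- !fexp1_X in Tu.
    replace (p * (fX 1 * fexp1 1))%fp with (fX 1 * (p * fexp1 1))%fp in Tu by ring.
    apply fX1_cancel in Tu. rewrite <- Tu. replace p with (p * fC 1)%fp at 1 by ring.
    rewrite <- H. ring. }
  transitivity ((beta * fexp1 (INR u))%fp (2 * m)%nat); [rewrite <- P; reflexivity|].
  replace beta with (bev beta - fC (1/2) * fX 1)%fp at 1 by (unfold bev; ring).
  replace ((bev beta - fC (1/2) * fX 1) * fexp1 (INR u))%fp
    with (bev beta * fexp1 (INR u) - fC (1/2) * (fX 1 * fexp1 (INR u)))%fp by ring.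
  rewrite fexp1_X, fmul_C. unfold fsub at 1, fscal, fsub.
  rewrite fmul_sumL. change (seq 0 (S (2 * m))) with (O :: seq 1 (2 * m)).
  rewrite sumL_cons, bev_0 by auto.
  rewrite sumL_even by (intros; rewrite bev_odd by auto; ring).
  rewrite (sumL_ext (seq 1 m) (fun i => bev beta (2 * i)%nat * fexp (INR u) (2 * (m + 1 - i) - 1))
             (fun i => bev beta (2 * i)%nat * fexp1 (INR u) (2 * m - 2 * i)%nat)).
  - rewrite Nat.sub_0_r. change (fexp1 (INR u) (2 * m)%nat) with (fexp (INR u) (S (2 * m))).
    replace (2 * m + 1)%nat with (S (2 * m)) by lia.
    destruct (2 * m)%nat eqn:E; [lia|]. simpl (fC 1 (S n)). lra.
  - intros i Hi. apply in_seq in Hi. f_equal. replace (2 * (m + 1 - i) - 1)%nat with (S (2 * m - 2 * i)) by lia.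
    reflexivity.
Qed.

Lemma sumL_rev_seq (f : nat -> R) u :
  sumL (seq 1 (u - 1)) (fun v => f (u - v)%nat) = sumL (seq 1 (u - 1)) f.
Proof.
  apply (sumL_bij _ _ (fun v => u - v)%nat (fun v => u - v)%nat); try apply seq_NoDup;
    intros v Hv; apply in_seq in Hv; rewrite in_seq; repeat split; lia.
Qed.

(** The convolution is a sum over the solutions of ax + by = n of the odd parts of e^(ax) e^(bx),
    which is a telescoping difference. The two diagonals contribute power sums, evaluated with
    Bernoulli numbers, and the term n sigma(n), which is a derivative. *)
Lemma Sh_conv beta m n : is_beta beta -> (1 <= m)%nat ->
  2 * sumL (seq 1 m) (fun i => fmul (Sh i) (Sh (m + 1 - i)) n)
  = (2 * INR m + 3) * Sh (m + 1) n
    + 2 * sumL (seq 1 m) (fun i => bev beta (2 * i)%nat * Sh (m + 1 - i) n)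
    - / INR m * (INR n * Sh m n).
Proof.
  intros H Hm.
  (* Up to the factor 1/(2m)!, f(a+b, b) - f(a, b) = (a+b)^(2m) - (a-b)^(2m), while f is symmetric
     and f(u+v, v) = f(u+v, u), as [quads_telescope] demands. *)
  set (f := fun u v => fexp (INR u) (2 * m) + fexp (INR v) (2 * m) + fexp (INR u - INR v) (2 * m)).
  assert (Ev : forall x, fexp (- x) (2 * m) = fexp x (2 * m)).
  { intros x. rewrite fexp_opp, pow_mult. replace ((-1) ^ 2) with 1 by ring. rewrite pow1. ring. }
  assert (L : 2 * sumL (seq 1 m) (fun i => fmul (Sh i) (Sh (m + 1 - i)) n)
    = sumL (quads n) (fun p => f (fst (fst p) + snd (fst p))%nat (snd (fst p)) - f (fst (fst p)) (snd (fst p)))).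
  { rewrite <- sumL_scal. unfold Sh.
    rewrite (sumL_ext _ _ (fun i => sumL (quads n) (fun p => 2 * (fexp (INR (fst (fst p))) (2 * i - 1)
       * fexp (INR (snd (fst p))) (2 * (m + 1 - i) - 1)))))
      by (intros; rewrite Sg_mul, sumL_scal; reflexivity).
    rewrite sumL_swap. apply sumL_ext. intros [[a b] [x y]] _. cbn [fst snd]. unfold f.
    rewrite plus_INR. replace (INR a + INR b - INR b) with (INR a) by ring.
    set (A := INR a). set (B := INR b).
    transitivity (((fexp A * fexp B)%fp - (fexp A * fexp (- B)))%fp (2 * m)%nat).
    2:{ rewrite !fexp_add. unfold fsub, Rminus. ring. }
    replace (fexp A * fexp B - fexp A * fexp (- B))%fp with (fexp A * (fexp B - fexp (- B)))%fp by ring.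
    rewrite fmul_sumL, sumL_odd.
    - apply sumL_ext. intros i Hi. apply in_seq in Hi. unfold fsub. rewrite fexp_opp.
      replace (2 * m - (2 * i - 1))%nat with (2 * (m + 1 - i) - 1)%nat by lia.
      replace ((-1) ^ (2 * (m + 1 - i) - 1)) with (-1); [ring|].
      replace (2 * (m + 1 - i) - 1)%nat with (S (2 * (m - i))) by lia. rewrite pow_1_odd. reflexivity.
    - intros i. unfold fsub. rewrite fexp_opp.
      replace (2 * m - 2 * i)%nat with (2 * (m - i))%nat by lia. rewrite pow_1_even. ring. }
  rewrite L, quads_telescope.
  2:{ intros u v; unfold f. replace (INR u - INR v) with (- (INR v - INR u)) by ring. rewrite Ev. ring. }
  2:{ intros u v; unfold f. rewrite plus_INR. replace (INR u + INR v - INR v) with (INR u) by ring.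
      replace (INR u + INR v - INR u) with (INR v) by ring. ring. }
  rewrite quads_diag_x, (quads_diag_a (fun a => f a a)).
  unfold Sh, Sg. rewrite (sumL_ext (seq 1 m) (fun i => bev beta (2 * i)%nat * _)
    (fun i => sumL (divs n) (fun d => bev beta (2 * i)%nat * fexp (INR d) (2 * (m + 1 - i) - 1))))
    by (intros; rewrite sumL_scal; reflexivity).
  rewrite sumL_swap, <- !sumL_scal, <- !sumL_sub, <- sumL_add, <- sumL_sub.
  apply sumL_ext. intros u Hu. apply in_divs in Hu. destruct Hu as [Hu [e [He E]]].
  assert (D : (n / u = e)%nat) by (rewrite <- E, Nat.mul_comm; apply Nat.div_mul; lia). rewrite D.
  assert (Z0 : fexp (INR u - INR u) (2 * m) = 0).
  { unfold fexp. rewrite Rminus_diag, pow_i by lia. unfold Rdiv; ring. }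
  assert (PS := psum_bernoulli beta u m H Hm).
  replace u with (S (u - 1)) in PS at 1 by lia. change (seq 0 (S (u - 1))) with (O :: seq 1 (u - 1)) in PS.
  rewrite sumL_cons in PS.
  assert (Z1 : fexp (INR 0) (2 * m) = 0) by (unfold fexp; rewrite pow_i by lia; unfold Rdiv; ring).
  rewrite Z1, Rplus_0_l in PS.
  assert (S1 : sumL (seq 1 (u - 1)) (f u)
    = (INR u - 1) * fexp (INR u) (2 * m) + 2 * sumL (seq 1 (u - 1)) (fun v => fexp (INR v) (2 * m))).
  { unfold f. rewrite !sumL_add, sumL_const, length_seq, minus_INR by lia.
    rewrite (sumL_ext (seq 1 (u - 1)) (fun x => fexp (INR u - INR x) (2 * m))
       (fun v => (fun w => fexp (INR w) (2 * m)) (u - v)%nat)).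
    - rewrite (sumL_rev_seq (fun w => fexp (INR w) (2 * m))%nat). simpl (INR 1). ring.
    - intros v Hv. apply in_seq in Hv. rewrite minus_INR by lia. reflexivity. }
  rewrite S1, PS. unfold f. rewrite Z0.
  replace (2 * (m + 1) - 1)%nat with (S (2 * m)) by lia. replace (2 * m + 1)%nat with (S (2 * m)) by lia.
  assert (X1 := fexp_S (INR u) (2 * m)). assert (X2 := fexp_S (INR u) (2 * m - 1)).
  replace (S (2 * m - 1)) with (2 * m)%nat in X2 by lia.
  rewrite minus_INR in X2 by lia. rewrite mult_INR in X1, X2. simpl (INR 2) in *. simpl (INR 1) in *.
  assert (EN : INR n = INR u * INR e) by (rewrite <- E, mult_INR; reflexivity). rewrite EN.
  assert (m0 : INR m <> 0) by (apply not_0_INR; lia).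
  replace (/ INR m * (INR u * INR e * fexp (INR u) (2 * m - 1)))
    with (/ INR m * INR e * (INR u * fexp (INR u) (2 * m - 1))) by ring.
  rewrite <- X2.
  replace (/ INR m * INR e * (((1 + 1) * INR m - 1 + 1) * fexp (INR u) (2 * m)))
    with (2 * INR e * fexp (INR u) (2 * m)) by (field; auto).
  replace ((INR u - 1) * fexp (INR u) (2 * m)) with (INR u * fexp (INR u) (2 * m) - fexp (INR u) (2 * m)) by ring.
  rewrite <- X1. lra.
Qed.

Definition fsumL (l : list nat) (F : nat -> fps) : fps := fun n => sumL l (fun i => F i n).

Lemma fsumL_nil F : fsumL [] F = fC 0.
Proof. apply fps_ext; intros [|n]; reflexivity. Qed.
Lemma fsumL_cons i l F : fsumL (i :: l) F = (F i + fsumL l F)%fp.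
Proof. reflexivity. Qed.
Lemma fsumL_ext l F G : (forall i, List.In i l -> F i = G i) -> fsumL l F = fsumL l G.
Proof. intros H; apply fps_ext; intros n; apply sumL_ext; intros i Hi; rewrite H; auto. Qed.
Lemma fsumL_mull l F g : fsumL l (fun i => (g * F i)%fp) = (g * fsumL l F)%fp.
Proof.
  induction l as [|i l IH]; [rewrite !fsumL_nil; ring|]. rewrite !fsumL_cons, IH. ring.
Qed.

(** [Gh beta k] is the Eisenstein series of weight 2k divided by (2k-1)!. *)
Definition Gh (beta : fps) (k : nat) : fps := (fC (- bev beta (2 * k)%nat / 2) + Sh k)%fp.

Lemma Sg_0 g : Sg g O = 0.
Proof. reflexivity. Qed.
Lemma Gh_0 beta k : Gh beta k O = - bev beta (2 * k)%nat / 2.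
Proof. unfold Gh, fadd, Sh. rewrite Sg_0. simpl. ring. Qed.

(** The constant terms -b_(2i)/2 are chosen so that the linear terms of [Sh_conv] are absorbed into
    the products; the constant coefficients then agree by the Bernoulli recursion [bev_rec_even]. *)
Lemma Gh_rec beta m : is_beta beta -> (1 <= m)%nat ->
  (fC (2 * INR m) * fsumL (seq 1 m) (fun i => Gh beta i * Gh beta (m + 1 - i))
   = fC (INR m * (2 * INR m + 3)) * Gh beta (m + 1) - fD (Gh beta m))%fp.
Proof.
  intros H Hm. rewrite !fmul_C. apply fps_ext. intros n. unfold fscal, fsub, fsumL.
  assert (m0 : INR m <> 0) by (apply not_0_INR; lia).
  assert (C := Sh_conv beta m n H Hm). set (b := bev beta) in *.
  set (c := fun i => - b (2 * i)%nat / 2).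
  rewrite (sumL_ext _ _ (fun i => c i * c (m + 1 - i)%nat * fC 1 n + c i * Sh (m + 1 - i) n
            + c (m + 1 - i)%nat * Sh i n + fmul (Sh i) (Sh (m + 1 - i)) n)).
  2:{ intros i Hi. unfold Gh. fold b. fold (c i) (c (m + 1 - i)%nat).
      replace ((fC (c i) + Sh i) * (fC (c (m + 1 - i)%nat) + Sh (m + 1 - i)))%fp
        with (fC (c i) * (fC (c (m + 1 - i)%nat) * fC 1) + fC (c i) * Sh (m + 1 - i)
              + fC (c (m + 1 - i)%nat) * Sh i + Sh i * Sh (m + 1 - i))%fp by ring.
      rewrite !fmul_C. unfold fadd, fscal. ring. }
  rewrite !sumL_add.
  assert (R : sumL (seq 1 m) (fun i => c (m + 1 - i)%nat * Sh i n)
            = sumL (seq 1 m) (fun i => c i * Sh (m + 1 - i) n)).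
  { transitivity (sumL (seq 1 (m + 1 - 1)) (fun v => (fun i => c i * Sh (m + 1 - i) n) (m + 1 - v)%nat)).
    - replace (m + 1 - 1)%nat with m by lia. apply sumL_ext. intros i Hi. apply in_seq in Hi.
      replace (m + 1 - (m + 1 - i))%nat with i by lia. reflexivity.
    - rewrite (sumL_rev_seq (fun i => c i * Sh (m + 1 - i) n)).
      replace (m + 1 - 1)%nat with m by lia. reflexivity. }
  rewrite R.
  assert (R2 : sumL (seq 1 m) (fun i => c i * Sh (m + 1 - i) n)
     = - / 2 * sumL (seq 1 m) (fun i => b (2 * i)%nat * Sh (m + 1 - i) n)).
  { rewrite <- sumL_scal. apply sumL_ext. intros i _. unfold c. field. }
  assert (R3 : sumL (seq 1 m) (fun i => c i * c (m + 1 - i)%nat * fC 1 n)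
     = - / 4 * ((2 * INR m + 3) * b (2 * m + 2)%nat) * fC 1 n).
  { unfold b. rewrite bev_rec_even by auto. fold b.
    replace (- / 4 * - sumL (seq 1 m) (fun i => b (2 * i)%nat * b (2 * (m + 1 - i))%nat) * fC 1 n)
      with (/ 4 * fC 1 n * sumL (seq 1 m) (fun i => b (2 * i)%nat * b (2 * (m + 1 - i))%nat)) by ring.
    rewrite <- sumL_scal. apply sumL_ext. intros i _. unfold c. field. }
  rewrite R2, R3. unfold Gh. fold b. unfold fadd, fD, fadd.
  replace (2 * (m + 1))%nat with (2 * m + 2)%nat by lia.
  replace (fC (- b (2 * m + 2)%nat / 2) n) with (- b (2 * m + 2)%nat / 2 * fC 1 n)
    by (destruct n; simpl; ring).
  replace (INR n * (fC (- b (2 * m)%nat / 2) n + Sh m n)) with (INR n * Sh m n)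
    by (destruct n; simpl; ring).
  set (X := sumL (seq 1 m) (fun i => fmul (Sh i) (Sh (m + 1 - i)) n)) in *.
  set (Y := sumL (seq 1 m) (fun i => b (2 * i)%nat * Sh (m + 1 - i) n)) in *.
  assert (X = / 2 * ((2 * INR m + 3) * Sh (m + 1) n + 2 * Y - / INR m * (INR n * Sh m n))) as -> by lra.
  field. auto.
Qed.

(** * The identity E_4^2 = E_8 and Ramanujan's equations for Eisenstein series *)

Lemma sum_sq_prod (u : R) w :
  sumL (seq 1 w) (fun v => (INR v * (u - INR v)) ^ 2)
  = u ^ 2 * (INR w * (INR w + 1) * (2 * INR w + 1) / 6) - 2 * u * (INR w * (INR w + 1) / 2) ^ 2
    + INR w * (INR w + 1) * (2 * INR w + 1) * (3 * INR w ^ 2 + 3 * INR w - 1) / 30.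
Proof.
  induction w as [|w IH]; [simpl; field|].
  rewrite sumL_seq_S, IH. change (1 + w)%nat with (S w). rewrite S_INR. field.
Qed.

(** The telescoping function is f(u, v) = (u v (u - v))^2, since f(a+b, b) - f(a, b) = 4 a^3 b^3. It
    vanishes for u = v, so only the diagonal x = y contributes. *)
Lemma sigma3_sq :
  (fC 120 * (Sg (fun d => (INR d ^ 3)%R) * Sg (fun d => (INR d ^ 3)%R))
   = Sg (fun d => (INR d ^ 7)%R) - Sg (fun d => (INR d ^ 3)%R))%fp.
Proof.
  rewrite fmul_C. apply fps_ext. intros n. unfold fscal, fsub. rewrite Sg_mul.
  set (f := fun u v => (INR u * INR v * (INR u - INR v)) ^ 2).
  rewrite (sumL_ext _ _ (fun p => / 4 * (f (fst (fst p) + snd (fst p))%nat (snd (fst p)) - f (fst (fst p)) (snd (fst p))))).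
  2:{ intros [[a b] [x y]] _. unfold f. simpl fst. simpl snd. rewrite plus_INR. field. }
  rewrite sumL_scal, quads_telescope, quads_diag_x, (quads_diag_a (fun a => f a a)).
  - unfold Sg. rewrite <- !sumL_sub, <- !sumL_scal. apply sumL_ext. intros u Hu.
    assert (1 <= u)%nat by (apply in_divs in Hu; lia).
    rewrite (sumL_ext _ (f u) (fun v => INR u ^ 2 * (INR v * (INR u - INR v)) ^ 2)) by (intros; unfold f; ring).
    rewrite sumL_scal, sum_sq_prod. unfold f. rewrite minus_INR by lia. simpl (INR 1). field.
  - intros u v; unfold f; ring.
  - intros u v; unfold f; rewrite plus_INR; ring.
Qed.

Lemma Sg_ext g h : (forall d, g d = h d) -> Sg g = Sg h.
Proof. intros E; apply fps_ext; intros n; apply sumL_ext; auto. Qed.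
Lemma Sg_scal c g : Sg (fun d => c * g d) = (fC c * Sg g)%fp.
Proof. rewrite fmul_C. apply fps_ext; intros n; apply sumL_scal. Qed.

Lemma bev_4 beta : is_beta beta -> bev beta 4 = - 1/720.
Proof.
  intros H. assert (E := bev_rec_even beta 1 H (le_n _)). simpl in E. rewrite bev_2 in E by auto. lra.
Qed.
Lemma bev_6 beta : is_beta beta -> bev beta 6 = 1/30240.
Proof.
  intros H. assert (E := bev_rec_even beta 2 H ltac:(lia)). simpl in E.
  rewrite bev_2, bev_4 in E by auto. lra.
Qed.
Lemma bev_8 beta : is_beta beta -> bev beta 8 = - 1/1209600.
Proof.
  intros H. assert (E := bev_rec_even beta 3 H ltac:(lia)). simpl in E.
  rewrite bev_2, bev_4, bev_6 in E by auto. lra.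
Qed.

Lemma Gh_sq beta : is_beta beta -> (fC 6 * (Gh beta 2 * Gh beta 2) = fC 7 * Gh beta 4)%fp.
Proof.
  intros H. unfold Gh. rewrite bev_4, bev_8 by auto. unfold Sh.
  rewrite (Sg_ext (fun d => fexp (INR d) (2 * 2 - 1)) (fun d => (/ 6) * INR d ^ 3))
    by (intros; unfold fexp; simpl; field).
  rewrite (Sg_ext (fun d => fexp (INR d) (2 * 4 - 1)) (fun d => (/ 5040) * INR d ^ 7)).
  2:{ intros; unfold fexp. replace (INR (fact (2 * 4 - 1))) with 5040; [simpl; field|].
      rewrite INR_IZR_INZ. apply f_equal. reflexivity. }
  rewrite !Sg_scal. assert (K := sigma3_sq). set (S3 := Sg _) in K. set (S7 := Sg _) in K.
  fold S3 S7.
  replace (fC 6 * ((fC (- (- 1 / 720) / 2) + fC (/ 6) * S3) * (fC (- (- 1 / 720) / 2) + fC (/ 6) * S3)))%fp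
    with (fC 6 * (fC (- (- 1 / 720) / 2) * fC (- (- 1 / 720) / 2))
          + fC 12 * (fC (/ 6) * (fC (- (- 1 / 720) / 2) * S3)) + fC 6 * (fC (/ 6) * (fC (/ 6) * (S3 * S3))))%fp by ring.
  replace (S3 * S3)%fp with (fC (/ 120) * (S7 - S3))%fp.
  - rewrite !fmul_C. apply fps_ext. intros n. unfold fadd, fsub, fscal. destruct n; simpl fC; field.
  - rewrite <- K. replace (fC (/ 120) * (fC 120 * (S3 * S3)))%fp with (fC (/ 120) * fC 120 * (S3 * S3))%fp by ring.
    rewrite <- fC_mul. replace (/ 120 * 120) with 1 by field. ring.
Qed.

(** The factors are the reciprocals of the constant terms -1/24, 1/1440, -1/60480. The equations are
    [Gh_rec] for m = 1, 2, 3; for m = 3 the weight 8 series is eliminated by E_4^2 = E_8. *)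
Lemma Gh_ramanujan beta : is_beta beta ->
  ramanujan_system (fC (-24) * Gh beta 1)%fp (fC 1440 * Gh beta 2)%fp (fC (-60480) * Gh beta 3)%fp.
Proof.
  intros H. assert (R1 := Gh_rec beta 1 H ltac:(lia)). assert (R2 := Gh_rec beta 2 H ltac:(lia)).
  assert (R3 := Gh_rec beta 3 H ltac:(lia)). assert (R4 := Gh_sq beta H).
  change (seq 1 1) with [1%nat] in R1. change (seq 1 2) with [1; 2]%nat in R2.
  change (seq 1 3) with [1; 2; 3]%nat in R3.
  rewrite !fsumL_cons, fsumL_nil in R1. rewrite !fsumL_cons, fsumL_nil in R2.
  rewrite !fsumL_cons, fsumL_nil in R3. simpl Nat.add in R1, R2, R3.
  simpl Nat.sub in R1, R2, R3. rewrite !INR_IZR_INZ, <- !mult_IZR, <- !plus_IZR, <- !mult_IZR in R1, R2, R3.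
  simpl Z.of_nat in R1, R2, R3. simpl Z.mul in R1, R2, R3. simpl Z.add in R1, R2, R3. simpl Z.mul in R1, R2, R3.
  set (G1 := Gh beta 1) in *. set (G2 := Gh beta 2) in *. set (G3 := Gh beta 3) in *. set (G4 := Gh beta 4) in *.
  assert (D1 : fD G1 = (fC 5 * G2 - fC 2 * (G1 * G1))%fp).
  { replace (fD G1) with (fC 5 * G2 - (fC 5 * G2 - fD G1))%fp by ring. rewrite <- R1. ring. }
  assert (D2 : fD G2 = (fC 14 * G3 - fC 8 * (G1 * G2))%fp).
  { replace (fD G2) with (fC 14 * G3 - (fC 14 * G3 - fD G2))%fp by ring. rewrite <- R2. ring. }
  assert (D3 : (fC 7 * fD G3 = fC 120 * (G2 * G2) - fC 84 * (G1 * G3))%fp).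
  { replace (fC 7 * fD G3)%fp with (fC 27 * (fC 7 * G4) - fC 7 * (fC 27 * G4 - fD G3))%fp by ring.
    rewrite <- R3, <- R4. ring. }
  repeat split; rewrite fD_mul, fD_C.
  - rewrite D1. unfold fZ. ring.
  - rewrite D2. unfold fZ. ring.
  - replace (fZ 2 * (fC 0 * G3 + fC (-60480) * fD G3))%fp with (fC (-17280) * (fC 7 * fD G3))%fp by (unfold fZ; ring).
    rewrite D3. ring.
Qed.

(** * The substitution of q^r for q *)

Definition dil (r : nat) (f : fps) : fps := fun n => if (n mod r =? 0)%nat then f (n / r)%nat else 0.

Lemma dil_add r f g : dil r (f + g)%fp = (dil r f + dil r g)%fp.
Proof. apply fps_ext; intros n; unfold dil, fadd; destruct (_ =? _)%nat; ring. Qed.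
Lemma dil_sub r f g : dil r (f - g)%fp = (dil r f - dil r g)%fp.
Proof. apply fps_ext; intros n; unfold dil, fsub; destruct (_ =? _)%nat; ring. Qed.
Lemma dil_scal r c f : dil r (fscal c f) = fscal c (dil r f).
Proof. apply fps_ext; intros n; unfold dil, fscal; destruct (_ =? _)%nat; ring. Qed.
Lemma dil_0 r f : dil r f O = f O.
Proof. unfold dil. rewrite Nat.Div0.mod_0_l, Nat.Div0.div_0_l. reflexivity. Qed.
Lemma dil_unfold r f : (0 < r)%nat -> dil r f = (fC (f O) + fX r * dil r (ftail f))%fp.
Proof.
  intros Hr. apply fps_ext; intros n. unfold fadd. rewrite fX_mul. unfold dil.
  destruct (Nat.ltb_spec n r) as [L|L].
  - rewrite Nat.mod_small, Nat.div_small by auto. destruct n; simpl; ring.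
  - replace (n mod r) with ((n - r) mod r)
      by (replace n with ((n - r) + 1 * r)%nat at 2 by lia; symmetry; apply Nat.Div0.mod_add).
    replace (n / r)%nat with (S ((n - r) / r))
      by (replace n with ((n - r) + 1 * r)%nat at 2 by lia; rewrite Nat.div_add by lia; lia).
    unfold ftail. destruct n; [lia|]. simpl (fC (f O) (S n)). ring.
Qed.
Lemma dil_C r c : (0 < r)%nat -> dil r (fC c) = fC c.
Proof.
  intros Hr. apply fps_ext; intros n. induction n as [n IH] using (well_founded_induction lt_wf).
  unfold dil. destruct (Nat.eqb_spec (n mod r) 0) as [E|E].
  - destruct n as [|n]; [rewrite Nat.Div0.div_0_l; reflexivity|].
    apply Nat.Lcm0.mod_divide in E. destruct E as [e E]. rewrite E, Nat.div_mul by lia.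
    destruct e; [lia|]. destruct (S e * r)%nat eqn:Z; [lia|reflexivity].
  - destruct n; [rewrite Nat.Div0.mod_0_l in E; lia | reflexivity].
Qed.
(** By [dil_unfold] both sides have the same leading part and a remainder with factor q^r, to which
    strong induction on the coefficient applies. *)
Lemma dil_mul r f g : (0 < r)%nat -> dil r (f * g)%fp = (dil r f * dil r g)%fp.
Proof.
  intros Hr. apply fps_ext. intros n. revert f.
  induction n as [n IH] using (well_founded_induction lt_wf). intros f.
  assert (E1 : dil r (f * g)%fp = (fC (f O) * dil r g + fX r * dil r (ftail f * g))%fp).
  { rewrite (dil_unfold r (f * g)%fp), (dil_unfold r g) by auto.
    change (ftail (f * g)%fp) with (fscal (f O) (ftail g) + ftail f * g)%fp.
    rewrite dil_add, dil_scal, fscalE, fmul_0, fC_mul. ring. }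
  rewrite E1, (dil_unfold r f) by auto.
  replace ((fC (f O) + fX r * dil r (ftail f)) * dil r g)%fp
    with (fC (f O) * dil r g + fX r * (dil r (ftail f) * dil r g))%fp by ring.
  unfold fadd. f_equal. rewrite !fX_mul. destruct (Nat.ltb_spec n r); [reflexivity|]. apply IH; lia.
Qed.
Lemma fD_dil r f : fD (dil r f) = (fC (INR r) * dil r (fD f))%fp.
Proof.
  rewrite fmul_C. apply fps_ext; intros n. unfold fD, fscal, dil.
  destruct (Nat.eqb_spec (n mod r) 0) as [E|E]; [|ring].
  rewrite (Nat.div_mod_eq n r) at 1. rewrite E, Nat.add_0_r, mult_INR. ring.
Qed.
Lemma dil_fsumL r l F : dil r (fsumL l F) = fsumL l (fun i => dil r (F i)).
Proof.
  apply fps_ext; intros n. unfold dil, fsumL. destruct (_ =? _)%nat; [reflexivity|].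
  symmetry; apply sumL_0; auto.
Qed.

(** Under q -> q^r the operator D gains a factor r; the factors r, r^2, r^3 in weights 2, 4, 6
    compensate because the system is homogeneous in the weight. *)
Lemma dil_ramanujan r Q F H : (0 < r)%nat -> ramanujan_system Q F H ->
  ramanujan_system (fC (INR r) * dil r Q)%fp (fC (INR r ^ 2) * dil r F)%fp (fC (INR r ^ 3) * dil r H)%fp.
Proof.
  intros Hr [S1 [S2 S3]]. replace (INR r ^ 3) with (INR r * INR r * INR r) by ring.
  replace (INR r ^ 2) with (INR r * INR r) by ring. rewrite !fC_mul.
  apply (f_equal (dil r)) in S1, S2, S3. unfold fZ in *.
  replace (Q ^ 2)%fp with (Q * Q)%fp in S1 by ring. replace (F ^ 2)%fp with (F * F)%fp in S3 by ring.
  rewrite dil_sub, !dil_mul, dil_C in S1 by auto. rewrite dil_sub, !dil_mul, dil_C in S2 by auto.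
  rewrite dil_sub, !dil_mul, dil_C in S3 by auto.
  set (c := fC (INR r)) in *.
  assert (Dc : fD c = fC 0) by apply fD_C.
  repeat split; unfold fZ; rewrite !fD_mul, fD_dil, !Dc; fold c.
  - match goal with |- ?L = _ => replace L with (c * c * (fC 12 * dil r (fD Q)))%fp by ring end. rewrite S1. ring.
  - match goal with |- ?L = _ => replace L with (c * c * c * (fC 3 * dil r (fD F)))%fp by ring end. rewrite S2. ring.
  - match goal with |- ?L = _ => replace L with (c * c * c * c * (fC 2 * dil r (fD H)))%fp by ring end. rewrite S3. ring.
Qed.

(** Both triples solve Ramanujan's system, start with r, r^2, r^3 and share the coefficient -24 r of
    q^r, so [ramanujan_unique] identifies them. *)
Lemma eisenstein_uniformized beta B A t : is_beta beta ->
  A O = 1 -> B O = 0 -> t O = 0 ->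
  fD B = (B ^ 2 - A ^ 4 * spol t)%fp -> fD A = (A * B)%fp -> fD t = (t * pre t * A ^ 2)%fp ->
  forall r, List.In r [1; 2; 3; 4; 6; 12]%nat ->
  (fZ 12 * B + A ^ 2 * ev (e2pol r) t)%fp O = INR r /\
  (fZ 12 * B + A ^ 2 * ev (e2pol r) t)%fp r = - 24 * INR r ->
  (fC (INR r * -24) * dil r (Gh beta 1) = fZ 12 * B + A ^ 2 * ev (e2pol r) t)%fp /\
  (fC (INR r ^ 2 * 1440) * dil r (Gh beta 2) = A ^ 4 * ev (e4pol r) t)%fp.
Proof.
  intros H A0 B0 t0 HB HA Ht r Hr [Q0 Qr].
  assert (r0 : (0 < r)%nat) by (each_divisor Hr; lia).
  assert (S1 := uniformized_system B A t HB HA Ht r Hr).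
  assert (S2 := dil_ramanujan r _ _ _ r0 (Gh_ramanujan beta H)).
  destruct (ramanujan_unique r _ _ _ _ _ _ r0 S2 S1) as [E1 [E2 _]].
  - rewrite fmul_0, dil_0, fmul_0, Gh_0. simpl (2 * 1)%nat. rewrite bev_2 by auto. simpl fC. field.
  - exact Q0.
  - rewrite fmul_0, dil_0, fmul_0, Gh_0. simpl (2 * 2)%nat. rewrite bev_4 by auto. simpl fC. field.
  - rewrite fmul_0, fpow_0, A0. each_divisor Hr; cbn [ev fold_right e4pol]; unfold fadd; rewrite fmul_0, t0; simpl; ring.
  - rewrite fmul_0, dil_0, fmul_0, Gh_0. simpl (2 * 3)%nat. rewrite bev_6 by auto. simpl fC. field.
  - rewrite fmul_0, fpow_0, A0. each_divisor Hr; cbn [ev fold_right e6pol]; unfold fadd; rewrite fmul_0, t0; simpl; ring.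
  - rewrite Qr, fmul_C. unfold fscal, dil at 1.
    rewrite Nat.Div0.mod_same, Nat.div_same by lia. simpl (0 =? 0)%nat. cbv iota.
    rewrite fmul_C. unfold fscal, Gh, fadd. simpl (fC _ 1%nat). unfold Sh, Sg, fexp. simpl. field.
  - rewrite <- E1, <- E2. rewrite !dil_mul, !dil_C, !fC_mul by auto. split; ring.
Qed.

(** * Euler products *)

Fixpoint eprod (r N : nat) : fps :=
  match N with O => fC 1 | S M => (eprod r M * (fC 1 - fX (r * S M)))%fp end.
(** The infinite product of the 1 - q^(rm). Its coefficient n is read off from n factors, as for r >
    0 the later ones are 1 modulo q^(n+1). *)
Definition euler (r : nat) : fps := fun n => eprod r n n.

Lemma eprod_0 r N : (0 < r)%nat -> eprod r N O = 1.
Proof.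
  intros Hr. induction N as [|N IH]; [reflexivity|]. cbn [eprod]. rewrite fmul_0, IH.
  unfold fsub, fX. destruct (Nat.eqb_spec 0 (r * S N)); [lia|]. simpl. ring.
Qed.
Lemma eprod_eqm r N M : (0 < r)%nat -> (N <= M)%nat -> eqm (S N) (eprod r M) (eprod r N).
Proof.
  intros Hr HM. induction HM as [|M HM IH]; [apply eqm_refl|]. cbn [eprod].
  replace (eprod r N) with (eprod r N * (fC 1 - fC 0))%fp by ring.
  apply eqm_mul; auto. apply eqm_sub; [apply eqm_refl|].
  replace (fX (r * S M)) with (fX (r * S M) * fC 1)%fp by ring. apply eqm_Xmul. nia.
Qed.
Lemma euler_eqm r N : (0 < r)%nat -> eqm (S N) (euler r) (eprod r N).
Proof. intros Hr n Hn. unfold euler. symmetry. apply eprod_eqm; auto; lia. Qed.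

(** The series -a q^a/(1 - q^a), the logarithmic derivative of 1 - q^a. *)
Definition geoL (a : nat) : fps := fun n => if ((1 <=? n)%nat && (n mod a =? 0)%nat)%bool then - INR a else 0.

Lemma mod_sub_eqb n a : (a <= n)%nat -> ((n - a) mod a =? 0)%nat = (n mod a =? 0)%nat.
Proof.
  intros H. replace n with ((n - a) + 1 * a)%nat at 2 by lia. rewrite Nat.Div0.mod_add. reflexivity.
Qed.
Lemma LD_factor a : (0 < a)%nat -> LD (fC 1 - fX a)%fp (geoL a).
Proof.
  intros Ha. split.
  - unfold fsub, fX. destruct (Nat.eqb_spec 0 a); [lia|]. simpl. ring.
  - rewrite fD_sub, fD_C, fD_X.
    replace ((fC 1 - fX a) * geoL a)%fp with (geoL a - fX a * geoL a)%fp by ring.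
    rewrite fmul_C. apply fps_ext; intros n. unfold fsub, fscal. rewrite fX_mul.
    unfold geoL, fX. rewrite (ltac:(destruct n; reflexivity) : fC 0 n = 0).
    destruct (Nat.ltb_spec n a).
    + destruct (Nat.eqb_spec n a); [lia|]. destruct (Nat.leb_spec 1 n); simpl; [|ring].
      rewrite Nat.mod_small by auto. destruct (Nat.eqb_spec n 0); [lia|ring].
    + rewrite mod_sub_eqb by auto. destruct (Nat.leb_spec 1 n); [|lia].
      destruct (Nat.eqb_spec n a) as [->|Hn].
      * rewrite Nat.sub_diag, Nat.Div0.mod_same. simpl. ring.
      * destruct (Nat.leb_spec 1 (n - a)); [|lia]. destruct (n mod a =? 0)%nat; simpl; ring.
Qed.
Lemma LD_eprod r N : (0 < r)%nat -> LD (eprod r N) (fsumL (seq 1 N) (fun m => geoL (r * m))).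
Proof.
  intros Hr. induction N as [|N IH].
  - simpl. rewrite fsumL_nil. apply LD_1.
  - replace (fsumL (seq 1 (S N)) (fun m => geoL (r * m)))
      with (fsumL (seq 1 N) (fun m => geoL (r * m)) + geoL (r * S N))%fp
      by (apply fps_ext; intros n; unfold fsumL; rewrite sumL_seq_S; reflexivity).
    apply LD_mul; auto. apply LD_factor; lia.
Qed.

(** Each m with rm dividing i contributes -rm, and such m divide i/r; for i <= N none of them is cut
    off. *)
Lemma geoL_sum r N i : (0 < r)%nat -> (i <= N)%nat ->
  fsumL (seq 1 N) (fun m => geoL (r * m)) i = - INR r * dil r (Sg INR) i.
Proof.
  intros Hr Hi. unfold fsumL, dil. destruct (Nat.eqb_spec (i mod r) 0) as [E|E].
  - apply Nat.Lcm0.mod_divide in E. destruct E as [j ->]. rewrite Nat.div_mul by lia.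
    unfold Sg. rewrite (sumL_filter (fun m => ((1 <=? j)%nat && (j mod m =? 0)%nat)%bool) (seq 1 N)).
    rewrite (sumL_0 (filter (fun x => negb _) _)).
    + rewrite Rplus_0_r, <- sumL_scal. apply (sumL_bij _ _ (fun m => m) (fun m => m)).
      * apply NoDup_filter, seq_NoDup.
      * apply NoDup_divs.
      * intros m Hm. apply filter_In in Hm. destruct Hm as [H1 H2]. apply in_seq in H1.
        apply andb_prop in H2. destruct H2 as [H2 H3]. apply Nat.leb_le in H2.
        assert (J := H3). apply Nat.eqb_eq, Nat.Lcm0.mod_divide in J. destruct J as [e J].
        repeat split.
        -- apply in_divs. split; [lia|]. exists e. nia.
        -- unfold geoL. subst j. replace (e * m * r)%nat with (e * (r * m))%nat by ring.
           rewrite Nat.Div0.mod_mul, mult_INR. destruct (Nat.leb_spec 1 (e * (r * m))); [simpl; ring|nia].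
      * intros m Hm. split; auto. apply in_divs in Hm. destruct Hm as [H1 [e [H2 H3]]].
        apply filter_In. rewrite in_seq. split; [nia|].
        rewrite <- H3 at 2. rewrite Nat.mul_comm, Nat.Div0.mod_mul. destruct (Nat.leb_spec 1 j); [reflexivity|nia].
    + intros m Hm. apply filter_In in Hm. destruct Hm as [H1 H2]. apply in_seq in H1. unfold geoL.
      destruct (Nat.leb_spec 1 (j * r)); [|reflexivity].
      destruct (Nat.eqb_spec ((j * r) mod (r * m)) 0) as [K|K]; [|reflexivity].
      exfalso. apply Nat.Lcm0.mod_divide in K. destruct K as [e K].
      assert (j = e * m)%nat by nia. subst j. rewrite Nat.Div0.mod_mul in H2.
      destruct (Nat.leb_spec 1 (e * m)); [discriminate|nia].
  - rewrite sumL_0; [ring|]. intros m Hm. unfold geoL.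
    destruct (Nat.leb_spec 1 i); [|reflexivity].
    destruct (Nat.eqb_spec (i mod (r * m)) 0) as [K|K]; [|reflexivity].
    exfalso. apply E. apply Nat.Lcm0.mod_divide in K. destruct K as [e ->].
    apply Nat.Lcm0.mod_divide. exists (e * m)%nat. ring.
Qed.

Lemma LD_euler r : (0 < r)%nat -> LD (euler r) (fC (- INR r) * dil r (Sg INR))%fp.
Proof.
  intros Hr. split; [apply eprod_0; auto|]. apply fps_ext. intros n.
  destruct (LD_eprod r n Hr) as [_ H]. apply (f_equal (fun f : fps => f n)) in H.
  assert (E := euler_eqm r n Hr). unfold fD in *. rewrite (E n) by lia. rewrite H.
  apply fmul_congr; intros i Hi; [symmetry; apply E; lia|].
  rewrite fmul_C. apply geoL_sum; auto.
Qed.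

Lemma LD_div f g h L M : g O = 1 -> (f * g)%fp = h -> LD g L -> LD h M -> LD f (M - L)%fp.
Proof.
  intros g0 E Hg Hh. destruct (finv_exists g) as [w Hw]; [rewrite g0; lra|].
  assert (Hf : f = (h * w)%fp).
  { rewrite <- E. replace (f * g * w)%fp with (f * (g * w))%fp by ring. rewrite Hw. ring. }
  rewrite Hf. replace (M - L)%fp with (M + - L)%fp by ring.
  apply LD_mul; auto. eapply LD_inv; eauto.
Qed.

Lemma dil_dil r s f : (0 < r)%nat -> (0 < s)%nat -> dil r (dil s f) = dil (r * s) f.
Proof.
  intros Hr Hs. apply fps_ext; intros n. unfold dil.
  destruct (Nat.eqb_spec (n mod (r * s)) 0) as [E|E].
  - apply Nat.Lcm0.mod_divide in E. destruct E as [e ->].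
    replace (e * (r * s))%nat with (e * s * r)%nat by ring. rewrite Nat.Div0.mod_mul, Nat.div_mul by lia.
    rewrite Nat.Div0.mod_mul, Nat.div_mul by lia.
    replace (e * s * r)%nat with (e * (r * s))%nat by ring. rewrite Nat.div_mul by lia. reflexivity.
  - destruct (Nat.eqb_spec (n mod r) 0) as [E1|E1]; [|reflexivity].
    destruct (Nat.eqb_spec ((n / r) mod s) 0) as [E2|E2]; [|reflexivity].
    exfalso. apply E. apply Nat.Lcm0.mod_divide in E1. destruct E1 as [e ->].
    rewrite Nat.div_mul in E2 by lia. apply Nat.Lcm0.mod_divide in E2. destruct E2 as [e' ->].
    apply Nat.Lcm0.mod_divide. exists e'. ring.
Qed.
Lemma LD_dil r f L : (0 < r)%nat -> LD f L -> LD (dil r f) (fC (INR r) * dil r L)%fp.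
Proof.
  intros Hr [f0 Hf]. split; [rewrite dil_0; auto|]. rewrite fD_dil, Hf, dil_mul by auto. ring.
Qed.
Lemma dil_euler r s : (0 < r)%nat -> (0 < s)%nat -> dil r (euler s) = euler (r * s).
Proof.
  intros Hr Hs. eapply LD_unique; [apply LD_dil, LD_euler; auto|].
  eapply LD_ext; [apply LD_euler; lia|].
  rewrite dil_mul, dil_C, dil_dil, mult_INR by auto.
  replace (- (INR r * INR s)) with (INR r * - INR s) by ring. rewrite fC_mul. ring.
Qed.

(** * Gauss's product for the theta series *)

Definition zlist (M : nat) : list Z := map (fun i => Z.of_nat i - Z.of_nat M)%Z (seq 0 (2 * M + 1)).

Lemma in_zlist M x : List.In x (zlist M) <-> (- Z.of_nat M <= x <= Z.of_nat M)%Z.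
Proof.
  unfold zlist. rewrite in_map_iff. split.
  - intros [i [<- Hi]]. apply in_seq in Hi. lia.
  - intros H. exists (Z.to_nat (x + Z.of_nat M)). rewrite in_seq. lia.
Qed.
Lemma NoDup_zlist M : NoDup (zlist M).
Proof. apply FinFun.Injective_map_NoDup; [intros x y; lia | apply seq_NoDup]. Qed.

(** The theta series of r x^2; for r > 0 a solution of r x^2 = n satisfies |x| <= n, so the finite
    search misses nothing. *)
Definition theta (r : nat) : fps := fun n =>
  INR (length (filter (fun x => (Z.of_nat r * x ^ 2 =? Z.of_nat n)%Z) (zlist n))).

Lemma theta_bound r M n : (0 < r)%nat -> (n <= M)%nat ->
  theta r n = sumL (zlist M) (fun x => if (Z.of_nat r * x ^ 2 =? Z.of_nat n)%Z then 1 else 0).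
Proof.
  intros Hr HM. unfold theta.
  rewrite (sumL_filter (fun x => (Z.of_nat r * x ^ 2 =? Z.of_nat n)%Z)).
  rewrite (sumL_0 (filter (fun x => negb _) _)).
  - rewrite Rplus_0_r. rewrite (sumL_ext _ _ (fun _ => 1)).
    + rewrite sumL_const, Rmult_1_r. f_equal. apply Permutation_length.
      apply NoDup_Permutation; try (apply NoDup_filter, NoDup_zlist).
      intros x. rewrite !filter_In, !in_zlist, !Z.eqb_eq. split; intros [H1 H2]; split; auto; try lia; nia.
    + intros x Hx. apply filter_In in Hx. destruct Hx as [_ ->]. reflexivity.
  - intros x Hx. apply filter_In in Hx. destruct Hx as [_ Hx].
    destruct (_ =? _)%Z; [discriminate|reflexivity].
Qed.

Definition geo (a : nat) : fps := fun n => if (n mod a =? 0)%nat then 1 else 0.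
Lemma geo_inv a : (0 < a)%nat -> ((fC 1 - fX a) * geo a)%fp = fC 1.
Proof.
  intros Ha. replace ((fC 1 - fX a) * geo a)%fp with (geo a - fX a * geo a)%fp by ring.
  apply fps_ext; intros n. unfold fsub. rewrite fX_mul. unfold geo. destruct (Nat.ltb_spec n a).
  - rewrite Nat.mod_small by auto. destruct n; simpl; ring.
  - rewrite mod_sub_eqb by auto. destruct n; [lia|]. simpl fC. ring.
Qed.

(** The inverse of the product of the first N factors 1 - q^(2m): the denominators of Gaussian
    binomials in q^2. *)
Fixpoint winv (N : nat) : fps :=
  match N with O => fC 1 | S M => (winv M * geo (2 * S M))%fp end.
Lemma winv_spec N : (eprod 2 N * winv N)%fp = fC 1.
Proof.
  induction N as [|N IH]; [simpl; ring|]. cbn [eprod winv].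
  replace (eprod 2 N * (fC 1 - fX (2 * S N)) * (winv N * geo (2 * S N)))%fp
    with (eprod 2 N * winv N * ((fC 1 - fX (2 * S N)) * geo (2 * S N)))%fp by ring.
  rewrite IH, geo_inv by lia. ring.
Qed.
Lemma winv_S N : ((fC 1 - fX (2 * S N)) * winv (S N))%fp = winv N.
Proof.
  cbn [winv].
  replace ((fC 1 - fX (2 * S N)) * (winv N * geo (2 * S N)))%fp
    with (winv N * ((fC 1 - fX (2 * S N)) * geo (2 * S N)))%fp by ring.
  rewrite geo_inv by lia. ring.
Qed.

(** This is (j - b)^2: with truncated subtraction at least one of the summands is 0. *)
Definition sqd (j b : nat) : nat := ((j - b) * (j - b) + (b - j) * (b - j))%nat.

(** Finite form of Jacobi's triple product at x = 1: the factor of q^((j-b)^2) is the Gaussian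
    binomial coefficient [a+b choose j] in q^2. *)
Definition jac (a b : nat) : fps :=
  fsumL (seq 0 (S (a + b))) (fun j => fX (sqd j b) * eprod 2 (a + b) * winv j * winv (a + b - j))%fp.

Lemma fsumL_seq_S s n F : fsumL (seq s (S n)) F = (fsumL (seq s n) F + F (s + n)%nat)%fp.
Proof. apply fps_ext; intros i. unfold fsumL. rewrite sumL_seq_S. reflexivity. Qed.
Lemma fsumL_add l F G : fsumL l (fun i => F i + G i)%fp = (fsumL l F + fsumL l G)%fp.
Proof. apply fps_ext; intros n. apply sumL_add. Qed.
Lemma fsumL_shift n F : fsumL (seq 0 (S n)) F = (F O + fsumL (seq 0 n) (fun j => F (S j)))%fp.
Proof.
  apply fps_ext; intros i. unfold fsumL, fadd. change (seq 0 (S n)) with (O :: seq 1 n).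
  rewrite sumL_cons, <- seq_shift, sumL_map. reflexivity.
Qed.

Lemma fX_split (x y z : nat) : x = (y + z)%nat -> fX x = (fX y * fX z)%fp.
Proof. intros ->. symmetry; apply fX_add. Qed.

(** The q-Pascal rule with Q = q^2 and m = a + b, from 1 - Q^(m+1) = (1 - Q^(m+1-j)) + Q^(m+1-j) (1
    - Q^j): the first part keeps the index j, the second becomes the term j - 1 times q^(2a+1). *)
Lemma jac_S_a a b : jac (S a) b = ((fC 1 + fX (2 * a + 1)) * jac a b)%fp.
Proof.
  unfold jac. replace (S a + b)%nat with (S (a + b)) by lia. set (m := (a + b)%nat).
  (* The case distinction makes the boundary term j = m + 1 vanish, where truncated subtraction
     would give [winv 0] = 1. *)
  set (G := fun j : nat => (fX (sqd j b) * eprod 2 m * winv j * (if (j <=? m)%nat then winv (m - j) else fC 0))%fp).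
  set (K := fun j : nat => match j with O => fC 0 | S i =>
     (fX (2 * a + 1) * (fX (sqd i b) * eprod 2 m * winv i * winv (m - i)))%fp end).
  rewrite (fsumL_ext _ _ (fun j => (G j + K j)%fp)).
  - rewrite fsumL_add, (fsumL_seq_S 0 (S m) G), (fsumL_shift (S m) K).
    unfold G at 2, K at 1. replace (0 + S m <=? m)%nat with false by (symmetry; apply Nat.leb_gt; lia).
    rewrite (fsumL_ext _ G (fun j => fX (sqd j b) * eprod 2 m * winv j * winv (m - j))%fp).
    + unfold K. rewrite fsumL_mull. ring.
    + intros j Hj. apply in_seq in Hj. unfold G. destruct (Nat.leb_spec j m); [reflexivity|lia].
  - intros j Hj. apply in_seq in Hj. unfold G, K. cbn [eprod].
    assert (E : forall n, (n <= S m)%nat -> ((fC 1 - fX (2 * S m)) * winv j * winv (S m - j)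
       = (fC 1 - fX (2 * (S m - j))) * winv (S m - j) * winv j
         + fX (2 * (S m - j)) * ((fC 1 - fX (2 * j)) * winv j) * winv (S m - j))%fp).
    { intros _ _. rewrite (fX_split (2 * S m) (2 * (S m - j)) (2 * j)) by lia. ring. }
    specialize (E O ltac:(lia)).
    replace (fX (sqd j b) * (eprod 2 m * (fC 1 - fX (2 * S m))) * winv j * winv (S m - j))%fp
      with (fX (sqd j b) * eprod 2 m * ((fC 1 - fX (2 * S m)) * winv j * winv (S m - j)))%fp by ring.
    rewrite E.
    assert (E1 : ((fC 1 - fX (2 * (S m - j))) * winv (S m - j)
                  = if (j <=? m)%nat then winv (m - j) else fC 0)%fp).
    { destruct (Nat.leb_spec j m).
      - replace (S m - j)%nat with (S (m - j)) by lia. apply winv_S.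
      - replace (S m - j)%nat with O by lia. simpl (2 * 0)%nat. rewrite fX0. ring. }
    rewrite E1. destruct j as [|i].
    + simpl (2 * 0)%nat. rewrite fX0. ring.
    + rewrite winv_S. replace (S m - S i)%nat with (m - i)%nat by lia.
      replace (fX (2 * a + 1) * (fX (sqd i b) * eprod 2 m * winv i * winv (m - i)))%fp
        with ((fX (sqd i b) * fX (2 * a + 1)) * eprod 2 m * winv i * winv (m - i))%fp by ring.
      rewrite <- (fX_split (sqd (S i) b + 2 * (m - i)) (sqd i b) (2 * a + 1)), <- fX_add; [ring|].
      unfold sqd, m. destruct (Nat.le_ge_cases b i).
      * replace (b - S i)%nat with O by lia. replace (b - i)%nat with O by lia.
        replace (S i - b)%nat with (S (i - b)) by lia. unfold m in Hj. nia.
      * replace (i - b)%nat with O by lia. replace (S i - b)%nat with (1 - (b - i))%nat by lia.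
        destruct (b - i)%nat eqn:Ebi; [replace (b - S i)%nat with O by lia; simpl; lia|].
        replace (b - S i)%nat with n by lia. replace (1 - S n)%nat with O by lia. nia.
Qed.

(** The other q-Pascal rule, from 1 - Q^(m+1) = Q^j (1 - Q^(m+1-j)) + (1 - Q^j). The squares are now
    centred at b + 1, and the part keeping j acquires q^(2b+1). *)
Lemma jac_S_b a b : jac a (S b) = ((fC 1 + fX (2 * b + 1)) * jac a b)%fp.
Proof.
  unfold jac. replace (a + S b)%nat with (S (a + b)) by lia. set (m := (a + b)%nat).
  set (G := fun j : nat => (fX (2 * b + 1) * (fX (sqd j b) * eprod 2 m * winv j * (if (j <=? m)%nat then winv (m - j) else fC 0)))%fp).
  set (K := fun j : nat => match j with O => fC 0 | S i =>
     (fX (sqd i b) * eprod 2 m * winv i * winv (m - i))%fp end).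
  rewrite (fsumL_ext _ _ (fun j => (G j + K j)%fp)).
  - rewrite fsumL_add, (fsumL_seq_S 0 (S m) G), (fsumL_shift (S m) K).
    unfold G at 2, K at 1. replace (0 + S m <=? m)%nat with false by (symmetry; apply Nat.leb_gt; lia).
    rewrite (fsumL_ext _ G (fun j => fX (2 * b + 1) * (fX (sqd j b) * eprod 2 m * winv j * winv (m - j)))%fp).
    + unfold K. rewrite fsumL_mull. ring.
    + intros j Hj. apply in_seq in Hj. unfold G. destruct (Nat.leb_spec j m); [reflexivity|lia].
  - intros j Hj. apply in_seq in Hj. unfold G, K. cbn [eprod].
    assert (E : ((fC 1 - fX (2 * S m)) * winv j * winv (S m - j)
       = fX (2 * j) * ((fC 1 - fX (2 * (S m - j))) * winv (S m - j)) * winv j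
         + ((fC 1 - fX (2 * j)) * winv j) * winv (S m - j))%fp).
    { rewrite (fX_split (2 * S m) (2 * (S m - j)) (2 * j)) by lia. ring. }
    replace (fX (sqd j (S b)) * (eprod 2 m * (fC 1 - fX (2 * S m))) * winv j * winv (S m - j))%fp
      with (fX (sqd j (S b)) * eprod 2 m * ((fC 1 - fX (2 * S m)) * winv j * winv (S m - j)))%fp by ring.
    rewrite E.
    assert (E1 : ((fC 1 - fX (2 * (S m - j))) * winv (S m - j)
                  = if (j <=? m)%nat then winv (m - j) else fC 0)%fp).
    { destruct (Nat.leb_spec j m).
      - replace (S m - j)%nat with (S (m - j)) by lia. apply winv_S.
      - replace (S m - j)%nat with O by lia. simpl (2 * 0)%nat. rewrite fX0. ring. }
    rewrite E1. set (W := if (j <=? m)%nat then winv (m - j) else fC 0).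
    assert (E2 : (fX (sqd j (S b)) * fX (2 * j) = fX (sqd j b) * fX (2 * b + 1))%fp).
    { rewrite !fX_add. f_equal. unfold sqd. destruct (Nat.le_gt_cases (S b) j).
      - replace (b - j)%nat with O by lia. replace (S b - j)%nat with O by lia.
        replace (j - b)%nat with (S (j - S b)) by lia. nia.
      - replace (j - S b)%nat with O by lia. replace (S b - j)%nat with (S (b - j)) by lia.
        replace (j - b)%nat with O by lia. nia. }
    match goal with |- ?L = _ => replace L with
      (fX (sqd j (S b)) * fX (2 * j) * eprod 2 m * W * winv j
       + fX (sqd j (S b)) * eprod 2 m * ((fC 1 - fX (2 * j)) * winv j) * winv (S m - j))%fp by ring end.
    rewrite E2. destruct j as [|i].
    + simpl (2 * 0)%nat. rewrite fX0. ring.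
    + rewrite winv_S. replace (S m - S i)%nat with (m - i)%nat by lia.
      replace (sqd (S i) (S b)) with (sqd i b) by reflexivity. ring.
Qed.

Fixpoint oprod (N : nat) : fps :=
  match N with O => fC 1 | S M => (oprod M * (fC 1 + fX (2 * M + 1)))%fp end.

Lemma jac_diag n : jac n n = (oprod n * oprod n)%fp.
Proof.
  assert (H : forall a b, jac a b = (oprod a * oprod b)%fp).
  { induction a as [|a IH]; intros b.
    - induction b as [|b IHb].
      + unfold jac. change (seq 0 (S (0 + 0))) with [O]. rewrite fsumL_cons, fsumL_nil.
        change (sqd 0 0) with O. rewrite fX0. cbn [eprod winv oprod Nat.add Nat.sub]. ring.
      + rewrite jac_S_b, IHb. cbn [oprod]. ring.
    - rewrite jac_S_a, IH. cbn [oprod]. ring. }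
  apply H.
Qed.

(** With x = q^(2n+1) the factors 1 + x and 1 - x combine to 1 - q^(2(2n+1)); this turns the product
    over odd exponents into a quotient of Euler products. *)
Lemma oprod_eprod n :
  (oprod n * eprod 1 (2 * n) * eprod 4 n = eprod 2 (2 * n) * eprod 2 n)%fp.
Proof.
  induction n as [|n IH]; [simpl; ring|].
  replace (2 * S n)%nat with (S (S (2 * n))) by lia. cbn [oprod eprod].
  replace (1 * S (2 * n))%nat with (2 * n + 1)%nat by lia.
  replace (2 * S (2 * n))%nat with ((2 * n + 1) + (2 * n + 1))%nat by lia.
  replace (1 * S (S (2 * n)))%nat with (2 * S n)%nat by lia.
  replace (2 * S (S (2 * n)))%nat with (4 * S n)%nat by lia.
  rewrite <- (fX_add (2 * n + 1) (2 * n + 1)). set (x := fX (2 * n + 1)). set (y := fX (2 * S n)). set (z := fX (4 * S n)).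
  match goal with |- ?L = _ => replace L with
    ((oprod n * eprod 1 (2 * n) * eprod 4 n) * ((fC 1 + x) * (fC 1 - x) * (fC 1 - y) * (fC 1 - z)))%fp by ring end.
  rewrite IH. ring.
Qed.

(** Modulo q^N a term either has (j - n)^2 >= N and drops out, or both j and 2n - j are at least N;
    then its Gaussian binomial is congruent to the inverse of [euler 2]. *)
Lemma jac_limit N n : (2 * N <= n)%nat -> eqm N (jac n n * euler 2)%fp (theta 1).
Proof.
  intros Hn. assert (E2 : forall M, (N <= M)%nat -> eqm N (eprod 2 M) (euler 2)).
  { intros M HM. apply eqm_sym, (eqm_le N (S M)); [lia|]. apply euler_eqm; lia. }
  assert (W : forall j, (N <= j)%nat -> eqm N (winv j * euler 2)%fp (fC 1)).
  { intros j Hj. rewrite <- (winv_spec j).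
    replace (eprod 2 j * winv j)%fp with (winv j * eprod 2 j)%fp by ring.
    apply eqm_mul; [apply eqm_refl | apply eqm_sym, E2; auto]. }
  assert (T : forall j, eqm N (fX (sqd j n) * eprod 2 (n + n) * winv j * winv (n + n - j) * euler 2)%fp (fX (sqd j n))).
  { intros j. destruct (Nat.le_gt_cases N (sqd j n)) as [L|L].
    - apply (eqm_trans _ _ (fC 0)).
      + match goal with |- eqm _ ?L _ => replace L with
          (fX (sqd j n) * (eprod 2 (n + n) * winv j * winv (n + n - j) * euler 2))%fp by ring end.
        apply eqm_Xmul; auto.
      + apply eqm_sym. replace (fX (sqd j n)) with (fX (sqd j n) * fC 1)%fp by ring. apply eqm_Xmul; auto.
    - assert (N <= j /\ N <= n + n - j)%nat by (unfold sqd in L; nia).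
      replace (fX (sqd j n)) with (fX (sqd j n) * (fC 1 * fC 1))%fp at 2 by ring.
      apply (eqm_trans _ _ (fX (sqd j n) * ((winv j * euler 2) * (winv (n + n - j) * euler 2)))%fp).
      + match goal with |- eqm _ ?L _ => replace L with
          (fX (sqd j n) * ((winv j * eprod 2 (n + n)) * (winv (n + n - j) * euler 2)))%fp by ring end.
        apply eqm_mul; [apply eqm_refl|]. apply eqm_mul; [|apply eqm_refl].
        apply eqm_mul; [apply eqm_refl | apply E2; lia].
      + apply eqm_mul; [apply eqm_refl|]. apply eqm_mul; apply W; lia. }
  intros k Hk. rewrite (theta_bound 1 n k) by lia. unfold zlist. rewrite sumL_map.
  replace (jac n n * euler 2)%fp with (euler 2 * jac n n)%fp by ring.
  unfold jac. rewrite <- fsumL_mull. unfold fsumL. replace (S (n + n)) with (2 * n + 1)%nat by lia.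
  apply sumL_ext. intros j Hj.
  replace (euler 2 * (fX (sqd j n) * eprod 2 (n + n) * winv j * winv (n + n - j)))%fp
    with (fX (sqd j n) * eprod 2 (n + n) * winv j * winv (n + n - j) * euler 2)%fp by ring.
  rewrite (T j k Hk). unfold fX, sqd.
  destruct (Nat.eqb_spec k ((j - n) * (j - n) + (n - j) * (n - j))) as [E|E];
    destruct (Z.eqb_spec (Z.of_nat 1 * (Z.of_nat j - Z.of_nat n) ^ 2) (Z.of_nat k)) as [F|F]; try reflexivity; exfalso.
  - apply F. rewrite E. destruct (Nat.le_ge_cases j n).
    + replace (j - n)%nat with O by lia. nia.
    + replace (n - j)%nat with O by lia. nia.
  - apply E. destruct (Nat.le_ge_cases j n).
    + replace (j - n)%nat with O by lia. nia.
    + replace (n - j)%nat with O by lia. nia.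
Qed.

Lemma theta_product : (theta 1 * (euler 1 ^ 2 * euler 4 ^ 2) = euler 2 ^ 5)%fp.
Proof.
  apply eqm_all. intros N. set (n := (2 * N)%nat).
  assert (J := jac_limit N n (le_n _)).
  assert (E : forall r M, (0 < r)%nat -> (N <= M)%nat -> eqm N (euler r) (eprod r M)).
  { intros r M Hr HM. apply (eqm_le N (S M)); [lia|]. apply euler_eqm; auto. }
  eapply eqm_trans; [apply eqm_mul; [apply eqm_sym, J | apply eqm_refl]|].
  rewrite jac_diag.
  apply (eqm_trans _ _ (oprod n * oprod n * euler 2 * (eprod 1 (2 * n) ^ 2 * eprod 4 n ^ 2))%fp).
  - apply eqm_mul; [apply eqm_refl|]. apply eqm_mul; apply eqm_pow; apply E; unfold n; lia.
  - replace (oprod n * oprod n * euler 2 * (eprod 1 (2 * n) ^ 2 * eprod 4 n ^ 2))%fp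
      with (euler 2 * (oprod n * eprod 1 (2 * n) * eprod 4 n) ^ 2)%fp by ring.
    rewrite oprod_eprod. replace (euler 2 ^ 5)%fp with (euler 2 * (euler 2 * euler 2) ^ 2)%fp by ring.
    apply eqm_mul; [apply eqm_refl|]. apply eqm_pow.
    apply eqm_mul; apply eqm_sym, E; unfold n; lia.
Qed.

Lemma dil_theta r : (0 < r)%nat -> dil r (theta 1) = theta r.
Proof.
  intros Hr. apply fps_ext; intros n. unfold dil. rewrite (theta_bound r n n) by lia.
  destruct (Nat.eqb_spec (n mod r) 0) as [E|E].
  - rewrite (theta_bound 1 n) by (try lia; apply Nat.Div0.div_le_upper_bound; nia).
    apply Nat.Lcm0.mod_divide in E. destruct E as [e ->]. rewrite Nat.div_mul by lia.
    apply sumL_ext. intros x _.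
    destruct (Z.eqb_spec (Z.of_nat 1 * x ^ 2) (Z.of_nat e)); destruct (Z.eqb_spec (Z.of_nat r * x ^ 2) (Z.of_nat (e * r)));
      try reflexivity; exfalso; nia.
  - symmetry. apply sumL_0. intros x _. destruct (Z.eqb_spec (Z.of_nat r * x ^ 2) (Z.of_nat n)); [|reflexivity].
    exfalso. apply E. apply Nat.Lcm0.mod_divide. exists (Z.to_nat (x ^ 2)). nia.
Qed.

(** * Eta quotients as functions of the uniformizer *)

Lemma fps_cancel f g h : f O <> 0 -> (f * g)%fp = (f * h)%fp -> g = h.
Proof.
  intros f0 E. destruct (finv_exists f f0) as [w Hw].
  replace g with (f * w * g)%fp by (rewrite Hw; ring).
  replace h with (f * w * h)%fp by (rewrite Hw; ring).
  replace (f * w * g)%fp with (w * (f * g))%fp by ring. rewrite E. ring.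
Qed.

Definition lin (c : Z) (t : fps) : fps := (fZ 1 + fZ c * t)%fp.

(** All that later sections use of the differential system. The fields [un_pre], [un_u] and [un_A]
    say that the three brackets in the definition of C_(j,k) are pre(t), t = q u and A. *)
Record uniformization (A u t B : fps) : Prop := {
  un_t : t = (fX 1 * u)%fp;
  un_u0 : u O = 1;
  un_A0 : A O = 1;
  un_DA : fD A = (A * B)%fp;
  un_Dt : fD t = (t * pre t * A ^ 2)%fp;
  un_E2 : forall beta, is_beta beta -> forall r, List.In r [1; 2; 3; 4; 6; 12]%nat ->
    (fC (INR r * -24) * dil r (Gh beta 1) = fZ 12 * B + A ^ 2 * ev (e2pol r) t)%fp;
  un_E4 : forall beta, is_beta beta -> forall r, List.In r [1; 2; 3; 4; 6; 12]%nat ->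
    (fC (INR r ^ 2 * 1440) * dil r (Gh beta 2) = A ^ 4 * ev (e4pol r) t)%fp;
  un_A : (A * (euler 2 ^ 3 * euler 3 ^ 2) = euler 1 ^ 6 * euler 6)%fp;
  un_u : (u * (euler 1 ^ 3 * euler 4 * euler 6 ^ 2) = euler 2 ^ 2 * euler 3 * euler 12 ^ 3)%fp;
  un_pre : (pre t * (euler 1 ^ 15 * euler 12 ^ 3)
            = euler 2 ^ 10 * euler 3 ^ 5 * euler 4 * euler 6 ^ 2)%fp;
  un_theta_mul : (theta 1 * theta 3 = A * (lin 2 t * lin 6 t))%fp;
  un_theta_div : (theta 1 ^ 2 * lin 2 t = theta 3 ^ 2 * lin 6 t)%fp
}.

Ltac ld_tac :=
  repeat match goal with
  | H : LD ?f _ |- LD ?f _ => exact H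
  | |- LD (_ * _)%fp _ => eapply LD_mul
  | |- LD (_ ^ _)%fp _ => eapply LD_pow
  end.
Ltac ld_ring :=
  cbn [ev fold_right e2pol]; rewrite ?INR_IZR_INZ; cbn [Z.of_nat Pos.of_succ_nat Pos.succ];
  unfold pre, lin; ring.

Lemma uniformization_exists : exists A u t B, uniformization A u t B.
Proof.
  destruct uniformizer_exists as [B [A [u [t [Et [u0 [A0 [B0 [HB [HA [Ht [Hu Hq]]]]]]]]]]]].
  assert (t0 : t O = 0) by (rewrite Et, fX_mul; reflexivity).
  assert (EU := fun beta Hb r Hr => eisenstein_uniformized beta B A t Hb A0 B0 t0 HB HA Ht r Hr (Hq r Hr)).
  exists A, u, t, B.
  (* The Euler product in q^r has logarithmic derivative (r E_2(q^r) - r)/24. Taking 1/24, B/24 and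
     A^2/24 as atoms gives every comparison integer coefficients, so that [ring] decides it. *)
  set (k0 := fC (1/24)). set (b0 := (k0 * B)%fp). set (a0 := (k0 * A ^ 2)%fp).
  assert (K1 : (fC 24 * k0)%fp = fC 1) by (unfold k0; rewrite <- fC_mul; f_equal; field).
  assert (Kb : (fC 24 * b0)%fp = B) by (unfold b0; transitivity ((fC 24 * k0) * B)%fp; [ring | rewrite K1; ring]).
  assert (Ka : (fC 24 * a0 = A ^ 2)%fp) by (unfold a0; transitivity ((fC 24 * k0) * A ^ 2)%fp; [ring | rewrite K1; ring]).
  assert (LA : LD A (fC 24 * b0)%fp) by (rewrite Kb; split; auto).
  assert (Lu : LD u (pre t * (fC 24 * a0) - fC 24 * k0)%fp).
  { rewrite Ka, K1. split; auto. }
  assert (Le : forall r, List.In r [1; 2; 3; 4; 6; 12]%nat ->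
    LD (euler r) (fC 12 * b0 + a0 * ev (e2pol r) t - fC (INR r) * k0)%fp).
  { intros r Hr. assert (r0 : (0 < r)%nat) by (each_divisor Hr; lia).
    eapply LD_ext; [apply LD_euler; auto|].
    destruct beta_exists as [beta Hb]. destruct (EU beta Hb r Hr) as [E _].
    unfold a0, b0. transitivity (k0 * (fZ 12 * B + A ^ 2 * ev (e2pol r) t) - fC (INR r) * k0)%fp; [|unfold fZ; ring].
    rewrite <- E. unfold Gh. rewrite dil_add, dil_C by auto. simpl (2 * 1)%nat. rewrite bev_2 by auto.
    unfold Sh. rewrite (Sg_ext (fun d => fexp (INR d) (2 * 1 - 1)) INR) by (intros; unfold fexp; simpl; field).
    unfold k0. set (S := dil r (Sg INR)).
    transitivity (fC (1/24) * fC (INR r * -24) * S + (fC (1/24) * fC (INR r * -24) * fC (- (1/12) / 2) - fC (INR r) * fC (1/24)))%fp; [|ring].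
    rewrite <- !fC_mul, <- fC_sub.
    replace (1 / 24 * (INR r * -24)) with (- INR r) by field.
    replace (- INR r * (- (1/12) / 2) - INR r * (1/24)) with 0 by field. ring. }
  (* Since D t = t pre(t) A^2, the derivative c t pre(t) A^2 of 1 + c t is divisible by 1 + c t as
     soon as that is a factor of pre(t). *)
  assert (Lc : forall c p, (lin c t * p)%fp = pre t ->
    LD (lin c t) (fZ c * t * p * (fC 24 * a0))%fp).
  { intros c p Hp. split.
    - unfold lin, fadd. rewrite fmul_0, t0. simpl. ring.
    - rewrite Ka. unfold lin at 1. rewrite fD_add, fD_mul. unfold fZ at 1 2. rewrite !fD_C, Ht, <- Hp. ring. }
  assert (L2 := Lc 2%Z (lin 3 t * lin 4 t * lin 6 t)%fp ltac:(unfold lin, pre; ring)).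
  assert (L3 := Lc 3%Z (lin 2 t * lin 4 t * lin 6 t)%fp ltac:(unfold lin, pre; ring)).
  assert (L4 := Lc 4%Z (lin 2 t * lin 3 t * lin 6 t)%fp ltac:(unfold lin, pre; ring)).
  assert (L6 := Lc 6%Z (lin 2 t * lin 3 t * lin 4 t)%fp ltac:(unfold lin, pre; ring)).
  assert (E1 := Le 1%nat ltac:(simpl; tauto)). assert (E2 := Le 2%nat ltac:(simpl; tauto)).
  assert (E3 := Le 3%nat ltac:(simpl; tauto)). assert (E4 := Le 4%nat ltac:(simpl; tauto)).
  assert (E6 := Le 6%nat ltac:(simpl; tauto)). assert (E12 := Le 12%nat ltac:(simpl; tauto)).
  (* The product for theta(q^3) is Gauss's product under q -> q^3. *)
  assert (P3 := f_equal (dil 3) theta_product). simpl fpow in P3.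
  rewrite !dil_mul, !dil_C, !dil_euler, dil_theta in P3 by lia. simpl Nat.mul in P3.
  assert (G : forall r s, (euler r ^ 2 * euler s ^ 2)%fp O = 1).
  { intros r s. rewrite fmul_0, !fpow_0. change (euler r O) with 1. change (euler s O) with 1. ring. }
  assert (T1 := LD_div _ _ _ _ _ (G 1%nat 4%nat) theta_product
    (LD_mul _ _ _ _ (LD_pow _ _ 2 E1) (LD_pow _ _ 2 E4)) (LD_pow _ _ 5 E2)).
  assert (P3' : (theta 3 * (euler 3 ^ 2 * euler 12 ^ 2) = euler 6 ^ 5)%fp).
  { transitivity (theta 3 * (euler 3 * (euler 3 * fC 1) * (euler 12 * (euler 12 * fC 1))))%fp; [ring|].
    rewrite P3. ring. }
  assert (T3 := LD_div _ _ _ _ _ (G 3%nat 12%nat) P3'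
    (LD_mul _ _ _ _ (LD_pow _ _ 2 E3) (LD_pow _ _ 2 E12)) (LD_pow _ _ 5 E6)).
  assert (Lp : LD (pre t) (fZ 2 * t * (lin 3 t * lin 4 t * lin 6 t) * (fC 24 * a0)
     + fZ 3 * t * (lin 2 t * lin 4 t * lin 6 t) * (fC 24 * a0)
     + fZ 4 * t * (lin 2 t * lin 3 t * lin 6 t) * (fC 24 * a0)
     + fZ 6 * t * (lin 2 t * lin 3 t * lin 4 t) * (fC 24 * a0))%fp).
  { replace (pre t) with (lin 2 t * lin 3 t * lin 4 t * lin 6 t)%fp by (unfold lin, pre; ring).
    repeat apply LD_mul; assumption. }
  assert (Fin : forall f g L M, LD f L -> LD g M -> L = M -> f = g)
    by (intros f g L M H1 H2 <-; eapply LD_unique; eauto).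
  clear Hq Le Lc.
  constructor; auto; try (intros beta Hb r Hr; apply (EU beta Hb r Hr)); clear EU.
  - eapply Fin; [ld_tac | ld_tac | ]. ld_ring.
  - eapply Fin; [ld_tac | ld_tac | ]. ld_ring.
  - eapply Fin; [ld_tac | ld_tac | ]. ld_ring.
  - eapply Fin; [ld_tac | ld_tac | ]. ld_ring.
  - eapply Fin; [ld_tac | ld_tac | ]. ld_ring.
Qed.

(** * Polynomials in the uniformizer and their values at the cusps *)

Definition evR (l : list R) (x : R) : R := fold_right (fun c acc => c + x * acc) 0 l.

Fixpoint padd (l m : list R) : list R :=
  match l, m with
  | [], _ => m
  | _, [] => l
  | a :: l', b :: m' => (a + b) :: padd l' m'
  end.
Definition pscal (c : R) (l : list R) : list R := map (Rmult c) l.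
Fixpoint pmul (l m : list R) : list R :=
  match l with [] => [] | a :: l' => padd (pscal a m) (0 :: pmul l' m) end.

Lemma ev_cons a l t : ev (a :: l) t = (fC a + t * ev l t)%fp.
Proof. reflexivity. Qed.
Lemma evR_cons a l x : evR (a :: l) x = a + x * evR l x.
Proof. reflexivity. Qed.

Lemma ev_padd l m t : ev (padd l m) t = (ev l t + ev m t)%fp.
Proof.
  revert m; induction l as [|a l IH]; intros [|b m]; cbn [padd]; rewrite ?ev_cons;
    try (change (ev [] t) with (fC 0); ring).
  rewrite IH, fC_add. ring.
Qed.
Lemma ev_pscal c l t : ev (pscal c l) t = (fC c * ev l t)%fp.
Proof.
  induction l as [|a l IH]; [change (fC 0 = fC c * fC 0)%fp; ring|].
  cbn [pscal map]. rewrite !ev_cons, fC_mul. unfold pscal in IH. rewrite IH. ring.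
Qed.
Lemma ev_pmul l m t : ev (pmul l m) t = (ev l t * ev m t)%fp.
Proof.
  induction l as [|a l IH]; [change (fC 0 = fC 0 * ev m t)%fp; ring|].
  cbn [pmul]. rewrite ev_padd, ev_pscal, !ev_cons, IH. ring.
Qed.
Lemma evR_padd l m x : evR (padd l m) x = evR l x + evR m x.
Proof.
  revert m; induction l as [|a l IH]; intros [|b m]; cbn [padd]; rewrite ?evR_cons;
    try (change (evR [] x) with 0; ring).
  rewrite IH. ring.
Qed.
Lemma evR_pscal c l x : evR (pscal c l) x = c * evR l x.
Proof.
  induction l as [|a l IH]; [change (0 = c * 0); ring|].
  cbn [pscal map]. rewrite !evR_cons. unfold pscal in IH. rewrite IH. ring.
Qed.
Lemma evR_pmul l m x : evR (pmul l m) x = evR l x * evR m x.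
Proof.
  induction l as [|a l IH]; [change (0 = 0 * evR m x); ring|].
  cbn [pmul]. rewrite evR_padd, evR_pscal, !evR_cons, IH. ring.
Qed.
Lemma length_padd l m : length (padd l m) = Nat.max (length l) (length m).
Proof.
  revert m; induction l as [|a l IH]; intros [|b m]; simpl; auto.
Qed.
Lemma length_pscal c l : length (pscal c l) = length l.
Proof. apply length_map. Qed.
Lemma length_pmul l m : (length (pmul l m) <= length l + length m)%nat /\
  (l <> [] -> m <> [] -> length (pmul l m) <= length l + length m - 1)%nat.
Proof.
  induction l as [|a l [IH1 IH2]]; [simpl; split; [lia | congruence]|].
  cbn [pmul]. rewrite length_padd, length_pscal. cbn [length].
  split; [lia|]. intros _ Hm. destruct l as [|b l].
  - simpl. destruct m; [congruence | simpl; lia].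
  - specialize (IH2 ltac:(congruence) Hm). cbn [length] in *. lia.
Qed.
Lemma nth_padd l m n : nth n (padd l m) 0 = nth n l 0 + nth n m 0.
Proof.
  revert m n; induction l as [|a l IH]; intros [|b m] [|n]; simpl; try ring. apply IH.
Qed.
Lemma nth_pscal c l n : nth n (pscal c l) 0 = c * nth n l 0.
Proof.
  revert n; induction l as [|a l IH]; intros [|n]; simpl; try ring. apply IH.
Qed.
(** Multiplicativity of evaluation at the pole of t; with formal degrees it holds even when a top
    coefficient is 0. *)
Lemma nth_pmul_top d1 d2 l m : (length l <= S d1)%nat -> (length m <= S d2)%nat ->
  nth (d1 + d2) (pmul l m) 0 = nth d1 l 0 * nth d2 m 0.
Proof.
  revert d1; induction l as [|a l IH]; intros d1 Hl Hm; cbn [length] in Hl.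
  - destruct d1, (0 + d2)%nat; simpl; destruct d2; simpl; ring.
  - cbn [pmul]. rewrite nth_padd, nth_pscal. destruct d1 as [|d1].
    + destruct l; [|simpl in Hl; lia]. simpl. destruct d2 as [|[|d2]]; simpl; ring.
    + change (S d1 + d2)%nat with (S (d1 + d2)). cbn [nth]. rewrite IH by lia.
      rewrite (nth_overflow m) by lia. ring.
Qed.

(** A cusp is [Some x] for the value x of the uniformizer, or [None] for its pole, where the
    value of a polynomial of formal degree d is its coefficient of degree d. *)
Definition val (d : nat) (c : option R) (l : list R) : R :=
  match c with Some x => evR l x | None => nth d l 0 end.
Definition cusps : list (option R) :=
  [Some 0; Some (- (1/2)); Some (- (1/3)); Some (- (1/4)); Some (- (1/6)); None].

Lemma val_padd d c l m : val d c (padd l m) = val d c l + val d c m.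
Proof. destruct c; [apply evR_padd | apply nth_padd]. Qed.
Lemma val_pscal d c a l : val d c (pscal a l) = a * val d c l.
Proof. destruct c; [apply evR_pscal | apply nth_pscal]. Qed.
Lemma val_pmul d1 d2 c l m : (length l <= S d1)%nat -> (length m <= S d2)%nat ->
  val (d1 + d2) c (pmul l m) = val d1 c l * val d2 c m.
Proof. intros; destruct c; [apply evR_pmul | apply nth_pmul_top; auto]. Qed.

(** The values at the cusps are carried along as a function v, so sums and products of forms become
    pointwise operations on v and the polynomials are never expanded. *)
Definition repr (A t : fps) (w d : nat) (f : fps) (v : option R -> R) : Prop :=
  exists l, (length l <= S d)%nat /\ f = (A ^ w * ev l t)%fp /\
    forall c, List.In c cusps -> val d c l = v c.

Lemma repr_add A t w d f g v v' : repr A t w d f v -> repr A t w d g v' ->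
  repr A t w d (f + g)%fp (fun c => v c + v' c).
Proof.
  intros [l [L1 [-> L2]]] [m [M1 [-> M2]]]. exists (padd l m). split; [|split].
  - rewrite length_padd. lia.
  - rewrite ev_padd. ring.
  - intros c Hc. rewrite val_padd, L2, M2; auto.
Qed.
Lemma repr_scal A t w d f v a : repr A t w d f v -> repr A t w d (fC a * f)%fp (fun c => a * v c).
Proof.
  intros [l [L1 [-> L2]]]. exists (pscal a l). split; [|split].
  - rewrite length_pscal. lia.
  - rewrite ev_pscal. ring.
  - intros c Hc. rewrite val_pscal, L2; auto.
Qed.
Lemma repr_mul A t w d f v w' d' g v' : repr A t w d f v -> repr A t w' d' g v' ->
  repr A t (w + w') (d + d') (f * g)%fp (fun c => v c * v' c).
Proof.
  intros [l [L1 [-> L2]]] [m [M1 [-> M2]]]. exists (pmul l m). split; [|split].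
  - destruct (length_pmul l m) as [H1 H2]. destruct l as [|a l]; [simpl; lia|].
    destruct m as [|b m]; [simpl in *; lia|]. specialize (H2 ltac:(congruence) ltac:(congruence)).
    cbn [length] in *. lia.
  - rewrite ev_pmul, fpow_add. ring.
  - intros c Hc. rewrite val_pmul, L2, M2; auto.
Qed.
Lemma repr_1 A t : repr A t 0 0 (fC 1) (fun _ => 1).
Proof.
  exists [1]. split; [simpl; lia | split; [simpl; ring|]].
  intros [x|] _; simpl; ring.
Qed.
Lemma repr_pow A t w d f v n : repr A t w d f v -> repr A t (n * w) (n * d) (f ^ n)%fp (fun c => v c ^ n).
Proof.
  intros H. induction n as [|n IH]; [apply repr_1|]. exact (repr_mul _ _ _ _ _ _ _ _ _ _ H IH).
Qed.
Lemma repr_ext A t w d f v g v' : repr A t w d f v -> f = g ->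
  (forall c, List.In c cusps -> v c = v' c) -> repr A t w d g v'.
Proof. intros [l [L1 [L2 L3]]] <- E. exists l. split; [|split]; auto. intros c Hc. rewrite L3; auto. Qed.
Lemma repr_fsumL A t w d (l : list nat) F V : (forall i, List.In i l -> repr A t w d (F i) (V i)) ->
  repr A t w d (fsumL l F) (fun c => sumL l (fun i => V i c)).
Proof.
  induction l as [|i l IH]; intros H.
  - exists []. split; [simpl; lia | split].
    + rewrite fsumL_nil. simpl. ring.
    + intros [x|] _; simpl; [reflexivity | destruct d; reflexivity].
  - rewrite fsumL_cons. apply (repr_add A t w d (F i) _ (V i)); [apply H; left; auto|].
    apply IH. intros j Hj; apply H; right; auto.
Qed.

Lemma nth_dl_from n l d : nth d (dl_from n l) 0 = (INR n + INR d) * nth d l 0.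
Proof.
  revert n d; induction l as [|c l IH]; intros n [|d]; cbn [dl_from nth]; try (change (INR 0) with 0; ring).
  rewrite IH, !S_INR. ring.
Qed.
Lemma length_dl l : length (dl l) = length l.
Proof. unfold dl. generalize 0%nat. induction l as [|c l IH]; intros n; simpl; auto. Qed.

Definition prel : list R := [1; 15; 80; 180; 144].
Lemma ev_prel t : ev prel t = pre t.
Proof. cbn [ev prel fold_right]. unfold pre, fZ. ring. Qed.

(** At the cusps the Serre derivative acts through the values of weight 2 alone. *)
Definition rho (r : nat) (c : option R) : R :=
  match c with Some x => evR (e2pol r) x | None => nth 4 (e2pol r) 0 - 24 * 144 end / INR r.

(** D(A^(2m)) = 2m A^(2m) B is cancelled by the part (m/6) 12 B of the subtracted term, so the Serre
    derivative is again A^(2m+2) times a polynomial in t. *)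
Lemma repr_serre A u t B m g v r : uniformization A u t B -> List.In r [1; 2; 3; 4; 6; 12]%nat ->
  repr A t (2 * m) (4 * m) g v ->
  repr A t (2 * (m + 1)) (4 * (m + 1))
    (fD g - fC (INR m / 6) * (fZ 12 * B + A ^ 2 * ev (e2pol r) t) * g)%fp
    (fun c => - (INR m / 6) * INR r * rho r c * v c).
Proof.
  intros U Hr [l [L1 [-> L2]]].
  assert (r0 : INR r <> 0) by (apply not_0_INR; each_divisor Hr; lia).
  exists (padd (pmul (dl l) prel) (pscal (- (INR m / 6)) (pmul l (e2pol r)))).
  assert (len2 : length (e2pol r) = 5%nat) by (each_divisor Hr; reflexivity).
  split; [|split].
  - rewrite length_padd, length_pscal. destruct (length_pmul (dl l) prel) as [H1 H2].
    destruct (length_pmul l (e2pol r)) as [H3 H4]. rewrite length_dl in *. rewrite len2 in *.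
    destruct l as [|a l]; [simpl in *; lia|].
    specialize (H2 ltac:(discriminate) ltac:(discriminate)).
    specialize (H4 ltac:(discriminate) ltac:(intros E; rewrite E in len2; discriminate)).
    simpl (length prel) in *. lia.
  - rewrite ev_padd, ev_pscal, !ev_pmul, ev_prel.
    assert (Ht : fD t = (t * (pre t * A ^ 2))%fp) by (rewrite (un_Dt _ _ _ _ U); ring).
    assert (DA : fD (A ^ (2 * m))%fp = (fC (INR (2 * m)) * A ^ (2 * m) * B)%fp).
    { rewrite fD_pow, (un_DA _ _ _ _ U). destruct (2 * m)%nat as [|n]; [change (INR 0) with 0; ring|].
      replace (S n - 1)%nat with n by lia. simpl fpow. ring. }
    rewrite fD_mul, DA, (fD_ev l t _ Ht).
    replace (2 * (m + 1))%nat with (2 * m + 2)%nat by lia. rewrite fpow_add.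
    replace (INR (2 * m)) with (INR m / 6 * 12) by (rewrite mult_INR; simpl; field).
    rewrite fC_mul, fC_opp. unfold fZ. ring.
  - intros c Hc. replace (4 * (m + 1))%nat with (4 * m + 4)%nat by lia.
    rewrite val_padd, val_pscal, !val_pmul by (rewrite ?length_dl, ?len2; auto).
    rewrite (L2 c Hc).
    destruct c as [x|].
    (* The derivative contributes t l'(t) pre(t), which vanishes at 0 and at the four roots of
       pre. *)
    + assert (P0 : evR (dl l) x * evR prel x = 0).
      { simpl in Hc. repeat destruct Hc as [Hc|Hc]; try contradiction; try discriminate; injection Hc as <-;
        try (replace (evR prel _) with 0 by (unfold prel, evR; simpl; field); ring).
        destruct l as [|a l]; simpl; ring. }
      cbn [val]. rewrite P0. unfold rho. field. auto.
    (* At the pole, t d/dt multiplies the top coefficient by 4m and pre contributes 144; 4m 144 =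
       (m/6) 24 144 is the correction built into [rho]. *)
    + cbn [val]. unfold dl. rewrite nth_dl_from. specialize (L2 None Hc). cbn [val] in L2. rewrite L2.
      rewrite mult_INR. unfold rho. simpl. field. auto.
Qed.

(** The base case for cusp values: E_4(q^r) takes the value rho^2, checked for the 36 pairs of r and
    cusp. *)
Lemma rho_sq r c : List.In r [1; 2; 3; 4; 6; 12]%nat -> List.In c cusps ->
  val 8 c (e4pol r) = (INR r * rho r c) ^ 2.
Proof.
  intros Hr Hc. unfold rho. simpl in Hc. each_divisor Hr;
  repeat destruct Hc as [<-|Hc]; try contradiction;
  unfold val; cbn [e4pol e2pol evR fold_right nth]; simpl; field.
Qed.

(** In [Gh_rec] after q -> q^r, the summands i = 1 and i = m contain E_2(q^r) and merge with the
    derivative into a Serre derivative; the remaining ones are products of lower weight. At a cusp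
    everything scales by rho^(m+1), so the values follow the recursion of the constant terms. *)
Lemma Gh_repr A u t B beta r k : uniformization A u t B -> is_beta beta ->
  List.In r [1; 2; 3; 4; 6; 12]%nat -> (2 <= k)%nat ->
  repr A t (2 * k) (4 * k) (dil r (Gh beta k)) (fun c => rho r c ^ k * Gh beta k O).
Proof.
  intros U H Hr. assert (r0 : INR r <> 0) by (apply not_0_INR; each_divisor Hr; lia).
  assert (rpos : (0 < r)%nat) by (each_divisor Hr; lia).
  induction k as [k IH] using (well_founded_induction lt_wf). intros Hk.
  destruct (Nat.eq_dec k 2) as [->|Hk2].
  { assert (E := un_E4 _ _ _ _ U beta H r Hr).
    exists (pscal (/ (INR r ^ 2 * 1440)) (e4pol r)). split; [|split].
    - rewrite length_pscal. each_divisor Hr; simpl; lia.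
    - rewrite ev_pscal. simpl (2 * 2)%nat.
      replace (A ^ 4 * (fC (/ (INR r ^ 2 * 1440)) * ev (e4pol r) t))%fp
        with (fC (/ (INR r ^ 2 * 1440)) * (A ^ 4 * ev (e4pol r) t))%fp by ring.
      rewrite <- E.
      replace (fC (/ (INR r ^ 2 * 1440)) * (fC (INR r ^ 2 * 1440) * dil r (Gh beta 2)))%fp
        with (fC (/ (INR r ^ 2 * 1440)) * fC (INR r ^ 2 * 1440) * dil r (Gh beta 2))%fp by ring.
      rewrite <- fC_mul. replace (/ (INR r ^ 2 * 1440) * (INR r ^ 2 * 1440)) with 1 by (field; auto). ring.
    - intros c Hc. change (4 * 2)%nat with 8%nat. rewrite val_pscal, rho_sq by auto.
      rewrite Gh_0. change (2 * 2)%nat with 4%nat. rewrite bev_4 by auto. field. auto. }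
  destruct k as [|m]; [lia|]. assert (Hm : (2 <= m)%nat) by lia.
  assert (m0 : INR m <> 0) by (apply not_0_INR; lia).
  assert (mpos : 0 <= INR m) by apply pos_INR.
  assert (R := Gh_rec beta m H ltac:(lia)).
  (* The summands 2 <= i <= m - 1, none of which involves weight 2; the range is empty for m = 2. *)
  set (S := fsumL (seq 2 (m - 2)) (fun i => Gh beta i * Gh beta (m + 1 - i))%fp).
  assert (Sp : fsumL (seq 1 m) (fun i => Gh beta i * Gh beta (m + 1 - i))%fp
    = (fC 2 * (Gh beta 1 * Gh beta m) + S)%fp).
  { replace m with (Datatypes.S (Datatypes.S (m - 2))) at 1 by lia.
    rewrite fsumL_seq_S. change (seq 1 (Datatypes.S (m - 2))) with (1%nat :: seq 2 (m - 2)).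
    rewrite fsumL_cons. replace (1 + Datatypes.S (m - 2))%nat with m by lia.
    replace (m + 1 - 1)%nat with m by lia. replace (m + 1 - m)%nat with 1%nat by lia. fold S. ring. }
  rewrite Sp in R.
  assert (E2 := un_E2 _ _ _ _ U beta H r Hr).
  assert (Rm := IH m ltac:(lia) Hm).
  assert (RS : repr A t (2 * (m + 1)) (4 * (m + 1)) (dil r S)
    (fun c => sumL (seq 2 (m - 2)) (fun i => rho r c ^ i * Gh beta i O * (rho r c ^ (m + 1 - i) * Gh beta (m + 1 - i) O)))).
  { unfold S. rewrite dil_fsumL. apply repr_fsumL. intros i Hi. apply in_seq in Hi.
    rewrite dil_mul by auto.
    replace (2 * (m + 1))%nat with (2 * i + 2 * (m + 1 - i))%nat by lia.
    replace (4 * (m + 1))%nat with (4 * i + 4 * (m + 1 - i))%nat by lia.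
    apply (repr_mul A t _ _ _ (fun c => rho r c ^ i * Gh beta i O) _ _ _ (fun c => rho r c ^ (m + 1 - i) * Gh beta (m + 1 - i) O));
      apply IH; lia. }
  assert (RD := repr_serre A u t B m _ _ r U Hr Rm).
  assert (Sum := repr_scal A t _ _ _ _ (/ (INR r * (INR m * (2 * INR m + 3))))
     (repr_add A t _ _ _ _ _ _ RD (repr_scal A t _ _ _ _ (INR r * (2 * INR m)) RS))).
  replace (Datatypes.S m) with (m + 1)%nat by lia.
  eapply repr_ext; [exact Sum | |].
  - rewrite fD_dil.
    assert (R' := f_equal (dil r) R).
    rewrite dil_sub, !dil_mul, !dil_add, !dil_mul, !dil_C in R' by auto.
    rewrite <- E2.
    set (D := dil r (fD (Gh beta m))) in *. set (g1 := dil r (Gh beta 1)) in *.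
    set (gm := dil r (Gh beta m)) in *. set (g' := dil r (Gh beta (m + 1))) in *.
    assert (ED : D = (fC (INR m * (2 * INR m + 3)) * g' - fC (2 * INR m) * (fC 2 * (g1 * gm) + dil r S))%fp).
    { rewrite R'. ring. }
    rewrite ED.
    transitivity (fC (/ (INR r * (INR m * (2 * INR m + 3)))) * (fC (INR r) * fC (INR m * (2 * INR m + 3))) * g'
      + fC (/ (INR r * (INR m * (2 * INR m + 3)))) *
        ((- (fC (INR r) * fC (2 * INR m) * fC 2) - fC (INR m / 6) * fC (INR r * -24)) * (g1 * gm)
         + (fC (INR r * (2 * INR m)) - fC (INR r) * fC (2 * INR m)) * dil r S))%fp; [ring|].
    rewrite <- !fC_mul, <- !fC_opp, <- !fC_sub.
    replace (- (INR r * (2 * INR m) * 2) - INR m / 6 * (INR r * -24)) with 0 by field.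
    replace (INR r * (2 * INR m) - INR r * (2 * INR m)) with 0 by ring.
    replace (/ (INR r * (INR m * (2 * INR m + 3))) * (INR r * (INR m * (2 * INR m + 3)))) with 1
      by (field; repeat split; auto; lra).
    ring.
  - intros c Hc. cbv beta.
    (* The constant coefficient of the recursion, where the derivative disappears, is the relation
       that the values must satisfy. *)
    assert (R0 := f_equal (fun f : fps => f O) R). cbv beta in R0.
    unfold fsub, fadd in R0. rewrite !fmul_0 in R0. unfold S, fsumL, fD in R0. simpl (INR 0) in R0.
    simpl (fC _ O) in R0. rewrite Gh_0 in R0 at 1. simpl (2 * 1)%nat in R0. rewrite bev_2 in R0 by auto.
    rewrite (sumL_ext _ _ (fun i => rho r c ^ (m + 1) * fmul (Gh beta i) (Gh beta (m + 1 - i)) O)).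
    2:{ intros i Hi. apply in_seq in Hi. replace (m + 1)%nat with (i + (m + 1 - i))%nat at 3 by lia.
        rewrite pow_add, fmul_0. ring. }
    rewrite sumL_scal. set (T := sumL _ _) in *. rewrite pow_add, pow_1.
    set (p := rho r c ^ m). set (q := rho r c).
    assert (G1 : Gh beta (m + 1) O = / (INR m * (2 * INR m + 3)) *
       (2 * INR m * (2 * (- (1 / 12) / 2 * Gh beta m O) + T))).
    { apply (Rmult_eq_reg_l (INR m * (2 * INR m + 3))); [|nra].
      rewrite <- Rmult_assoc, Rinv_r, Rmult_1_l by nra. lra. }
    rewrite G1. field. repeat split; auto; lra.
Qed.

(** The two theta relations give theta(q^3)^4 = A^2 (1+2t)^3 (1+6t), and theta(q)^2/theta(q^3)^2 =
    (1+6t)/(1+2t); even exponents are all that is needed. *)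
Lemma theta_repr A u t B k i : uniformization A u t B -> (i <= 2 * k)%nat ->
  repr A t (2 * k) (4 * k) (theta 1 ^ (4 * k - 2 * i) * theta 3 ^ (2 * i))%fp
    (fun c => val 1 c [1; 2] ^ (k + i) * val 1 c [1; 6] ^ (3 * k - i)).
Proof.
  intros U Hi.
  assert (t0 : t O = 0) by (rewrite (un_t _ _ _ _ U), fX_mul; reflexivity).
  assert (l0 : forall c, lin c t O = 1).
  { intros c. unfold lin, fadd. rewrite fmul_0, t0. simpl. ring. }
  assert (M := un_theta_mul _ _ _ _ U). assert (D := un_theta_div _ _ _ _ U).
  set (X := theta 1) in *. set (Y := theta 3) in *. set (a := lin 2 t) in *. set (b := lin 6 t) in *.
  assert (Y4 : (Y ^ 4 = A ^ 2 * (a ^ 3 * b))%fp).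
  { apply (fps_cancel b); [unfold b; rewrite l0; lra|].
    transitivity (Y ^ 2 * (Y ^ 2 * b))%fp; [ring|]. rewrite <- D.
    transitivity ((X * Y) * (X * Y) * a)%fp; [ring|]. rewrite M. ring. }
  assert (E : (X ^ (4 * k - 2 * i) * Y ^ (2 * i) = A ^ (2 * k) * (a ^ (k + i) * b ^ (3 * k - i)))%fp).
  { apply (fps_cancel (a ^ (2 * k - i))%fp); [rewrite fpow_0; unfold a; rewrite l0, pow1; lra|].
    replace (4 * k - 2 * i)%nat with (2 * (2 * k - i))%nat by lia. rewrite (fpow_mul X).
    transitivity ((X ^ 2 * a) ^ (2 * k - i) * Y ^ (2 * i))%fp; [rewrite fpow_mull; ring|].
    rewrite D, fpow_mull, <- fpow_mul.
    transitivity (Y ^ (4 * k) * b ^ (2 * k - i))%fp.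
    { replace (4 * k)%nat with (2 * (2 * k - i) + 2 * i)%nat by lia. rewrite fpow_add. ring. }
    rewrite (fpow_mul Y 4 k), Y4, !fpow_mull, <- !fpow_mul.
    replace (3 * k - i)%nat with (k + (2 * k - i))%nat by lia. rewrite (fpow_add b).
    transitivity (A ^ (2 * k) * ((a ^ (2 * k - i) * a ^ (k + i)) * (b ^ k * b ^ (2 * k - i))))%fp; [|ring].
    rewrite <- fpow_add. replace (2 * k - i + (k + i))%nat with (3 * k)%nat by lia. ring. }
  rewrite E.
  assert (RA : repr A t 1 0 A (fun _ => 1)).
  { exists [1]. split; [simpl; lia | split; [simpl; ring|]]. intros [x|] _; simpl; ring. }
  assert (Ra : repr A t 0 1 a (fun c => val 1 c [1; 2])).
  { exists [1; 2]. split; [simpl; lia | split; [unfold a, lin, fZ; simpl; ring | reflexivity]]. }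
  assert (Rb : repr A t 0 1 b (fun c => val 1 c [1; 6])).
  { exists [1; 6]. split; [simpl; lia | split; [unfold b, lin, fZ; simpl; ring | reflexivity]]. }
  assert (R := repr_mul _ _ _ _ _ _ _ _ _ _ (repr_pow _ _ _ _ _ _ (2 * k) RA)
    (repr_mul _ _ _ _ _ _ _ _ _ _ (repr_pow _ _ _ _ _ _ (k + i) Ra) (repr_pow _ _ _ _ _ _ (3 * k - i) Rb))).
  replace (2 * k * 1 + ((k + i) * 0 + (3 * k - i) * 0))%nat with (2 * k)%nat in R by lia.
  replace (2 * k * 0 + ((k + i) * 1 + (3 * k - i) * 1))%nat with (4 * k)%nat in R by lia.
  eapply repr_ext; [exact R | reflexivity|]. intros c _. cbv beta. rewrite pow1. ring.
Qed.

(** Horner division, carried out on lists so that one quotient serves both the real argument and the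
    series t. *)
Lemma root_factor l x : evR l x = 0 -> exists m, length m = pred (length l) /\
  (forall t, ev l t = ((t - fC x) * ev m t)%fp) /\ forall y, evR l y = (y - x) * evR m y.
Proof.
  intros H0.
  assert (K : forall l, exists m, length m = pred (length l) /\
    (forall t, ev l t = (fC (evR l x) + (t - fC x) * ev m t)%fp) /\
    forall y, evR l y = evR l x + (y - x) * evR m y).
  { clear. induction l as [|a [|b l] IH].
    - exists []. split; [reflexivity | split; intros; simpl; ring].
    - exists []. split; [reflexivity | split; intros; simpl].
      + rewrite fC_add, fC_mul. ring.
      + ring.
    - destruct IH as [m [M1 [M2 M3]]]. exists (evR (b :: l) x :: m). split; [simpl in *; lia | split].
      + intros t. rewrite ev_cons, (ev_cons (evR (b :: l) x)), M2, (evR_cons a), fC_add, fC_mul. ring.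
      + intros y. rewrite evR_cons, M3, (evR_cons a), (evR_cons (evR (b :: l) x)). ring. }
  destruct (K l) as [m [M1 [M2 M3]]]. exists m. split; [auto | split].
  - intros t. rewrite M2, H0. ring.
  - intros y. rewrite M3, H0. ring.
Qed.

Lemma ev_firstn l n : (length l <= S n)%nat -> nth n l 0 = 0 -> exists m, (length m <= n)%nat /\
  (forall t, ev m t = ev l t) /\ forall x, evR m x = evR l x.
Proof.
  revert l; induction n as [|n IH]; intros l Hl Hn.
  - exists []. destruct l as [|a [|b l]]; [split; auto | | simpl in Hl; lia].
    simpl in Hn. subst a. split; [simpl; lia|]. split; intros; simpl; ring.
  - destruct l as [|a l]; [exists []; split; [simpl; lia | split; auto]|].
    destruct (IH l) as [m [M1 [M2 M3]]]; [simpl in Hl; lia | exact Hn|].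
    exists (a :: m). split; [simpl; lia | split; intros].
    + rewrite !ev_cons, M2. reflexivity.
    + rewrite !evR_cons, M3. reflexivity.
Qed.

Lemma ev_fsumL l t : ev l t = fsumL (seq 0 (length l)) (fun j => fC (nth j l 0) * t ^ j)%fp.
Proof.
  induction l as [|a l IH]; [rewrite fsumL_nil; reflexivity|].
  cbn [length]. rewrite fsumL_shift, ev_cons, IH, <- fsumL_mull. cbn [nth fpow].
  replace (fC a * fC 1)%fp with (fC a) by ring. f_equal.
  apply fsumL_ext. intros j _. ring.
Qed.

(** Vanishing at the pole lowers the degree to 4k - 1; the five other cusps split off t pre(t) up to
    a constant. The quotient has 4k - 5 coefficients, which multiply t^j for j = 1, ..., 4k - 5. *)
Lemma repr_cuspidal A t k f : (2 <= k)%nat -> repr A t (2 * k) (4 * k) f (fun _ => 0) ->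
  exists a : nat -> R,
    f = fsumL (seq 1 (4 * k - 5)) (fun j => fC (a j) * (pre t * t ^ j * A ^ (2 * k)))%fp.
Proof.
  intros Hk [l [L1 [-> L2]]].
  assert (V := fun c => L2 c). unfold cusps in V.
  assert (V0 := V (Some 0) ltac:(simpl; tauto)). assert (V1 := V (Some (- (1/2))) ltac:(simpl; tauto)).
  assert (V2 := V (Some (- (1/3))) ltac:(simpl; tauto)). assert (V3 := V (Some (- (1/4))) ltac:(simpl; tauto)).
  assert (V4 := V (Some (- (1/6))) ltac:(simpl; tauto)). assert (V5 := V None ltac:(simpl; tauto)).
  cbn [val] in *. clear V L2.
  destruct (ev_firstn l (4 * k) L1 V5) as [l0 [N0 [T0 X0]]]. rewrite <- X0 in *.
  destruct (root_factor l0 0 V0) as [l1 [N1 [T1 X1]]]. rewrite X1 in V1, V2, V3, V4.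
  assert (W1 : evR l1 (- (1/2)) = 0) by lra. assert (W2 : evR l1 (- (1/3)) = 0) by lra.
  assert (W3 : evR l1 (- (1/4)) = 0) by lra. assert (W4 : evR l1 (- (1/6)) = 0) by lra.
  destruct (root_factor l1 _ W1) as [l2 [N2 [T2 X2]]]. rewrite X2 in W2, W3, W4.
  assert (Y2 : evR l2 (- (1/3)) = 0) by lra. assert (Y3 : evR l2 (- (1/4)) = 0) by lra.
  assert (Y4 : evR l2 (- (1/6)) = 0) by lra.
  destruct (root_factor l2 _ Y2) as [l3 [N3 [T3 X3]]]. rewrite X3 in Y3, Y4.
  assert (Z3 : evR l3 (- (1/4)) = 0) by lra. assert (Z4 : evR l3 (- (1/6)) = 0) by lra.
  destruct (root_factor l3 _ Z3) as [l4 [N4 [T4 X4]]]. rewrite X4 in Z4.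
  assert (U4 : evR l4 (- (1/6)) = 0) by lra.
  destruct (root_factor l4 _ U4) as [l5 [N5 [T5 X5]]].
  (* 144 = 2 3 4 6 is the leading coefficient of pre, whereas the factors split off are monic. *)
  exists (fun j => nth (j - 1) l5 0 / 144).
  assert (Len : (length l5 <= 4 * k - 5)%nat) by lia.
  assert (E5 : ev l5 t = fsumL (seq 0 (4 * k - 5)) (fun j => fC (nth j l5 0) * t ^ j)%fp).
  { rewrite ev_fsumL. replace (4 * k - 5)%nat with (length l5 + (4 * k - 5 - length l5))%nat by lia.
    generalize (4 * k - 5 - length l5)%nat. intros e. induction e as [|e IH]; [rewrite Nat.add_0_r; reflexivity|].
    rewrite Nat.add_succ_r, fsumL_seq_S, <- IH, nth_overflow by lia. ring. }
  rewrite <- T0, T1, T2, T3, T4, T5, E5.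
  rewrite <- seq_shift.
  assert (Sh : forall n F, fsumL (map S (seq 0 n)) F = fsumL (seq 0 n) (fun j => F (S j))).
  { intros n F. apply fps_ext; intros i. apply sumL_map. }
  rewrite Sh.
  match goal with |- (?P * ((t - _) * (?a * (?b * (?c * (?d * ?S))))))%fp = _ =>
    transitivity (P * (t - fC 0) * a * b * c * d * S)%fp; [ring|] end.
  rewrite <- fsumL_mull. apply fsumL_ext. intros j _. cbn [fpow]. rewrite Nat.sub_1_r. cbn [pred].
  replace (nth j l5 0 / 144) with (nth j l5 0 * / 144) by reflexivity. rewrite fC_mul, !fC_opp.
  assert (P : (fC (/ 144) * pre t = (t + fC (1/2)) * (t + fC (1/3)) * (t + fC (1/4)) * (t + fC (1/6)))%fp).
  { assert (Q : forall c d, c * d = 1 -> (fZ 1 + fC c * t = fC c * (t + fC d))%fp).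
    { intros c d E. transitivity (fC c * t + fC c * fC d)%fp; [|ring].
      rewrite <- fC_mul, E. unfold fZ. ring. }
    unfold pre. change (fZ 2) with (fC 2). change (fZ 3) with (fC 3). change (fZ 4) with (fC 4). change (fZ 6) with (fC 6). rewrite (Q 2 (1/2)), (Q 3 (1/3)), (Q 4 (1/4)), (Q 6 (1/6)) by field.
    transitivity ((fC (/ 144) * fC 144) * ((t + fC (1/2)) * (t + fC (1/3)) * (t + fC (1/4)) * (t + fC (1/6))))%fp; [ring|].
    rewrite <- fC_mul. replace (/ 144 * 144) with 1 by field. ring. }
  transitivity (fC (nth j l5 0) * (fC (/ 144) * pre t) * (t * t ^ j) * A ^ (2 * k))%fp; [|ring].
  rewrite P. ring.
Qed.

(** * The Eisenstein part *)

Definition divisors12 : list nat := [1; 2; 3; 4; 6; 12]%nat.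

Definition bnum (r i k : nat) : R :=
  match r with
  | 1 => (-1) ^ k * (3 ^ (2 * k - i) + (-1) ^ (i + 1))
  | 2 => (-1) ^ (i + 1) * (1 + (-1) ^ (i + k)) * (3 ^ (2 * k - i) + (-1) ^ (i + 1))
  | 3 => (-1) ^ (i + k) * 3 ^ (2 * k - i) * (3 ^ i + (-1) ^ (i + 1))
  | 4 => (-1) ^ i * 2 ^ (2 * k) * (3 ^ (2 * k - i) + (-1) ^ (i + 1))
  | 6 => - (1 + (-1) ^ (i + k)) * 3 ^ (2 * k - i) * (3 ^ i + (-1) ^ (i + 1))
  | 12 => 2 ^ (2 * k) * 3 ^ (2 * k - i) * (3 ^ i + (-1) ^ (i + 1))
  | _ => 0
  end.
Definition bden (k : nat) : R := (2 ^ (2 * k) - 1) * (3 ^ (2 * k) - 1).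

Lemma bcoef_bnum r i k : List.In r divisors12 -> bcoef r i k = bnum r i k * alpha k.
Proof. intros Hr; unfold divisors12 in Hr; each_divisor Hr; unfold bcoef, bnum; ring. Qed.

Lemma pow_gt_1 x n : 1 < x -> (1 <= n)%nat -> 1 < x ^ n.
Proof. intros; apply Rlt_pow_R1; auto; lia. Qed.
Lemma bden_pos k : (1 <= k)%nat -> 0 < bden k.
Proof.
  intros Hk. unfold bden. assert (1 < 2 ^ (2 * k)) by (apply pow_gt_1; [lra | lia]).
  assert (1 < 3 ^ (2 * k)) by (apply pow_gt_1; [lra | lia]). apply Rmult_lt_0_compat; lra.
Qed.

Lemma sign_cases n : (-1) ^ n = 1 \/ (-1) ^ n = -1.
Proof. induction n as [|n [IH|IH]]; simpl; [left; lra | right; rewrite IH; lra | left; rewrite IH; lra]. Qed.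

(** These are the linear equations behind the b_r: at each cusp the Eisenstein combination must take
    the value of the theta product. *)
Lemma eisenstein_cusps k i c : (1 <= k)%nat -> (i <= 2 * k)%nat -> List.In c cusps ->
  sumL divisors12 (fun r => bnum r i k * rho r c ^ k)
  = bden k * (val 1 c [1; 2] ^ (k + i) * val 1 c [1; 6] ^ (3 * k - i)).
Proof.
  intros Hk Hi Hc.
  assert (Rw : forall r x, rho r c = x -> rho r c ^ k = x ^ k) by (intros r x ->; auto).
  unfold divisors12. cbn [sumL fold_right].
  set (X := 2 ^ k). set (Y := 3 ^ k). set (w := 3 ^ i). set (e := (-1) ^ k). set (s := (-1) ^ i).
  assert (X0 : X <> 0) by (apply pow_nonzero; lra). assert (Y0 : Y <> 0) by (apply pow_nonzero; lra).
  assert (w0 : w <> 0) by (apply pow_nonzero; lra).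
  assert (X2 : 2 ^ (2 * k) = X * X) by (replace (2 * k)%nat with (k + k)%nat by lia; apply pow_add).
  assert (Y2 : 3 ^ (2 * k) = Y * Y) by (replace (2 * k)%nat with (k + k)%nat by lia; apply pow_add).
  assert (YW : 3 ^ (2 * k - i) = Y * Y / w).
  { rewrite <- Y2. apply (Rmult_eq_reg_r w); auto. unfold w. rewrite <- pow_add.
    replace (2 * k - i + i)%nat with (2 * k)%nat by lia. field. apply pow_nonzero; lra. }
  assert (s1 : (-1) ^ (i + 1) = - s) by (rewrite pow_add; fold s; simpl; ring).
  assert (se : (-1) ^ (i + k) = s * e) by apply pow_add.
  assert (P4 : 4 ^ k = X * X) by (replace 4 with (2 * 2) by ring; apply Rpow_mult_distr).
  assert (E27 : 27 ^ k = Y * Y * Y) by (replace 27 with (3 * 3 * 3) by ring; rewrite !Rpow_mult_distr; reflexivity).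
  assert (E16 : 16 ^ k = X * X * X * X) by (replace 16 with (2 * 2 * 2 * 2) by ring; rewrite !Rpow_mult_distr; reflexivity).
  assert (Neg : forall x, (- x) ^ k = e * x ^ k).
  { intros x. replace (- x) with (-1 * x) by ring. apply Rpow_mult_distr. }
  assert (Inv : forall x, (/ x) ^ k = / x ^ k) by (intros x; apply pow_inv).
  assert (Sg3 : (-1) ^ (3 * k - i) = e * s).
  { assert (K : (-1) ^ (3 * k - i) * s = e * (e * e)).
    { unfold s, e. rewrite <- !pow_add. f_equal. lia. }
    unfold e in K at 2 3. rewrite pow_m1_sq in K.
    assert (s * s = 1) by apply pow_m1_sq. nra. }
  unfold bnum, bden. rewrite X2, Y2, YW, s1, se. fold e s w.
  (* With all powers written in X = 2^k, Y = 3^k and w = 3^i, only the two signs are beyond [field];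
     four cases settle them. *)
  assert (Hes : (e = 1 \/ e = -1) /\ (s = 1 \/ s = -1)) by (split; apply sign_cases).
  unfold cusps in Hc. simpl in Hc.
  destruct Hc as [<-|[<-|[<-|[<-|[<-|[<-|[]]]]]]].
  - rewrite (Rw 1%nat 1), (Rw 2%nat 1), (Rw 3%nat 1), (Rw 4%nat 1), (Rw 6%nat 1), (Rw 12%nat 1)
      by (unfold rho; cbn [e2pol evR fold_right]; simpl INR; field).
    simpl val. replace (1 + 0 * (2 + 0 * 0)) with 1 by ring. replace (1 + 0 * (6 + 0 * 0)) with 1 by ring.
    rewrite !pow1. destruct Hes as [[-> | ->] [-> | ->]]; field; auto.
  - rewrite (Rw 1%nat 1), (Rw 2%nat 1), (Rw 3%nat 1), (Rw 4%nat (/ 4)), (Rw 6%nat 1), (Rw 12%nat (/ 4))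
      by (unfold rho; cbn [e2pol evR fold_right]; simpl INR; field).
    (* Here 1 + 2t vanishes, and with it the theta product because k + i > 0; the same happens to 1
       + 6t at -1/6. *)
    simpl val. replace (1 + - (1 / 2) * (2 + - (1 / 2) * 0)) with 0 by field. rewrite (pow_i (k + i)) by lia.
    rewrite !Inv, P4, !pow1. destruct Hes as [[-> | ->] [-> | ->]]; field; auto.
  - rewrite (Rw 1%nat (- / 3)), (Rw 2%nat (- / 3)), (Rw 3%nat (- / 27)), (Rw 4%nat (- / 3)), (Rw 6%nat (- / 27)), (Rw 12%nat (- / 27))
      by (unfold rho; cbn [e2pol evR fold_right]; simpl INR; field).
    simpl val. replace (1 + - (1 / 3) * (2 + - (1 / 3) * 0)) with (/ 3) by field.
    replace (1 + - (1 / 3) * (6 + - (1 / 3) * 0)) with (-1) by field.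
    rewrite Sg3, !Neg, !Inv, E27, pow_inv, pow_add. fold Y w.
    destruct Hes as [[-> | ->] [-> | ->]]; field; auto.
  - rewrite (Rw 1%nat (/ 4)), (Rw 2%nat (/ 16)), (Rw 3%nat (/ 4)), (Rw 4%nat (/ 4 * / 16)), (Rw 6%nat (/ 16)), (Rw 12%nat (/ 4 * / 16))
      by (unfold rho; cbn [e2pol evR fold_right]; simpl INR; field).
    simpl val. replace (1 + - (1 / 4) * (2 + - (1 / 4) * 0)) with (/ 2) by field.
    replace (1 + - (1 / 4) * (6 + - (1 / 4) * 0)) with (-1 * / 2) by field.
    rewrite (Rpow_mult_distr (-1)), Sg3.
    replace ((/ 2) ^ (k + i) * (e * s * (/ 2) ^ (3 * k - i))) with (e * s * ((/ 2) ^ (k + i) * (/ 2) ^ (3 * k - i))) by ring.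
    rewrite <- pow_add. replace (k + i + (3 * k - i))%nat with (k + k + k + k)%nat by lia.
    rewrite !pow_add, !Rpow_mult_distr, !Inv, E16, P4. fold X.
    destruct Hes as [[-> | ->] [-> | ->]]; field; auto.
  - rewrite (Rw 1%nat (- / 3)), (Rw 2%nat (- / 3)), (Rw 3%nat (- / 27)), (Rw 4%nat (- (/ 4 * / 3))), (Rw 6%nat (- / 27)), (Rw 12%nat (- (/ 4 * / 27)))
      by (unfold rho; cbn [e2pol evR fold_right]; simpl INR; field).
    simpl val. replace (1 + - (1 / 6) * (6 + - (1 / 6) * 0)) with 0 by field. rewrite (pow_i (3 * k - i)) by lia.
    rewrite !Neg, !Rpow_mult_distr, !Inv, E27, P4. fold Y.
    destruct Hes as [[-> | ->] [-> | ->]]; field; auto.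
  - rewrite (Rw 1%nat (- (16 * 4 * 27))), (Rw 2%nat (- (16 * 27))), (Rw 3%nat (- (16 * 4 * 3))), (Rw 4%nat (- (4 * 27))), (Rw 6%nat (- (16 * 3))), (Rw 12%nat (- (4 * 3)))
      by (unfold rho; cbn [e2pol nth]; simpl INR; field).
    simpl val. replace 6 with (2 * 3) by ring. rewrite (Rpow_mult_distr 2 3 (3 * k - i)).
    replace (2 ^ (k + i) * (2 ^ (3 * k - i) * 3 ^ (3 * k - i))) with ((2 ^ (k + i) * 2 ^ (3 * k - i)) * 3 ^ (3 * k - i)) by ring.
    rewrite <- pow_add. replace (k + i + (3 * k - i))%nat with (k + k + k + k)%nat by lia.
    replace (3 * k - i)%nat with (k + (2 * k - i))%nat by lia.
    rewrite !pow_add, YW, !Neg, !Rpow_mult_distr, E16, E27, P4. fold X Y.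
    destruct Hes as [[-> | ->] [-> | ->]]; field; auto.
Qed.

Lemma INR_list_sum l : INR (list_sum l) = sumL l INR.
Proof. induction l as [|x l IH]; [reflexivity|]. cbn [list_sum fold_right]. rewrite plus_INR. unfold list_sum in IH. rewrite IH. reflexivity. Qed.

Lemma sigma_div_dil m n r : INR (sigma_div m n r) = dil r (Sg (fun d => INR d ^ m)) n.
Proof.
  unfold sigma_div, dil. destruct (n mod r =? 0)%nat; [|reflexivity].
  unfold divisor_sigma. rewrite INR_list_sum, sumL_map. apply sumL_ext. intros; apply pow_INR.
Qed.

Definition cform (A t : fps) (k j : nat) : fps := (pre t * t ^ j * A ^ k)%fp.

(** Theta product minus Eisenstein combination vanishes at all six cusps, so [repr_cuspidal]
    applies. The restriction to n >= 1 drops the constant terms of the Eisenstein series. *)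
Lemma formal_main A u t B beta k i : uniformization A u t B -> is_beta beta ->
  bernoulli (2 * k) = INR (fact (2 * k)) * bev beta (2 * k)%nat ->
  (2 <= k)%nat -> (i <= 2 * k)%nat ->
  exists a : nat -> R, forall n, (1 <= n)%nat ->
    (theta 1 ^ (4 * k - 2 * i) * theta 3 ^ (2 * i))%fp n - eisenstein_part i k n
    = sumL (seq 1 (4 * k - 5)) (fun j => a j * cform A t (2 * k) j n).
Proof.
  intros U H HB Hk Hi.
  assert (Sgn := bev_sign beta k H ltac:(lia)). set (b := bev beta (2 * k)%nat) in *.
  assert (b0 : b <> 0) by (intros E; rewrite E in Sgn; lra).
  assert (d0 := bden_pos k ltac:(lia)).
  assert (G0 : Gh beta k O = - b / 2) by apply Gh_0.
  set (Th := (theta 1 ^ (4 * k - 2 * i) * theta 3 ^ (2 * i))%fp).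
  (* Division by the constant term -b/2 normalises the cusp values to [rho r c ^ k]; division by
     [bden k] matches [eisenstein_cusps]. *)
  set (f := (Th + fC (-1) * fsumL divisors12 (fun r => fC (bnum r i k / (bden k * (- b / 2))) * dil r (Gh beta k)))%fp).
  assert (Rf : repr A t (2 * k) (4 * k) f (fun _ => 0)).
  { eapply repr_ext.
    - apply repr_add; [apply (theta_repr A u t B k i U Hi)|].
      apply repr_scal. apply repr_fsumL. intros r Hr. apply repr_scal.
      apply (Gh_repr A u t B beta r k U H Hr Hk).
    - reflexivity.
    - intros c Hc. cbv beta. rewrite G0.
      rewrite (sumL_ext _ _ (fun r => / bden k * (bnum r i k * rho r c ^ k))).
      + rewrite sumL_scal, eisenstein_cusps by (auto; lia). field. lra.
      + intros r _. field. lra. }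
  destruct (repr_cuspidal A t k f Hk Rf) as [a Ha]. exists a. intros n Hn.
  transitivity (f n).
  - unfold f, fadd. rewrite fmul_C. unfold fscal, fsumL, eisenstein_part.
    change [1; 2; 3; 4; 6; 12]%nat with divisors12.
    assert (M : forall (l : list nat) g, fold_right Rplus 0 (map g l) = sumL l g).
    { intros l g. induction l as [|x l IH]; simpl; [reflexivity | rewrite IH; reflexivity]. }
    rewrite M. unfold Rminus. f_equal.
    match goal with |- _ = -1 * ?x => replace (-1 * x) with (- x) by ring end. f_equal.
    apply sumL_ext. intros r Hr. rewrite bcoef_bnum, sigma_div_dil by auto.
    rewrite fmul_C. unfold fscal.
    assert (rpos : (0 < r)%nat) by (unfold divisors12 in Hr; each_divisor Hr; lia).
    unfold Gh. rewrite dil_add, dil_C by auto. unfold fadd.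
    replace (fC _ n) with 0 by (destruct n; [lia | reflexivity]).
    rewrite Rplus_0_l. unfold Sh.
    rewrite (Sg_ext (fun d => fexp (INR d) (2 * k - 1)) (fun d => / INR (fact (2 * k - 1)) * INR d ^ (2 * k - 1)))
      by (intros; unfold fexp, Rdiv; ring).
    rewrite Sg_scal, dil_mul, dil_C, fmul_C by auto. unfold fscal, alpha. rewrite HB. fold (bden k).
    fold b. replace (fact (2 * k)) with (fact (S (2 * k - 1))) by (f_equal; lia).
    (* Since (2k)! = 2k (2k-1)!, the factor 1/((2k-1)! (-b/2)) equals -4k/B_2k, the numerator of
       alpha_k included. *)
    rewrite fact_S, minus_INR, mult_INR by lia. simpl (INR 2). simpl (INR 1).
    field. repeat split; auto; try apply fact_neq; try lra.
    assert (0 < INR k) by (apply lt_0_INR; lia). lra.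
  - rewrite Ha. unfold fsumL, cform. apply sumL_ext. intros j _. rewrite fmul_C. reflexivity.
Qed.

(** * Representation numbers as coefficients *)

Lemma cardinal_list {T : Type} (A : T -> Prop) m :
  cardinal T A m <-> exists l, NoDup l /\ length l = m /\ forall x, A x <-> List.In x l.
Proof.
  split.
  - induction 1 as [|A m Hm [l [L1 [L2 L3]]] x Hx].
    + exists []. split; [constructor | split; [reflexivity|]]. intros x; split; [intros [] | intros []].
    + exists (x :: l). split; [constructor; auto; rewrite <- L3; auto | split; [simpl; auto|]].
      intros y. split.
      * intros [z Hz|z Hz]; [right; apply L3; auto | left; destruct Hz; reflexivity].
      * intros [->|Hy]; [right; constructor | left; apply L3; auto].
  - intros [l [L1 [<- L3]]]. revert A L3. induction L1 as [|x l Hx L1 IH]; intros A L3.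
    + replace A with (Empty_set T); [constructor|].
      apply functional_extensionality; intros x. apply propositional_extensionality.
      rewrite L3. split; intros [].
    + replace A with (Add T (fun y => List.In y l) x).
      * simpl. constructor; [apply IH; intros; reflexivity | exact Hx].
      * apply functional_extensionality; intros y. apply propositional_extensionality.
        rewrite L3. split.
        -- intros [z Hz|z Hz]; [right; exact Hz | left; destruct Hz; reflexivity].
        -- intros [->|Hy]; [right; constructor | left; exact Hy].
Qed.

(** The list shows that a cardinality exists for [epsilon] to choose, and two duplicate-free
    enumerations of one set have equal length. *)
Lemma card_list {T : Type} (A : T -> Prop) (l : list T) :
  NoDup l -> (forall x, A x <-> List.In x l) -> card A = length l.
Proof.
  intros H1 H2. unfold card.
  assert (E : cardinal T A (epsilon (inhabits 0%nat) (fun m => cardinal T A m))).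
  { apply epsilon_spec. exists (length l). apply cardinal_list. exists l; auto. }
  apply cardinal_list in E. destruct E as [m [M1 [<- M2]]].
  apply Permutation_length, NoDup_Permutation; auto. intros x. rewrite <- M2, H2. reflexivity.
Qed.

Fixpoint qform (cs : list nat) (x : list Z) : Z :=
  match cs, x with
  | c :: cs', y :: x' => (Z.of_nat c * y ^ 2 + qform cs' x')%Z
  | _, _ => 0%Z
  end.

(** The filter c y^2 <= n keeps the truncated subtraction exact. *)
Fixpoint sols (cs : list nat) (n : nat) : list (list Z) :=
  match cs with
  | [] => match n with O => [[]] | S _ => [] end
  | c :: cs' => map (fun p => fst p :: snd p)
      (dep (filter (fun y => (Z.of_nat c * y ^ 2 <=? Z.of_nat n)%Z) (zlist n))
           (fun y => sols cs' (n - Z.to_nat (Z.of_nat c * y ^ 2))))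
  end.

Lemma qform_nonneg cs x : (0 <= qform cs x)%Z.
Proof.
  revert x; induction cs as [|c cs IH]; intros [|y x]; simpl; try lia.
  specialize (IH x). assert (0 <= Z.of_nat c * (y * (y * 1)))%Z by nia. lia.
Qed.

Lemma in_sols cs n x : (forall c, List.In c cs -> (0 < c)%nat) ->
  List.In x (sols cs n) <-> length x = length cs /\ qform cs x = Z.of_nat n.
Proof.
  revert n x; induction cs as [|c cs IH]; intros n x Hc.
  - simpl. destruct n as [|n]; simpl; split.
    + intros [<-|[]]; auto.
    + intros [H _]. destruct x; [auto | discriminate].
    + intros [].
    + intros [_ H]. destruct x; simpl in H; lia.
  - cbn [sols]. rewrite in_map_iff. assert (c0 : (0 < c)%nat) by (apply Hc; left; auto).
    assert (Hc' : forall d, List.In d cs -> (0 < d)%nat) by (intros; apply Hc; right; auto).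
    split.
    + intros [[y z] [<- H]]. apply in_dep in H. destruct H as [H1 H2]. apply filter_In in H1.
      destruct H1 as [H1 H3]. apply Z.leb_le in H3. apply IH in H2; auto. destruct H2 as [H2 H4].
      cbn [fst snd length qform]. split; [congruence|]. rewrite H4. nia.
    + intros [H1 H2]. destruct x as [|y z]; [discriminate|]. cbn [qform] in H2.
      assert (Q := qform_nonneg cs z). exists (y, z). split; [reflexivity|].
      apply in_dep. rewrite filter_In, in_zlist, Z.leb_le, IH by auto.
      assert (0 <= y ^ 2)%Z by nia.
      repeat split; try nia. simpl in H1; lia.
Qed.

Lemma NoDup_sols cs n : NoDup (sols cs n).
Proof.
  revert n; induction cs as [|c cs IH]; intros n.
  - destruct n; simpl; repeat constructor; intros [].
  - cbn [sols]. apply FinFun.Injective_map_NoDup.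
    + intros [a b] [a' b'] E. simpl in E. congruence.
    + apply NoDup_dep; auto. apply NoDup_filter, NoDup_zlist.
Qed.

Fixpoint theta_prod (cs : list nat) : fps :=
  match cs with [] => fC 1 | c :: cs' => (theta c * theta_prod cs')%fp end.

Lemma sumL_delta n m g :
  sumL (seq 0 (S n)) (fun l => if (l =? m)%nat then g l else 0) = if (m <=? n)%nat then g m else 0.
Proof.
  induction n as [|n IH].
  - simpl. destruct m; simpl; ring.
  - rewrite sumL_seq_S, IH. simpl (0 + S n)%nat.
    destruct (Nat.leb_spec m n); destruct (Nat.leb_spec m (S n)); destruct (Nat.eqb_spec (S n) m); subst; try lia; ring.
Qed.

(** Splitting off the first coordinate is a Cauchy product: after exchanging the sums over l and x,
    each x meets the single exponent l = c x^2. *)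
Lemma length_sols cs n : (forall c, List.In c cs -> (0 < c)%nat) ->
  INR (length (sols cs n)) = theta_prod cs n.
Proof.
  revert n; induction cs as [|c cs IH]; intros n Hc.
  - destruct n; reflexivity.
  - cbn [sols theta_prod]. rewrite length_map, fmul_sumL.
    assert (c0 : (0 < c)%nat) by (apply Hc; left; auto).
    assert (Hc' : forall d, List.In d cs -> (0 < d)%nat) by (intros; apply Hc; right; auto).
    rewrite (sumL_ext (seq 0 (S n)) _ (fun l => sumL (zlist n)
      (fun x => if (l =? Z.to_nat (Z.of_nat c * x ^ 2))%nat then theta_prod cs (n - l) else 0))).
    + rewrite sumL_swap.
      rewrite <- (Rmult_1_r (INR _)), <- (sumL_const _ 1), sumL_dep.
      rewrite (sumL_filter (fun y => (Z.of_nat c * y ^ 2 <=? Z.of_nat n)%Z) (zlist n)).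
      rewrite (sumL_0 (filter (fun x => negb _) _)).
      * rewrite Rplus_0_r. apply sumL_ext. intros x Hx. apply filter_In in Hx. destruct Hx as [_ Hx].
        apply Z.leb_le in Hx. rewrite sumL_delta, sumL_const, IH by auto.
        destruct (Nat.leb_spec (Z.to_nat (Z.of_nat c * x ^ 2)) n); [ring | lia].
      * intros x Hx. apply filter_In in Hx. destruct Hx as [_ Hx].
        rewrite Bool.negb_true_iff, Z.leb_gt in Hx. rewrite sumL_delta.
        destruct (Nat.leb_spec (Z.to_nat (Z.of_nat c * x ^ 2)) n); [lia | reflexivity].
    + intros l Hl. apply in_seq in Hl. rewrite (theta_bound c n l) by lia.
      rewrite Rmult_comm, <- sumL_scal. apply sumL_ext. intros x _.
      assert (0 <= Z.of_nat c * x ^ 2)%Z by nia.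
      destruct (Z.eqb_spec (Z.of_nat c * x ^ 2) (Z.of_nat l)); destruct (Nat.eqb_spec l (Z.to_nat (Z.of_nat c * x ^ 2)));
        try lia; ring.
Qed.

Lemma theta_prod_repeat a b : theta_prod (repeat 1%nat a ++ repeat 3%nat b) = (theta 1 ^ a * theta 3 ^ b)%fp.
Proof.
  induction a as [|a IH]; simpl.
  - induction b as [|b IH]; simpl; [ring | rewrite IH; ring].
  - rewrite IH. ring.
Qed.

Lemma qform_repeat a b x : length x = (a + b)%nat ->
  qform (repeat 1%nat a ++ repeat 3%nat b) x
  = (zsum (map (fun t => t ^ 2) (firstn a x)) + zsum (map (fun t => 3 * t ^ 2) (skipn a x)))%Z.
Proof.
  revert x; induction a as [|a IH]; intros x Hx.
  - cbn [repeat app firstn skipn map]. change (zsum []) with 0%Z. rewrite Z.add_0_l.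
    revert x Hx; induction b as [|b IHb]; intros [|y x] Hx; try discriminate; [reflexivity|].
    cbn [repeat qform map]. rewrite IHb by (simpl in *; lia). reflexivity.
  - destruct x as [|y x]; [discriminate|]. cbn [repeat app qform firstn skipn map].
    rewrite IH by (simpl in Hx; lia). unfold zsum. cbn [fold_right]. lia.
Qed.

Lemma Nrep_theta a b n : INR (Nrep a b n) = (theta 1 ^ a * theta 3 ^ b)%fp n.
Proof.
  set (cs := repeat 1%nat a ++ repeat 3%nat b).
  assert (Hc : forall c, List.In c cs -> (0 < c)%nat).
  { intros c H. unfold cs in H. apply in_app_or in H. destruct H as [H|H]; apply repeat_spec in H; lia. }
  rewrite <- theta_prod_repeat, <- length_sols by exact Hc. f_equal.
  apply card_list; [apply NoDup_sols|]. intros x. fold cs. rewrite in_sols by exact Hc.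
  unfold cs at 1. rewrite length_app, !repeat_length.
  split; intros [H1 H2]; (split; [exact H1|]).
  - unfold cs. rewrite qform_repeat by exact H1. symmetry; exact H2.
  - unfold cs in H2. rewrite qform_repeat in H2 by exact H1. symmetry; exact H2.
Qed.

(** * Evaluation of power series in the unit disc *)

Definition cv (u : nat -> C) (l : C) : Prop :=
  forall eps, 0 < eps -> exists N, forall n, (N <= n)%nat -> Cmod (u n - l)%C < eps.

Lemma cv_ext u v l : (forall n, u n = v n) -> cv u l -> cv v l.
Proof. intros H K eps He. destruct (K eps He) as [N HN]. exists N. intros n Hn. rewrite <- H. auto. Qed.
Lemma cv_const c : cv (fun _ => c) c.
Proof. intros eps He. exists O. intros n _. replace (c - c)%C with (RtoC 0) by ring. rewrite Cmod_0. exact He. Qed.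
Lemma Cmod_sub_sym x y : Cmod (x - y)%C = Cmod (y - x)%C.
Proof. rewrite <- Cmod_opp. f_equal. ring. Qed.
Lemma cv_unique u l m : cv u l -> cv u m -> l = m.
Proof.
  intros H K. destruct (Req_dec (Cmod (l - m)%C) 0) as [E|E].
  - apply Cmod_eq_0 in E. replace l with ((l - m) + m)%C by ring. rewrite E. ring.
  - exfalso. assert (P := Cmod_ge_0 (l - m)%C).
    destruct (H (Cmod (l - m)%C / 2) ltac:(lra)) as [N1 H1].
    destruct (K (Cmod (l - m)%C / 2) ltac:(lra)) as [N2 H2].
    specialize (H1 (N1 + N2)%nat ltac:(lia)). specialize (H2 (N1 + N2)%nat ltac:(lia)).
    assert (T := Cmod_triangle (l - u (N1 + N2)%nat)%C (u (N1 + N2)%nat - m)%C).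
    replace (l - u (N1 + N2)%nat + (u (N1 + N2)%nat - m))%C with (l - m)%C in T by ring.
    rewrite (Cmod_sub_sym l (u _)) in T. lra.
Qed.
Lemma cv_close u v l (e : nat -> R) : cv u l -> (forall n, Cmod (v n - u n)%C <= e n) ->
  is_lim_seq e 0 -> cv v l.
Proof.
  intros H K E eps He. destruct (H (eps / 2) ltac:(lra)) as [N1 H1].
  apply is_lim_seq_spec in E. destruct (E (mkposreal (eps / 2) ltac:(lra))) as [N2 H2]. simpl in H2.
  exists (N1 + N2)%nat. intros n Hn. specialize (H1 n ltac:(lia)). specialize (H2 n ltac:(lia)).
  assert (T := Cmod_triangle (v n - u n)%C (u n - l)%C). specialize (K n).
  replace (v n - u n + (u n - l))%C with (v n - l)%C in T by ring.
  rewrite Rminus_0_r in H2. assert (e n <= Rabs (e n)) by apply Rle_abs. lra.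
Qed.
Lemma cv_plus u v l m : cv u l -> cv v m -> cv (fun n => (u n + v n)%C) (l + m)%C.
Proof.
  intros H K eps He. destruct (H (eps / 2) ltac:(lra)) as [N1 H1]. destruct (K (eps / 2) ltac:(lra)) as [N2 H2].
  exists (N1 + N2)%nat. intros n Hn. specialize (H1 n ltac:(lia)). specialize (H2 n ltac:(lia)).
  assert (T := Cmod_triangle (u n - l)%C (v n - m)%C).
  replace (u n - l + (v n - m))%C with (u n + v n - (l + m))%C in T by ring. lra.
Qed.
Lemma cv_bounded u l : cv u l -> exists M, 0 < M /\ exists N, forall n, (N <= n)%nat -> Cmod (u n) <= M.
Proof.
  intros H. destruct (H 1 ltac:(lra)) as [N HN]. exists (1 + Cmod l). split; [assert (P := Cmod_ge_0 l); lra|].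
  exists N. intros n Hn. specialize (HN n Hn). assert (T := Cmod_triangle (u n - l)%C l).
  replace (u n - l + l)%C with (u n) in T by ring. lra.
Qed.
Lemma cv_mult u v l m : cv u l -> cv v m -> cv (fun n => (u n * v n)%C) (l * m)%C.
Proof.
  intros H K eps He. destruct (cv_bounded u l H) as [M [M0 [N0 HM]]].
  assert (Pm := Cmod_ge_0 m).
  destruct (H (eps / 2 / (Cmod m + 1))) as [N1 H1]; [apply Rdiv_lt_0_compat; lra|].
  destruct (K (eps / 2 / M)) as [N2 H2]; [apply Rdiv_lt_0_compat; lra|].
  exists (N0 + N1 + N2)%nat. intros n Hn. specialize (H1 n ltac:(lia)). specialize (H2 n ltac:(lia)).
  specialize (HM n ltac:(lia)).
  assert (T := Cmod_triangle (u n * (v n - m))%C ((u n - l) * m)%C).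
  replace (u n * (v n - m) + (u n - l) * m)%C with (u n * v n - l * m)%C in T by ring.
  rewrite !Cmod_mult in T.
  assert (Cmod (u n) * Cmod (v n - m)%C <= M * Cmod (v n - m)%C)
    by (apply Rmult_le_compat_r; [apply Cmod_ge_0 | auto]).
  assert (M * Cmod (v n - m)%C < M * (eps / 2 / M)) by (apply Rmult_lt_compat_l; auto).
  replace (M * (eps / 2 / M)) with (eps / 2) in * by (field; lra).
  assert (Cmod (u n - l)%C * Cmod m <= eps / 2 / (Cmod m + 1) * (Cmod m + 1)).
  { apply Rmult_le_compat; try apply Cmod_ge_0; lra. }
  replace (eps / 2 / (Cmod m + 1) * (Cmod m + 1)) with (eps / 2) in * by (field; lra). lra.
Qed.
Lemma cv_le u l B : cv u l -> (exists N, forall n, (N <= n)%nat -> Cmod (u n) <= B) -> Cmod l <= B.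
Proof.
  intros H [N HN]. apply Rnot_lt_le. intros L. destruct (H (Cmod l - B) ltac:(lra)) as [N' H'].
  specialize (H' (N + N')%nat ltac:(lia)). specialize (HN (N + N')%nat ltac:(lia)).
  assert (T := Cmod_triangle (l - u (N + N')%nat)%C (u (N + N')%nat)).
  replace (l - u (N + N')%nat + u (N + N')%nat)%C with l in T by ring. rewrite Cmod_sub_sym in T. lra.
Qed.
Lemma cv_R u l : is_lim_seq u (Finite l) -> cv (fun n => RtoC (u n)) (RtoC l).
Proof.
  intros H eps He. apply is_lim_seq_spec in H. destruct (H (mkposreal eps He)) as [N HN]. exists N.
  intros n Hn. rewrite <- RtoC_minus, Cmod_R. apply HN; auto.
Qed.
Lemma im_le_Cmod (c : C) : Rabs (Im c) <= Cmod c.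
Proof. eapply Rle_trans; [apply Rmax_r | apply Rmax_Cmod]. Qed.
Lemma cv_Re u l : cv u l -> is_lim_seq (fun n => Re (u n)) (Finite (Re l)).
Proof.
  intros H. apply is_lim_seq_spec. intros eps. destruct (H eps (cond_pos eps)) as [N HN]. exists N.
  intros n Hn. eapply Rle_lt_trans; [|apply (HN n Hn)].
  replace (Re (u n) - Re l) with (Re (u n - l)%C) by reflexivity. apply re_le_Cmod.
Qed.
Lemma cv_Im u l : cv u l -> is_lim_seq (fun n => Im (u n)) (Finite (Im l)).
Proof.
  intros H. apply is_lim_seq_spec. intros eps. destruct (H eps (cond_pos eps)) as [N HN]. exists N.
  intros n Hn. eapply Rle_lt_trans; [|apply (HN n Hn)].
  replace (Im (u n) - Im l) with (Im (u n - l)%C) by reflexivity. apply im_le_Cmod.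
Qed.
Lemma cv_ReIm u a b : is_lim_seq (fun n => Re (u n)) (Finite a) -> is_lim_seq (fun n => Im (u n)) (Finite b) ->
  cv u (a, b).
Proof.
  intros H K. apply (cv_ext (fun n => (RtoC (Re (u n)) + Ci * RtoC (Im (u n)))%C)).
  - intros n. destruct (u n) as [x y]. unfold RtoC, Ci, Cplus, Cmult, Re, Im; simpl. f_equal; ring.
  - replace ((a, b) : C) with (RtoC a + Ci * RtoC b)%C
      by (unfold RtoC, Ci, Cplus, Cmult; simpl; f_equal; ring).
    apply cv_plus; [apply cv_R; auto|]. apply cv_mult; [apply cv_const | apply cv_R; auto].
Qed.
Lemma Clim_seq_cv u l : cv u l -> Clim_seq u = l.
Proof.
  intros H. unfold Clim_seq. rewrite (is_lim_seq_unique _ _ (cv_Re u l H)), (is_lim_seq_unique _ _ (cv_Im u l H)).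
  destruct l; reflexivity.
Qed.

Lemma is_series_cv (a : nat -> C) (l : C) :
  is_series (K := C_AbsRing) (V := C_NormedModule) a l <-> cv (sum_n (G := C_AbelianMonoid) a) l.
Proof.
  unfold is_series. split.
  (* Balls of the normed module and the modulus are comparable up to sqrt 2 < 2, so half of eps is
     requested. *)
  - intros H eps He. assert (He2 : 0 < eps / 2) by lra.
    assert (H2 := proj1 (filterlim_locally (F := eventually) _ _) H (mkposreal _ He2)).
    destruct H2 as [N HN]. exists N. intros n Hn. apply HN in Hn.
    apply C_NormedModule_mixin_compat2 in Hn. simpl in Hn.
    assert (sqrt 2 < 2) by (rewrite <- (sqrt_square 2) at 2 by lra; apply sqrt_lt_1; lra).
    eapply Rlt_trans; [exact Hn|]. apply (Rlt_le_trans _ (2 * (eps / 2))); [|lra].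
    apply Rmult_lt_compat_r; lra.
  - intros H. apply (proj2 (filterlim_locally (F := eventually) _ _)). intros eps.
    destruct (H eps (cond_pos eps)) as [N HN]. exists N. intros n Hn.
    apply C_NormedModule_mixin_compat1. apply HN; auto.
Qed.

(** Horner form of the partial sum through q^N, built on [ftail] to match the recursion of
    [fmul]. *)
Fixpoint pev (f : fps) (q : C) (N : nat) : C :=
  match N with O => RtoC (f O) | S M => (RtoC (f O) + q * pev (ftail f) q M)%C end.
Fixpoint rpev (f : fps) (r : R) (N : nat) : R :=
  match N with O => f O | S M => f O + r * rpev (ftail f) r M end.

Lemma pev_last f q N : pev f q (S N) = (pev f q N + RtoC (f (S N)) * q ^ S N)%C.
Proof.
  revert f; induction N as [|N IH]; intros f; [simpl; unfold ftail; ring|].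
  change (pev f q (S (S N))) with (RtoC (f O) + q * pev (ftail f) q (S N))%C. rewrite IH.
  change (pev f q (S N)) with (RtoC (f O) + q * pev (ftail f) q N)%C. unfold ftail at 2. simpl (q ^ S (S N))%C.
  simpl (q ^ S N)%C. ring.
Qed.
Lemma rpev_last f r N : rpev f r (S N) = rpev f r N + f (S N) * r ^ S N.
Proof.
  revert f; induction N as [|N IH]; intros f; [simpl; unfold ftail; ring|].
  change (rpev f r (S (S N))) with (f O + r * rpev (ftail f) r (S N)). rewrite IH.
  change (rpev f r (S N)) with (f O + r * rpev (ftail f) r N). unfold ftail at 2. simpl. ring.
Qed.
Lemma rpev_sum f r N : rpev f r N = sum_n (fun n => f n * r ^ n) N.
Proof.
  induction N as [|N IH]; [rewrite sum_O; simpl; ring|]. rewrite rpev_last, sum_Sn, IH. reflexivity.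
Qed.
Lemma pev_RtoC f r N : pev f (RtoC r) N = RtoC (rpev f r N).
Proof.
  revert f; induction N as [|N IH]; intros f; [reflexivity|]. simpl. rewrite IH, RtoC_plus, RtoC_mult. reflexivity.
Qed.
Lemma rpev_series f r l : is_lim_seq (rpev f r) (Finite l) <-> is_series (fun n => f n * r ^ n) l.
Proof.
  split; intros H.
  - unfold is_series. apply (is_lim_seq_ext _ _ _ (rpev_sum f r)) in H. exact H.
  - apply (is_lim_seq_ext (sum_n (fun n => f n * r ^ n))); [intros; symmetry; apply rpev_sum | exact H].
Qed.

Definition fabs (f : fps) : fps := fun n => Rabs (f n).

Lemma pev_le f q N : Cmod (pev f q N) <= rpev (fabs f) (Cmod q) N.
Proof.
  revert f; induction N as [|N IH]; intros f; cbn [pev rpev]; [rewrite Cmod_R; apply Rle_refl|].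
  eapply Rle_trans; [apply Cmod_triangle|]. rewrite Cmod_R, Cmod_mult. apply Rplus_le_compat; [apply Rle_refl|].
  apply Rmult_le_compat_l; [apply Cmod_ge_0 | apply IH].
Qed.
(** The defect consists of the products of terms of degree at most N with total degree above N; its
    bound is the same defect for absolute values, which tends to 0 by the real Cauchy product. *)
Lemma pev_mul_defect f g q N :
  Cmod (pev f q N * pev g q N - pev (f * g)%fp q N)%C
  <= rpev (fabs f) (Cmod q) N * rpev (fabs g) (Cmod q) N - rpev (fabs f * fabs g)%fp (Cmod q) N.
Proof.
  set (r := Cmod q). assert (r0 : 0 <= r) by apply Cmod_ge_0.
  assert (Cs : forall c h N, pev (fscal c h) q N = (RtoC c * pev h q N)%C).
  { intros c h M. revert h; induction M as [|M IH]; intros h; cbn [pev].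
    - unfold fscal. apply RtoC_mult.
    - change (ftail (fscal c h)) with (fscal c (ftail h)). rewrite IH. unfold fscal. rewrite RtoC_mult. ring. }
  assert (Cr : forall c h N, rpev (fscal c h) r N = c * rpev h r N).
  { intros c h M. revert h; induction M as [|M IH]; intros h; cbn [rpev].
    - unfold fscal. reflexivity.
    - change (ftail (fscal c h)) with (fscal c (ftail h)). rewrite IH. unfold fscal. ring. }
  assert (As : forall h h' N, pev (h + h')%fp q N = (pev h q N + pev h' q N)%C).
  { intros h h' M. revert h h'; induction M as [|M IH]; intros h h'; cbn [pev].
    - unfold fadd. apply RtoC_plus.
    - change (ftail (h + h')%fp) with (ftail h + ftail h')%fp. rewrite IH. unfold fadd. rewrite RtoC_plus. ring. }
  assert (Ar : forall h h' N, rpev (h + h')%fp r N = rpev h r N + rpev h' r N).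
  { intros h h' M. revert h h'; induction M as [|M IH]; intros h h'; cbn [rpev].
    - unfold fadd. reflexivity.
    - change (ftail (h + h')%fp) with (ftail h + ftail h')%fp. rewrite IH. unfold fadd. ring. }
  revert f g; induction N as [|N IH]; intros f g.
  - cbn [pev rpev]. rewrite !fmul_0, RtoC_mult.
    replace (RtoC (f O) * RtoC (g O) - RtoC (f O) * RtoC (g O))%C with (RtoC 0) by ring.
    rewrite Cmod_0. unfold fabs. right; ring.
  - assert (E1 : pev (f * g)%fp q (S N) = (RtoC (f O) * pev g q (S N) + q * pev (ftail f * g)%fp q N)%C).
    { change (pev (f * g)%fp q (S N)) with (RtoC ((f * g)%fp O) + q * pev (ftail (f * g)%fp) q N)%C.
      change (ftail (f * g)%fp) with (fscal (f O) (ftail g) + ftail f * g)%fp. rewrite As, Cs, fmul_0, RtoC_mult.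
      cbn [pev]. ring. }
    assert (E2 : rpev (fabs f * fabs g)%fp r (S N)
       = fabs f O * rpev (fabs g) r (S N) + r * rpev (fabs (ftail f) * fabs g)%fp r N).
    { change (rpev (fabs f * fabs g)%fp r (S N))
        with ((fabs f * fabs g)%fp O + r * rpev (ftail (fabs f * fabs g)%fp) r N).
      change (ftail (fabs f * fabs g)%fp) with (fscal (fabs f O) (ftail (fabs g)) + fabs (ftail f) * fabs g)%fp.
      rewrite Ar, Cr, fmul_0. cbn [rpev]. ring. }
    rewrite E1, E2. specialize (IH (ftail f) g).
    change (pev f q (S N)) with (RtoC (f O) + q * pev (ftail f) q N)%C.
    change (rpev (fabs f) r (S N)) with (fabs f O + r * rpev (fabs (ftail f)) r N).
    rewrite (pev_last g), (rpev_last (fabs g)).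
    match goal with |- Cmod ?L <= ?R =>
      replace L with (q * ((pev (ftail f) q N * pev g q N - pev (ftail f * g)%fp q N)
                        + pev (ftail f) q N * (RtoC (g (S N)) * q ^ S N)))%C by ring;
      replace R with (r * ((rpev (fabs (ftail f)) r N * rpev (fabs g) r N - rpev (fabs (ftail f) * fabs g)%fp r N)
                        + rpev (fabs (ftail f)) r N * (fabs g (S N) * r ^ S N))) by ring end.
    rewrite Cmod_mult. apply Rmult_le_compat_l; [exact r0|].
    eapply Rle_trans; [apply Cmod_triangle|]. apply Rplus_le_compat; [exact IH|].
    rewrite !Cmod_mult, Cmod_R, Cmod_pow. fold r. apply Rmult_le_compat_r.
    + apply Rmult_le_pos; [apply Rabs_pos | apply pow_le; auto].
    + apply pev_le.
Qed.

(** Absolute convergence in the whole open unit disc, the domain of the nome. *)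
Definition summ (f : fps) : Prop := forall r, 0 <= r < 1 -> ex_series (fun n => fabs f n * r ^ n).

Lemma summ_abs f r : summ f -> 0 <= r < 1 -> ex_series (fun n => Rabs (fabs f n * r ^ n)).
Proof.
  intros H Hr. apply (ex_series_ext (fun n => fabs f n * r ^ n)); [|apply H; auto].
  intros n. rewrite Rabs_right; [reflexivity|]. apply Rle_ge, Rmult_le_pos; [apply Rabs_pos | apply pow_le; lra].
Qed.

Lemma fabs_mul_series f g r : summ f -> summ g -> 0 <= r < 1 ->
  is_series (fun n => (fabs f * fabs g)%fp n * r ^ n)
    (Series (fun n => fabs f n * r ^ n) * Series (fun n => fabs g n * r ^ n)).
Proof.
  intros Hf Hg Hr.
  assert (M := is_series_mult _ _ _ _ (Series_correct _ (Hf r Hr)) (Series_correct _ (Hg r Hr))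
    (summ_abs f r Hf Hr) (summ_abs g r Hg Hr)).
  eapply is_series_ext; [|exact M]. intros n. cbv beta. rewrite fmul_sumL.
  assert (B : forall h m, sum_f_R0 h m = sumL (seq 0 (S m)) h).
  { intros h m. induction m as [|m IH]; [simpl; ring|]. rewrite sumL_seq_S, <- IH. reflexivity. }
  rewrite B, Rmult_comm, <- sumL_scal. apply sumL_ext. intros l Hl. apply in_seq in Hl.
  replace (r ^ n) with (r ^ l * r ^ (n - l)) by (rewrite <- pow_add; f_equal; lia). ring.
Qed.

Lemma fmul_abs f g n : Rabs ((f * g)%fp n) <= (fabs f * fabs g)%fp n.
Proof.
  revert f; induction n as [|n IH]; intros f; cbn [fmul]; [rewrite Rabs_mult; apply Rle_refl|].
  eapply Rle_trans; [apply Rabs_triang|]. rewrite Rabs_mult. apply Rplus_le_compat; [apply Rle_refl|]. apply IH.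
Qed.

Lemma summ_le f g : summ g -> (forall n, Rabs (f n) <= g n) -> summ f.
Proof.
  intros Hg H r Hr. apply (ex_series_le (K := R_AbsRing) (V := R_CompleteNormedModule)) with (b := fun n => fabs g n * r ^ n); [|apply Hg; auto].
  intros n. change (norm (fabs f n * r ^ n)) with (Rabs (fabs f n * r ^ n)).
  assert (0 <= r ^ n) by (apply pow_le; lra). unfold fabs.
  rewrite Rabs_mult, Rabs_Rabsolu, (Rabs_right (r ^ n)) by lra. apply Rmult_le_compat_r; auto.
  eapply Rle_trans; [apply H | apply Rle_abs].
Qed.
Lemma summ_mul f g : summ f -> summ g -> summ (f * g)%fp.
Proof.
  intros Hf Hg. apply (summ_le _ (fabs f * fabs g)%fp); [|intros; apply fmul_abs].
  intros r Hr. assert (E : fabs (fabs f * fabs g)%fp = (fabs f * fabs g)%fp).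
  { apply fps_ext; intros n. apply Rabs_right, Rle_ge. eapply Rle_trans; [apply Rabs_pos | apply (fmul_abs f g)]. }
  rewrite E. eexists. apply fabs_mul_series; auto.
Qed.
Lemma summ_bounded f M : (forall n, Rabs (f n) <= M) -> summ f.
Proof.
  intros H r Hr. apply (ex_series_le (K := R_AbsRing) (V := R_CompleteNormedModule)) with (b := fun n => M * r ^ n).
  - intros n. change (norm (fabs f n * r ^ n)) with (Rabs (fabs f n * r ^ n)).
    assert (0 <= r ^ n) by (apply pow_le; lra). unfold fabs.
    rewrite Rabs_mult, Rabs_Rabsolu, (Rabs_right (r ^ n)) by lra. apply Rmult_le_compat_r; auto.
  - apply (ex_series_scal (K := R_AbsRing) (V := R_NormedModule)). apply ex_series_geom. rewrite Rabs_right; lra.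
Qed.
Lemma summ_add f g : summ f -> summ g -> summ (f + g)%fp.
Proof.
  intros Hf Hg. apply (summ_le _ (fabs f + fabs g)%fp); [|intros; apply Rabs_triang].
  intros r Hr. apply (ex_series_ext (fun n => plus (fabs f n * r ^ n) (fabs g n * r ^ n))).
  - intros n. unfold fadd, fabs at 3. rewrite Rabs_right; [unfold plus; simpl; ring|].
    apply Rle_ge, Rplus_le_le_0_compat; apply Rabs_pos.
  - apply (ex_series_plus (K := R_AbsRing) (V := R_NormedModule)); [apply Hf | apply Hg]; auto.
Qed.
Lemma summ_C c : summ (fC c).
Proof. apply (summ_bounded _ (Rabs c)). intros [|n]; simpl; [apply Rle_refl | rewrite Rabs_R0; apply Rabs_pos]. Qed.
Lemma summ_X a : summ (fX a).
Proof. apply (summ_bounded _ 1). intros n. unfold fX. destruct (_ =? _)%nat; rewrite ?Rabs_R0, ?Rabs_R1; lra. Qed.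
Lemma summ_pow f n : summ f -> summ (f ^ n)%fp.
Proof. intros H; induction n; simpl; [apply summ_C | apply summ_mul; auto]. Qed.

Definition evalsto (f : fps) (q l : C) : Prop := cv (pev f q) l.

Lemma evalsto_mul f g q l m : summ f -> summ g -> Cmod q < 1 ->
  evalsto f q l -> evalsto g q m -> evalsto (f * g)%fp q (l * m)%C.
Proof.
  intros Hf Hg Hq H K. assert (r0 : 0 <= Cmod q < 1) by (split; [apply Cmod_ge_0 | auto]).
  apply (cv_close _ _ _ _ (cv_mult _ _ _ _ H K)
    (fun n => eq_ind _ (fun x => x <= _) (pev_mul_defect f g q n) _ (Cmod_sub_sym _ _))).
  set (r := Cmod q) in *.
  assert (L1 := proj2 (rpev_series _ _ _) (Series_correct _ (Hf r r0))).
  assert (L2 := proj2 (rpev_series _ _ _) (Series_correct _ (Hg r r0))).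
  assert (L3 := proj2 (rpev_series _ _ _) (fabs_mul_series f g r Hf Hg r0)).
  assert (L4 := is_lim_seq_minus' _ _ _ _ (is_lim_seq_mult' _ _ _ _ L1 L2) L3).
  rewrite Rminus_diag in L4. exact L4.
Qed.
Lemma evalsto_add f g q l m : evalsto f q l -> evalsto g q m -> evalsto (f + g)%fp q (l + m)%C.
Proof.
  intros H K. refine (cv_ext _ _ _ _ (cv_plus _ _ _ _ H K)). intros n. clear. revert f g.
  induction n as [|n IH]; intros f g; cbn [pev]; unfold fadd; rewrite RtoC_plus; [reflexivity|].
  change (ftail (fun n0 => f n0 + g n0)) with (ftail f + ftail g)%fp. rewrite <- IH. ring.
Qed.
Lemma evalsto_C c q : evalsto (fC c) q (RtoC c).
Proof.
  apply (cv_ext (fun _ => RtoC c)); [|apply cv_const]. intros n.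
  assert (Z : forall m, pev (fun _ => 0) q m = RtoC 0).
  { intros m. induction m as [|m IH]; cbn [pev]; [reflexivity|].
    change (ftail (fun _ => 0)) with (fun _ : nat => 0). rewrite IH. ring. }
  destruct n as [|n]; cbn [pev]; [reflexivity|].
  change (ftail (fC c)) with (fun _ : nat => 0). rewrite Z. simpl. ring.
Qed.
Lemma evalsto_X a q : evalsto (fX a) q (q ^ a)%C.
Proof.
  assert (E : forall a n, pev (fX a) q (a + n) = (q ^ a)%C).
  { clear. induction a as [|a IH]; intros n.
    - rewrite fX0. assert (Z : forall m, pev (fun _ => 0) q m = RtoC 0).
      { intros m. induction m as [|m IHm]; cbn [pev]; [reflexivity|].
        change (ftail (fun _ => 0)) with (fun _ : nat => 0). rewrite IHm. ring. }
      destruct n; cbn [pev Nat.add]; [reflexivity|]. change (ftail (fC 1)) with (fun _ : nat => 0). rewrite Z. simpl. ring.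
    - cbn [Nat.add pev]. rewrite ftail_fX, IH. change (fX (S a) O) with 0. simpl. ring. }
  intros eps He. exists a. intros n Hn. replace n with (a + (n - a))%nat by lia. rewrite E.
  replace (q ^ a - q ^ a)%C with (RtoC 0) by ring. rewrite Cmod_0. exact He.
Qed.
Lemma evalsto_pow f q l n : summ f -> Cmod q < 1 -> evalsto f q l -> evalsto (f ^ n)%fp q (l ^ n)%C.
Proof.
  intros H Hq K. induction n as [|n IH]; cbn [fpow]; [apply evalsto_C|].
  apply evalsto_mul; auto. apply summ_pow; auto.
Qed.
Lemma evalsto_exists f q : summ f -> Cmod q < 1 -> exists l, evalsto f q l.
Proof.
  intros H Hq. assert (r0 : 0 <= Cmod q < 1) by (split; [apply Cmod_ge_0 | auto]).
  assert (B : forall (p : C -> R), (forall z, Rabs (p z) <= Cmod z) ->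
     ex_series (fun n => p (RtoC (f n) * q ^ n)%C)).
  { intros p Hp. apply (ex_series_le (K := R_AbsRing) (V := R_CompleteNormedModule)) with (b := fun n => fabs f n * Cmod q ^ n); [|apply H; auto].
    intros n. eapply Rle_trans; [apply Hp|]. rewrite Cmod_mult, Cmod_R, Cmod_pow. apply Rle_refl. }
  destruct (B Re re_le_Cmod) as [a Ha]. destruct (B Im im_le_Cmod) as [b Hb].
  exists (a, b). apply cv_ReIm.
  - eapply is_lim_seq_ext; [|exact Ha]. intros n. induction n as [|n IH].
    + rewrite sum_O. simpl. f_equal. ring.
    + rewrite sum_Sn, pev_last, IH. reflexivity.
  - eapply is_lim_seq_ext; [|exact Hb]. intros n. induction n as [|n IH].
    + rewrite sum_O. simpl. f_equal. ring.
    + rewrite sum_Sn, pev_last, IH. reflexivity.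
Qed.

Lemma summ_pos f : (forall r, 0 < r < 1 -> ex_series (fun n => fabs f n * r ^ n)) -> summ f.
Proof.
  intros H r [H0 H1]. destruct (Rle_lt_or_eq_dec 0 r H0) as [L|<-]; [apply H; lra|].
  apply (ex_series_le (K := R_AbsRing) (V := R_CompleteNormedModule)) with (b := fun n => fabs f n * (1/2) ^ n);
    [|apply H; lra].
  intros n. change (norm (fabs f n * 0 ^ n)) with (Rabs (fabs f n * 0 ^ n)).
  assert (0 <= fabs f n) by apply Rabs_pos. assert (0 < (1/2) ^ n) by (apply pow_lt; lra).
  destruct n as [|n]; [simpl; rewrite Rabs_right; lra|].
  rewrite pow_i, Rmult_0_r, Rabs_R0 by lia. apply Rmult_le_pos; lra.
Qed.

(** For r < s < 1 and 1 + x = s/r, Bernoulli's inequality gives n r^n <= s^n/x. *)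
Lemma summ_D f : summ f -> summ (fD f).
Proof.
  intros H. apply summ_pos. intros r Hr. set (s := (1 + r) / 2).
  assert (Hs : r < s < 1) by (unfold s; lra). set (x := s / r - 1).
  assert (x0 : 0 < x). { unfold x. assert (1 < s / r); [|lra]. apply (Rmult_lt_reg_r r); [lra|].
    unfold Rdiv. rewrite Rmult_assoc, Rinv_l by lra. lra. }
  apply (ex_series_le (K := R_AbsRing) (V := R_CompleteNormedModule)) with (b := fun n => / x * (fabs f n * s ^ n)).
  - intros n. change (norm (fabs (fD f) n * r ^ n)) with (Rabs (fabs (fD f) n * r ^ n)).
    assert (P := poly n x x0). replace (1 + x) with (s / r) in P by (unfold x; ring).
    assert (rn : 0 < r ^ n) by (apply pow_lt; lra).
    assert (E : INR n * r ^ n <= / x * s ^ n).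
    { assert (Q : (s / r) ^ n * r ^ n = s ^ n) by (rewrite <- Rpow_mult_distr; f_equal; field; lra).
      apply (Rmult_le_reg_l x); auto. rewrite <- Rmult_assoc, <- Rmult_assoc, Rinv_r, Rmult_1_l by lra.
      rewrite <- Q. apply Rmult_le_compat_r; [lra|]. lra. }
    unfold fabs, fD. rewrite Rabs_mult, Rabs_Rabsolu, Rabs_mult, (Rabs_right (INR n)), (Rabs_right (r ^ n))
      by (try apply Rle_ge, pos_INR; lra).
    assert (0 <= Rabs (f n)) by apply Rabs_pos.
    replace (INR n * Rabs (f n) * r ^ n) with (Rabs (f n) * (INR n * r ^ n)) by ring.
    replace (/ x * (Rabs (f n) * s ^ n)) with (Rabs (f n) * (/ x * s ^ n)) by ring.
    apply Rmult_le_compat_l; auto.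
  - apply (ex_series_scal (K := R_AbsRing) (V := R_NormedModule)). apply H. lra.
Qed.

Lemma summ_partial f r : summ f -> 0 <= r < 1 ->
  exists M, forall m, sumL (seq 0 (S m)) (fun l => fabs f l * r ^ l) <= M.
Proof.
  intros H Hr. exists (Series (fun n => fabs f n * r ^ n)). intros m.
  assert (E : sumL (seq 0 (S m)) (fun l => fabs f l * r ^ l) = sum_n (fun n => fabs f n * r ^ n) m).
  { induction m as [|m IH]; [rewrite sum_O; simpl; ring|]. rewrite sumL_seq_S, IH, sum_Sn. reflexivity. }
  rewrite E. apply (is_lim_seq_incr_compare _ (Finite _) (Series_correct _ (H r Hr))).
  intros n. rewrite sum_Sn. unfold plus; simpl.
  assert (0 <= fabs f (S n) * (r * r ^ n)); [|lra].
  apply Rmult_le_pos; [apply Rabs_pos | apply (pow_le r (S n)); lra].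
Qed.

Lemma sumL_le {T} (l : list T) f g : (forall x, List.In x l -> f x <= g x) -> sumL l f <= sumL l g.
Proof.
  induction l as [|x l IH]; intros H; [apply Rle_refl|]. rewrite !sumL_cons. apply Rplus_le_compat.
  - apply H; left; auto.
  - apply IH; intros; apply H; right; auto.
Qed.

(** From n f_n = sum of L_i f_(n-i): once n exceeds the sum of the |L_i| r^i, the sequence
    |f_n| r^n is dominated by its earlier terms. *)
Lemma LD_summ f L : summ L -> LD f L -> summ f.
Proof.
  intros HL Hf. assert (L0 := LD_0 _ _ Hf). destruct Hf as [_ Hf].
  apply summ_pos. intros r Hr. set (s := (1 + r) / 2). assert (Hs : r < s < 1) by (unfold s; lra).
  destruct (summ_partial L s HL ltac:(lra)) as [Lam HLam].
  set (a := fun n => fabs f n * s ^ n).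
  assert (a0 : forall n, 0 <= a n) by (intros n; apply Rmult_le_pos; [apply Rabs_pos | apply pow_le; lra]).
  destruct (INR_unbounded Lam) as [N HN].
  assert (Mx : exists M, 0 <= M /\ forall l, (l <= N)%nat -> a l <= M).
  { clear HN. induction N as [|N [M [M0 HM]]].
    - exists (a O). split; auto. intros l Hl. replace l with O by lia. apply Rle_refl.
    - exists (Rmax M (a (S N))). split; [eapply Rle_trans; [exact M0 | apply Rmax_l]|].
      intros l Hl. destruct (Nat.eq_dec l (S N)) as [->|E]; [apply Rmax_r|].
      eapply Rle_trans; [apply HM; lia | apply Rmax_l]. }
  destruct Mx as [M [M0 HM]].
  assert (B : forall n, a n <= M).
  { intros n. induction n as [n IH] using (well_founded_induction lt_wf).
    destruct (Nat.le_gt_cases n N) as [Ln|Ln]; [auto|]. destruct n as [|m]; [lia|].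
    assert (E := f_equal (fun g : fps => g (S m)) Hf). cbv beta in E.
    rewrite fmul_Sr, L0, Rmult_0_r, Rplus_0_l in E. unfold fD in E.
    assert (E1 : INR (S m) * a (S m) <= M * Lam).
    { transitivity ((fabs (ftail L) * fabs f)%fp m * s ^ S m).
      - unfold a, fabs at 1. rewrite <- Rmult_assoc. apply Rmult_le_compat_r; [apply pow_le; lra|].
        rewrite <- (Rabs_right (INR (S m))) by (apply Rle_ge, pos_INR). rewrite <- Rabs_mult, E.
        rewrite fmul_comm_coef. apply fmul_abs.
      - rewrite fmul_sumL, Rmult_comm, <- sumL_scal.
        apply Rle_trans with (sumL (seq 0 (S m)) (fun l => M * (fabs L (S l) * s ^ S l))).
        + apply sumL_le. intros l Hl. apply in_seq in Hl.
          replace (s ^ S m) with (s ^ S l * s ^ (m - l)) by (rewrite <- pow_add; f_equal; lia).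
          replace (s ^ S l * s ^ (m - l) * (fabs (ftail L) l * fabs f (m - l)%nat))
            with (a (m - l)%nat * (fabs L (S l) * s ^ S l)) by (unfold a, fabs, ftail; ring).
          apply Rmult_le_compat_r; [|apply IH; lia].
          apply Rmult_le_pos; [apply Rabs_pos | apply pow_le; lra].
        + rewrite sumL_scal. apply Rmult_le_compat_l; auto.
          eapply Rle_trans; [|apply (HLam (S m))].
          change (seq 0 (S (S m))) with (O :: seq 1 (S m)). rewrite sumL_cons, <- seq_shift, sumL_map.
          assert (0 <= fabs L 0 * s ^ 0) by (apply Rmult_le_pos; [apply Rabs_pos | simpl; lra]). lra. }
    assert (mN : INR N < INR (S m)) by (apply lt_INR; lia).
    assert (m0 : 0 < INR (S m)) by (apply lt_0_INR; lia).
    apply (Rmult_le_reg_l (INR (S m))); auto. eapply Rle_trans; [exact E1|].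
    rewrite Rmult_comm. apply Rmult_le_compat_r; lra. }
  apply (ex_series_le (K := R_AbsRing) (V := R_CompleteNormedModule)) with (b := fun n => M * (r / s) ^ n).
  - intros n. change (norm (fabs f n * r ^ n)) with (Rabs (fabs f n * r ^ n)).
    rewrite Rabs_right by (apply Rle_ge, Rmult_le_pos; [apply Rabs_pos | apply pow_le; lra]).
    replace (r ^ n) with (s ^ n * (r / s) ^ n) by (rewrite <- Rpow_mult_distr; f_equal; field; lra).
    rewrite <- Rmult_assoc. apply Rmult_le_compat_r; [|apply B].
    apply pow_le. apply Rlt_le, Rdiv_lt_0_compat; lra.
  - apply (ex_series_scal (K := R_AbsRing) (V := R_NormedModule)). apply ex_series_geom.
    rewrite Rabs_right by (apply Rle_ge, Rlt_le, Rdiv_lt_0_compat; lra).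
    apply (Rmult_lt_reg_r s); [lra|]. unfold Rdiv. rewrite Rmult_assoc, Rinv_l; lra.
Qed.

(** sigma_1(n/r) is at most n^2, and the series of the n^2 is the second derivative of a geometric
    series. *)
Lemma summ_sigma r : summ (fC (INR r) * dil r (Sg INR))%fp.
Proof.
  apply summ_mul; [apply summ_C|]. apply (summ_le _ (fD (fD (geo 1)))).
  - apply summ_D, summ_D, (summ_bounded _ 1). intros n. unfold geo. rewrite Nat.mod_1_r. simpl.
    rewrite Rabs_R1. apply Rle_refl.
  - intros n. unfold fD, geo. rewrite Nat.mod_1_r. simpl. rewrite Rmult_1_r.
    assert (P := pos_INR n). unfold dil. destruct (n mod r =? 0)%nat; [|rewrite Rabs_R0; apply Rmult_le_pos; auto].
    assert (Hd : (n / r <= n)%nat) by (destruct r; [rewrite Nat.div_0_r; lia | apply Nat.Div0.div_le_upper_bound; nia]).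
    unfold Sg. rewrite Rabs_right.
    + apply Rle_trans with (sumL (divs (n / r)) (fun _ => INR n)).
      * apply sumL_le. intros d Hd'. apply le_INR. apply in_divs in Hd'. destruct Hd' as [_ [e [He E]]]. nia.
      * rewrite sumL_const. apply Rmult_le_compat_r; auto. apply le_INR.
        unfold divs. eapply Nat.le_trans; [apply filter_length_le|]. rewrite length_seq. exact Hd.
    + apply Rle_ge. rewrite <- (sumL_0 (divs (n / r)) (fun _ => 0)) by auto. apply sumL_le. intros; apply pos_INR.
Qed.

Lemma summ_euler r : (0 < r)%nat -> summ (euler r).
Proof.
  intros Hr. apply (LD_summ _ _) with (2 := LD_euler r Hr).
  replace (fC (- INR r)) with (fC (-1) * fC (INR r))%fp by (rewrite <- fC_mul; f_equal; ring).
  replace (fC (-1) * fC (INR r) * dil r (Sg INR))%fp with (fC (-1) * (fC (INR r) * dil r (Sg INR)))%fp by ring.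
  apply summ_mul; [apply summ_C | apply summ_sigma].
Qed.

(** The inverse is the generating series of partitions in q^r. It shows that the Euler product has
    no zero in the disc, and its coefficients majorise those of the partial products. *)
Lemma euler_inv r : (0 < r)%nat -> exists w, (euler r * w)%fp = fC 1 /\ summ w /\
  LD w (fC (INR r) * dil r (Sg INR))%fp.
Proof.
  intros Hr. destruct (finv_exists (euler r)) as [w Hw].
  { change (euler r O) with 1. lra. }
  assert (E : LD w (fC (INR r) * dil r (Sg INR))%fp).
  { eapply LD_ext; [eapply LD_inv; [apply (LD_euler r Hr) | exact Hw]|]. rewrite fC_opp. ring. }
  exists w. split; [exact Hw | split; [|exact E]]. eapply LD_summ; [apply summ_sigma | exact E].
Qed.

Lemma fmul_le f g f' g' n : (forall i, (i <= n)%nat -> 0 <= f i <= f' i) ->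
  (forall i, (i <= n)%nat -> 0 <= g i <= g' i) -> fmul f g n <= fmul f' g' n.
Proof.
  intros Hf Hg. rewrite !fmul_sumL. apply sumL_le. intros l Hl. apply in_seq in Hl.
  apply Rmult_le_compat; try apply Hf; try apply Hg; lia.
Qed.

(** By the recursion n f_n = sum of L_i f_(n-i), a bound on logarithmic derivatives passes to the
    series. *)
Lemma LD_dom f w L G : LD f L -> LD w G -> (forall i, Rabs (L i) <= G i) -> forall n, Rabs (f n) <= w n.
Proof.
  intros Hf Hw HG n. assert (L0 := LD_0 _ _ Hf). assert (G0 := LD_0 _ _ Hw).
  destruct Hf as [f0 Hf], Hw as [w0 Hw].
  induction n as [n IH] using (well_founded_induction lt_wf). destruct n as [|n].
  - rewrite f0, w0, Rabs_R1. apply Rle_refl.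
  - apply (f_equal (fun h : fps => h (S n))) in Hf, Hw.
    rewrite fmul_Sr, L0, Rmult_0_r, Rplus_0_l in Hf. rewrite fmul_Sr, G0, Rmult_0_r, Rplus_0_l in Hw.
    unfold fD in Hf, Hw. assert (m0 : 0 < INR (S n)) by (apply lt_0_INR; lia).
    apply (Rmult_le_reg_l (INR (S n))); auto. rewrite Hw.
    rewrite <- (Rabs_right (INR (S n))) by lra. rewrite <- Rabs_mult, Hf.
    eapply Rle_trans; [apply fmul_abs|]. apply fmul_le; intros i Hi; split; try apply Rabs_pos.
    + apply IH; lia.
    + apply HG.
Qed.

Lemma geoL_le_0 a i : geoL a i <= 0.
Proof. unfold geoL. destruct (_ && _)%bool; [assert (P := pos_INR a); lra | lra]. Qed.

(** All contributions to the logarithmic derivative have one sign, so cutting off factors only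
    decreases its absolute value; the bound is uniform in N. *)
Lemma eprod_dom r w N n : (0 < r)%nat -> LD w (fC (INR r) * dil r (Sg INR))%fp ->
  Rabs (eprod r N n) <= w n.
Proof.
  intros Hr Hw. eapply LD_dom; [apply LD_eprod; auto | exact Hw|]. intros i.
  set (M := (N + i)%nat). assert (E := geoL_sum r M i Hr ltac:(lia)).
  rewrite fmul_C. unfold fscal. replace (INR r * dil r (Sg INR) i) with (- - (INR r * dil r (Sg INR) i)) by ring.
  replace (- (INR r * dil r (Sg INR) i)) with (- INR r * dil r (Sg INR) i) by ring. rewrite <- E.
  unfold fsumL. unfold M. rewrite seq_app, sumL_app.
  assert (S1 : forall l : list nat, sumL l (fun m => geoL (r * m) i) <= 0).
  { intros l. induction l as [|x l IH]; [apply Rle_refl|]. rewrite sumL_cons. assert (P := geoL_le_0 (r * x) i). lra. }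
  assert (A1 := S1 (seq 1 N)). assert (A2 := S1 (seq (1 + N) i)).
  rewrite Rabs_left1 by exact A1. lra.
Qed.
Lemma euler_dom r w n : (0 < r)%nat -> LD w (fC (INR r) * dil r (Sg INR))%fp -> Rabs (euler r n) <= w n.
Proof. intros; apply eprod_dom; auto. Qed.

Fixpoint cprod (q : C) (r N : nat) : C :=
  match N with O => RtoC 1 | S M => (cprod q r M * (RtoC 1 - q ^ (r * S M)))%C end.

Lemma eprod_eval r q N : Cmod q < 1 -> summ (eprod r N) /\ evalsto (eprod r N) q (cprod q r N).
Proof.
  intros Hq. induction N as [|N [IH1 IH2]]; cbn [eprod cprod].
  - split; [apply summ_C | apply evalsto_C].
  - assert (E : (fC 1 - fX (r * S N) = fC 1 + fC (-1) * fX (r * S N))%fp) by ring. rewrite E.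
    assert (S1 : summ (fC 1 + fC (-1) * fX (r * S N))%fp).
    { apply summ_add; [apply summ_C | apply summ_mul; [apply summ_C | apply summ_X]]. }
    split; [apply summ_mul; auto|]. apply evalsto_mul; auto.
    replace (RtoC 1 - q ^ (r * S N))%C with (RtoC 1 + RtoC (-1) * q ^ (r * S N))%C by ring.
    apply evalsto_add; [apply evalsto_C|].
    apply evalsto_mul; auto using summ_C, summ_X, evalsto_C, evalsto_X.
Qed.

(** Partial product and limit agree through q^N, and beyond that both are dominated by w: they
    differ by at most twice a tail of the convergent series of w at |q|. *)
Lemma euler_limit r q l : (0 < r)%nat -> Cmod q < 1 -> evalsto (euler r) q l -> cv (cprod q r) l.
Proof.
  intros Hr Hq Hl. destruct (euler_inv r Hr) as [w [_ [Sw Lw]]].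
  set (p := Cmod q). assert (p0 : 0 <= p < 1) by (split; [apply Cmod_ge_0 | auto]).
  assert (w0 : forall n, 0 <= w n) by (intros n; eapply Rle_trans; [apply Rabs_pos | apply (euler_dom r w n Hr Lw)]).
  assert (fw : fabs w = w) by (apply fps_ext; intros n; apply Rabs_right, Rle_ge; auto).
  assert (LW := proj2 (rpev_series _ _ _) (Series_correct _ (Sw p p0))). rewrite fw in LW.
  set (W := Series (fun n => w n * p ^ n)) in *.
  assert (pn : forall n, 0 <= p ^ n) by (intros; apply pow_le; lra).
  assert (inc : forall n, rpev w p n <= W).
  { apply (is_lim_seq_incr_compare _ (Finite W) LW). intros n. rewrite rpev_last.
    assert (0 <= w (S n) * p ^ S n) by (apply Rmult_le_pos; auto). lra. }
  apply (cv_close (fun _ => l) _ l (fun N => 2 * (W - rpev w p N)) (cv_const l)).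
  - intros N. destruct (eprod_eval r q N Hq) as [_ EN].
    assert (K := evalsto_add _ _ _ _ _ EN (evalsto_mul _ _ _ _ _ (summ_C (-1)) (summ_euler r Hr) Hq (evalsto_C (-1) q) Hl)).
    replace (cprod q r N - l)%C with (cprod q r N + RtoC (-1) * l)%C by ring.
    apply (cv_le _ _ _ K). exists N. intros M HM.
    set (h := (eprod r N + fC (-1) * euler r)%fp).
    eapply Rle_trans; [apply pev_le|]. fold p. apply Rle_trans with (2 * (rpev w p M - rpev w p N)); [|assert (I := inc M); lra].
    assert (hn : forall n, h n = eprod r N n - euler r n)
      by (intros n; unfold h; rewrite fmul_C; unfold fadd, fscal; ring).
    induction HM as [|M HM IH].
    + rewrite Rminus_diag, Rmult_0_r. right.
      assert (Z : forall g : fps, (forall n, (n <= N)%nat -> g n = 0) -> rpev g p N = 0).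
      { clear. intros g Hg. revert g Hg. induction N as [|N IH]; intros g Hg; cbn [rpev]; [apply Hg; lia|].
        rewrite IH; [rewrite Hg by lia; ring|]. intros n Hn. apply Hg. lia. }
      apply Z. intros n Hn. unfold fabs. rewrite hn, (euler_eqm r N Hr n) by lia. rewrite Rminus_diag. apply Rabs_R0.
    + rewrite !rpev_last.
      assert (fabs h (S M) * p ^ S M <= 2 * w (S M) * p ^ S M); [|lra].
      apply Rmult_le_compat_r; auto. unfold fabs. rewrite hn. unfold Rminus.
      eapply Rle_trans; [apply Rabs_triang|]. rewrite Rabs_Ropp.
      assert (A1 := eprod_dom r w N (S M) Hr Lw). assert (A2 := euler_dom r w (S M) Hr Lw). lra.
  - assert (L2 := is_lim_seq_minus' _ _ _ _ (is_lim_seq_const W) LW).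
    assert (L3 := is_lim_seq_mult' _ _ _ _ (is_lim_seq_const 2) L2).
    rewrite Rminus_diag, Rmult_0_r in L3. exact L3.
Qed.

(** * The eta function *)

Lemma Cexp_add a b : Cexp (a + b)%C = (Cexp a * Cexp b)%C.
Proof.
  unfold Cexp. destruct a as [x y], b as [x' y']. unfold Cplus, Cmult, Re, Im; simpl.
  rewrite exp_plus, cos_plus, sin_plus. f_equal; ring.
Qed.
Lemma Cexp_0 : Cexp 0 = RtoC 1.
Proof. unfold Cexp, RtoC, Re, Im; simpl. rewrite exp_0, cos_0, sin_0. f_equal; ring. Qed.
Lemma Cexp_nat n z : Cexp (RtoC (INR n) * z)%C = (Cexp z ^ n)%C.
Proof.
  induction n as [|n IH].
  - simpl INR. replace (RtoC 0 * z)%C with (RtoC 0) by ring. apply Cexp_0.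
  - rewrite S_INR, RtoC_plus. replace ((RtoC (INR n) + 1) * z)%C with (RtoC (INR n) * z + z)%C by ring.
    rewrite Cexp_add, IH. simpl. ring.
Qed.
Lemma Cmod_Cexp z : Cmod (Cexp z) = exp (Re z).
Proof.
  unfold Cexp, Cmod; simpl. set (x := Re z). set (y := Im z).
  replace (exp x * cos y * (exp x * cos y * 1) + exp x * sin y * (exp x * sin y * 1))
    with (exp x * exp x * ((sin y)² + (cos y)²)) by (unfold Rsqr; ring).
  rewrite sin2_cos2, Rmult_1_r. apply sqrt_square. apply Rlt_le, exp_pos.
Qed.
Lemma Cexp_neq_0 z : Cexp z <> RtoC 0.
Proof. intros E. assert (K := Cmod_Cexp z). rewrite E, Cmod_0 in K. assert (P := exp_pos (Re z)). lra. Qed.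

Definition nome (z : C) : C := Cexp (2 * PI * Ci * z)%C.

Lemma nome_lt_1 z : 0 < Im z -> Cmod (nome z) < 1.
Proof.
  intros H. unfold nome. rewrite Cmod_Cexp. rewrite <- exp_0. apply exp_increasing.
  destruct z as [x y]. unfold Ci, Cmult, RtoC, Re, Im in *; simpl in *.
  assert (P := PI_RGT_0). assert (0 < PI * y) by (apply Rmult_lt_0_compat; auto). lra.
Qed.

(** [Clim_seq] is meaningful only for a convergent product, which [euler_limit] supplies; the
    exponential prefactor at rz is the r-th power of that at z. *)
Lemma eta_value r z l : (0 < r)%nat -> 0 < Im z -> evalsto (euler r) (nome z) l ->
  eta (RtoC (INR r) * z)%C = (Cexp (PI * Ci * z / 12) ^ r * l)%C.
Proof.
  intros Hr Hz Hl. unfold eta. f_equal.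
  - rewrite <- Cexp_nat. f_equal. unfold Cdiv. ring.
  - apply Clim_seq_cv. eapply cv_ext; [|apply (euler_limit r (nome z) l Hr (nome_lt_1 z Hz) Hl)].
    intros N. induction N as [|N IH]; [reflexivity|]. cbn [cprod eta_partial]. rewrite IH. f_equal. f_equal.
    f_equal. unfold nome. rewrite <- Cexp_nat, mult_INR, RtoC_mult. f_equal. ring.
Qed.

(** * Coefficients are determined by the sum of the series *)

(** Terms bounded by M at s = rho/2 force the partial sums at small x to lie within 2 M x/s of d_0,
    while they tend to 0. *)
Lemma zero_series_0 (d : fps) rho : 0 < rho ->
  (forall x, 0 < x < rho -> is_lim_seq (rpev d x) 0) -> d O = 0.
Proof.
  intros Hr H. set (s := rho / 2). assert (Hs : 0 < s < rho) by (unfold s; lra).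
  assert (L := ex_series_lim_0 _ (ex_intro _ 0 (proj1 (rpev_series d s 0) (H s Hs)))).
  assert (Bd : exists M, 0 < M /\ forall n, Rabs (d n * s ^ n) <= M).
  { apply is_lim_seq_spec in L. destruct (L (mkposreal 1 Rlt_0_1)) as [N HN]. simpl in HN. clear H L.
    assert (K : exists M, 0 < M /\ forall n, (n < N)%nat -> Rabs (d n * s ^ n) <= M).
    { clear HN. induction N as [|N [M [M0 HM]]]; [exists 1; split; [lra | intros; lia]|].
      exists (Rmax M (Rabs (d N * s ^ N))). split; [eapply Rlt_le_trans; [exact M0 | apply Rmax_l]|].
      intros n Hn. destruct (Nat.eq_dec n N) as [->|E]; [apply Rmax_r|].
      eapply Rle_trans; [apply HM; lia | apply Rmax_l]. }
    destruct K as [M [M0 HM]]. exists (Rmax M 1). split; [eapply Rlt_le_trans; [exact M0 | apply Rmax_l]|].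
    intros n. destruct (Nat.le_gt_cases N n) as [Ln|Ln].
    - specialize (HN n Ln). rewrite Rminus_0_r in HN. eapply Rle_trans; [|apply Rmax_r]. lra.
    - eapply Rle_trans; [apply HM; auto | apply Rmax_l]. }
  destruct Bd as [M [M0 HM]].
  (* The bound is sharpened by -2 (x/s)^N so that the induction on N closes; this uses x/s <=
     1/2. *)
  assert (T : forall x N, 0 < x <= s / 2 -> Rabs (rpev d x N - d O) <= M * (x / s) * (2 - 2 * (x / s) ^ N)).
  { intros x N Hx. assert (y0 : 0 < x / s <= 1 / 2).
    { split; [apply Rdiv_lt_0_compat; lra|]. apply (Rmult_le_reg_r s); [lra|]. unfold Rdiv.
      rewrite Rmult_assoc, Rinv_l; lra. }
    set (y := x / s) in *. assert (Ex : x = y * s) by (unfold y; field; lra).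
    induction N as [|N IH].
    - simpl. rewrite Rminus_diag, Rabs_R0. nra.
    - rewrite rpev_last. replace (rpev d x N + d (S N) * x ^ S N - d O) with ((rpev d x N - d O) + d (S N) * x ^ S N) by ring.
      eapply Rle_trans; [apply Rabs_triang|].
      assert (B : Rabs (d (S N) * x ^ S N) <= M * y ^ S N).
      { rewrite Ex, Rpow_mult_distr. replace (d (S N) * (y ^ S N * s ^ S N)) with ((d (S N) * s ^ S N) * y ^ S N) by ring.
        rewrite Rabs_mult, (Rabs_right (y ^ S N)) by (apply Rle_ge, pow_le; lra).
        apply Rmult_le_compat_r; [apply pow_le; lra | apply HM]. }
      assert (yN : 0 < y ^ N) by (apply pow_lt; lra). simpl pow in *.
      assert (0 <= M * (y * y ^ N) * (1 - 2 * y)).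
      { apply Rmult_le_pos; [|lra]. apply Rmult_le_pos; [lra|]. apply Rmult_le_pos; lra. }
      lra. }
  destruct (Req_dec (d O) 0) as [E|E]; [exact E|exfalso].
  assert (D0 : 0 < Rabs (d O)) by (apply Rabs_pos_lt; auto).
  (* This x makes the bound at most |d_0|/2; a partial sum below |d_0|/4 then contradicts the
     triangle inequality. *)
  set (x := Rmin (s / 2) (s * (Rabs (d O) / (4 * M)))).
  assert (Hx : 0 < x <= s / 2).
  { split; [|apply Rmin_l]. apply Rmin_glb_lt; [lra|]. apply Rmult_lt_0_compat; [lra|]. apply Rdiv_lt_0_compat; lra. }
  assert (Hx2 : x / s <= Rabs (d O) / (4 * M)).
  { apply (Rmult_le_reg_r s); [lra|]. unfold Rdiv at 1. rewrite Rmult_assoc, Rinv_l, Rmult_1_r by lra.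
    rewrite Rmult_comm. apply Rmin_r. }
  assert (Lx := H x ltac:(lra)). apply is_lim_seq_spec in Lx.
  destruct (Lx (mkposreal (Rabs (d O) / 4) ltac:(lra))) as [N HN]. simpl in HN.
  specialize (HN N (le_n _)). rewrite Rminus_0_r in HN. specialize (T x N Hx).
  assert (y0 : 0 < x / s) by (apply Rdiv_lt_0_compat; lra).
  assert (yN : 0 < (x / s) ^ N) by (apply pow_lt; auto).
  assert (M * (x / s) * (2 - 2 * (x / s) ^ N) <= Rabs (d O) / 2).
  { apply Rle_trans with (M * (Rabs (d O) / (4 * M)) * 2).
    - apply Rle_trans with (M * (x / s) * 2).
      + apply Rmult_le_compat_l; [apply Rmult_le_pos; lra | lra].
      + apply Rmult_le_compat_r; [lra|]. apply Rmult_le_compat_l; lra.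
    - right. field. lra. }
  assert (Tr := Rabs_triang (- (rpev d x N - d O)) (rpev d x N)). rewrite Rabs_Ropp in Tr.
  replace (- (rpev d x N - d O) + rpev d x N) with (d O) in Tr by ring. lra.
Qed.

Lemma zero_series (d : fps) rho : 0 < rho ->
  (forall x, 0 < x < rho -> is_lim_seq (rpev d x) 0) -> forall n, d n = 0.
Proof.
  intros Hr H n. revert d H. induction n as [|n IH]; intros d H; [eapply zero_series_0; eauto|].
  assert (d0 := zero_series_0 d rho Hr H). apply (IH (ftail d)). intros x Hx.
  assert (K := is_lim_seq_scal_l _ (/ x) _ (proj1 (is_lim_seq_incr_1 _ _) (H x Hx))).
  simpl in K. rewrite Rmult_0_r in K. eapply is_lim_seq_ext; [|exact K].
  intros m. cbn [rpev]. rewrite d0. field. lra.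
Qed.

(** * The defining series of the Bernoulli numbers *)

(** The recursion bounds (n + 2) |b_(n+1)| by n products and one term below 1. Radius 1 falls short
    of the true 2 pi but suffices for [is_bernoulli]. *)
Lemma bev_bound beta n : is_beta beta -> Rabs (bev beta n) <= 1.
Proof.
  intros H. induction n as [n IH] using (well_founded_induction lt_wf). destruct n as [|n].
  - rewrite bev_0, Rabs_R1 by auto. apply Rle_refl.
  - assert (E := bev_rec beta n H). assert (P := pos_INR n).
    assert (S1 : forall l, (forall i, List.In i l -> (1 <= i <= n)%nat) ->
      Rabs (sumL l (fun l => bev beta l * bev beta (S n - l)%nat)) <= INR (length l)).
    { intros l. induction l as [|x l IHl]; intros Hl; [simpl; rewrite Rabs_R0; apply Rle_refl|].
      rewrite sumL_cons. cbn [length]. rewrite S_INR. eapply Rle_trans; [apply Rabs_triang|].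
      rewrite Rabs_mult. assert (Hx := Hl x (or_introl eq_refl)).
      assert (A1 := IH x ltac:(lia)). assert (A2 := IH (S n - x)%nat ltac:(lia)).
      assert (Rabs (bev beta x) * Rabs (bev beta (S n - x)%nat) <= 1 * 1).
      { apply Rmult_le_compat; auto; apply Rabs_pos. }
      assert (Rabs (sumL l (fun l => bev beta l * bev beta (S n - l)%nat)) <= INR (length l)); [|lra].
      apply IHl. intros i Hi; apply Hl; right; auto. }
    specialize (S1 (seq 1 n) ltac:(intros i Hi; apply in_seq in Hi; lia)). rewrite length_seq in S1.
    apply (Rmult_le_reg_l (INR n + 2)); [lra|].
    rewrite <- (Rabs_right (INR n + 2)) at 1 by lra. rewrite <- Rabs_mult, E. unfold Rminus.
    eapply Rle_trans; [apply Rabs_triang|]. rewrite Rabs_Ropp.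
    assert (Rabs (if (n =? 1)%nat then 1 / 4 else 0) <= 1); [|lra].
    destruct (n =? 1)%nat; [rewrite Rabs_right; lra | rewrite Rabs_R0; lra].
Qed.

Lemma summ_beta beta : is_beta beta -> summ beta.
Proof.
  intros H. replace beta with (bev beta + fC (-1) * (fC (1/2) * fX 1))%fp by (unfold bev; ring).
  apply summ_add; [apply (summ_bounded _ 1); intros; apply bev_bound; auto|].
  repeat apply summ_mul; try apply summ_C; apply summ_X.
Qed.

Lemma fexp_evalsto x : evalsto (fexp 1) (RtoC x) (RtoC (exp x)).
Proof.
  eapply cv_ext; [intros n; symmetry; apply pev_RtoC|]. apply cv_R. apply rpev_series.
  eapply is_series_ext; [|exact (is_exp_Reals x)]. intros n. unfold fexp. rewrite pow1, pow_n_pow.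
  unfold scal; simpl. unfold mult; simpl. unfold Rdiv. ring.
Qed.

Lemma bernoulli_is beta : is_beta beta -> is_bernoulli (fun n => INR (fact n) * beta n).
Proof.
  intros H. exists 1. split; [lra|]. intros x x0 Hx.
  assert (Hq : Cmod (RtoC x) < 1) by (rewrite Cmod_R; auto).
  assert (S1 : summ (fexp1 1)).
  { apply (summ_bounded _ 1). intros n. unfold fexp1. rewrite pow1. unfold Rdiv. rewrite Rmult_1_l.
    assert (1 <= INR (fact (S n))) by (apply (le_INR 1), lt_O_fact).
    rewrite Rabs_right; [rewrite <- Rinv_1; apply Rinv_le_contravar; lra|].
    apply Rle_ge, Rlt_le, Rinv_0_lt_compat. lra. }
  destruct (evalsto_exists (fexp1 1) (RtoC x) S1 Hq) as [l Hl].
  destruct (evalsto_exists beta (RtoC x) (summ_beta beta H) Hq) as [b Hb].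
  assert (E1 : (RtoC x * l = RtoC (exp x) + RtoC (-1) * RtoC 1)%C).
  { assert (K1 := evalsto_mul _ _ _ _ _ (summ_X 1) S1 Hq (evalsto_X 1 (RtoC x)) Hl).
    assert (K2 := evalsto_add _ _ _ _ _ (fexp_evalsto x)
      (evalsto_mul _ _ _ _ _ (summ_C (-1)) (summ_C 1) Hq (evalsto_C (-1) _) (evalsto_C 1 _))).
    rewrite fexp1_X in K1. replace (fexp 1 + fC (-1) * fC 1)%fp with (fexp 1 - fC 1)%fp in K2 by ring.
    assert (K3 := cv_unique _ _ _ K1 K2). rewrite <- K3. simpl. ring. }
  assert (E2 : (l * b = RtoC 1)%C).
  { assert (K := evalsto_mul _ _ _ _ _ S1 (summ_beta beta H) Hq Hl Hb). unfold is_beta in H. rewrite H in K.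
    exact (cv_unique _ _ _ K (evalsto_C 1 _)). }
  assert (ne : exp x - 1 <> 0).
  { intros E. apply x0. apply exp_inv. rewrite exp_0. lra. }
  assert (Eb : b = RtoC (x / (exp x - 1))).
  { replace b with (RtoC x * l * b / RtoC (exp x - 1))%C.
    - replace (RtoC x * l * b)%C with (RtoC x * (l * b))%C by ring. rewrite E2, RtoC_div by auto. unfold Cdiv. ring.
    - rewrite E1. rewrite RtoC_minus.
      replace (RtoC (exp x) + RtoC (-1) * RtoC 1)%C with (RtoC (exp x) - RtoC 1)%C by ring. field.
      intros E. change (RtoC (exp x) - RtoC 1 = RtoC 0)%C in E. rewrite <- RtoC_minus in E. apply ne. apply RtoC_inj in E. exact E. }
  rewrite Eb in Hb.
  assert (K := cv_Re _ _ Hb). simpl Re in K.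
  apply (is_lim_seq_ext _ (rpev beta x)) in K; [|intros n; rewrite pev_RtoC; reflexivity].
  apply rpev_series in K. eapply is_series_ext; [|exact K]. intros n. cbv beta.
  match goal with |- @eq _ ?y ?z => change (@eq R y z) end. field. apply fact_neq.
Qed.

(** [bernoulli_is] guarantees that the choice satisfies the specification; on the smaller of the two
    radii both series have the same sum, hence the same coefficients. *)
Lemma bernoulli_value beta n : is_beta beta -> bernoulli n = INR (fact n) * beta n.
Proof.
  intros H. assert (Hb := bernoulli_is beta H).
  assert (He : is_bernoulli bernoulli) by (unfold bernoulli; apply epsilon_spec; eexists; exact Hb).
  destruct He as [r1 [P1 He]]. destruct Hb as [r2 [P2 Hb]].
  set (d := fun n => bernoulli n / INR (fact n) - beta n).
  assert (Z : d n = 0).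
  { apply (zero_series d (Rmin r1 r2)); [apply Rmin_glb_lt; auto|]. intros x Hx.
    assert (x < r1) by (eapply Rlt_le_trans; [apply Hx | apply Rmin_l]).
    assert (x < r2) by (eapply Rlt_le_trans; [apply Hx | apply Rmin_r]).
    assert (K1 := He x ltac:(lra) ltac:(rewrite Rabs_right; lra)).
    assert (K2 := Hb x ltac:(lra) ltac:(rewrite Rabs_right; lra)).
    assert (K := is_series_minus _ _ _ _ K1 K2). apply rpev_series.
    unfold minus, plus, opp in K. simpl in K. rewrite Rplus_opp_r in K.
    eapply is_series_ext; [|exact K]. intros m. cbv beta. unfold d.
    match goal with |- @eq _ ?y ?z => change (@eq R y z) end. field. apply fact_neq. }
  unfold d in Z. assert (F := fact_neq n). replace (bernoulli n) with (bernoulli n / INR (fact n) * INR (fact n)) by (field; auto).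
  replace (bernoulli n / INR (fact n)) with (beta n) by lra. ring.
Qed.

(** * The q-expansion of the basic cusp forms *)

Lemma Cpowz_nat x n : Cpowz x (Z.of_nat n) = (x ^ n)%C.
Proof.
  destruct n as [|n]; [reflexivity|]. cbn [Z.of_nat Cpowz]. rewrite SuccNat2Pos.id_succ. reflexivity.
Qed.

Lemma quotient_eq f g h w : (g * w)%fp = fC 1 -> (f * g)%fp = h -> f = (h * w)%fp.
Proof.
  intros Hw <-. replace (f * g * w)%fp with (f * (g * w))%fp by ring. rewrite Hw. ring.
Qed.

Ltac eval_tac :=
  repeat match goal with
  | |- evalsto (_ * _)%fp _ _ => apply evalsto_mul
  | |- evalsto (_ ^ _)%fp _ _ => apply evalsto_pow
  | |- summ (_ * _)%fp => apply summ_mul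
  | |- summ (_ ^ _)%fp => apply summ_pow
  | _ => assumption
  end.

(** Summability of A, u and pre(t) is read off from their eta quotients, since Euler products and
    their inverses are summable; the identities between series then become identities between
    values. *)
Lemma Cjk_eval A u t B j k z : uniformization A u t B -> 0 < Im z ->
  summ (pre t * u ^ j * A ^ (2 * k))%fp /\ exists H, evalsto (pre t * u ^ j * A ^ (2 * k))%fp (nome z) H /\
  Cjk (Z.of_nat j) (2 * Z.of_nat k) z = (nome z ^ j * H)%C.
Proof.
  intros U Hz. set (q := nome z). assert (Hq : Cmod q < 1) by (apply nome_lt_1; auto).
  destruct (euler_inv 1 ltac:(lia)) as [w1 [W1 [S1 _]]]. destruct (euler_inv 2 ltac:(lia)) as [w2 [W2 [S2 _]]].
  destruct (euler_inv 3 ltac:(lia)) as [w3 [W3 [S3 _]]]. destruct (euler_inv 4 ltac:(lia)) as [w4 [W4 [S4 _]]].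
  destruct (euler_inv 6 ltac:(lia)) as [w6 [W6 [S6 _]]]. destruct (euler_inv 12 ltac:(lia)) as [w12 [W12 [S12 _]]].
  assert (T1 := summ_euler 1 ltac:(lia)). assert (T2 := summ_euler 2 ltac:(lia)).
  assert (T3 := summ_euler 3 ltac:(lia)). assert (T4 := summ_euler 4 ltac:(lia)).
  assert (T6 := summ_euler 6 ltac:(lia)). assert (T12 := summ_euler 12 ltac:(lia)).
  assert (SA : summ A).
  { rewrite (quotient_eq A _ _ (w2 ^ 3 * w3 ^ 2)%fp) with (2 := un_A _ _ _ _ U).
    - eval_tac.
    - transitivity ((euler 2 * w2) ^ 3 * (euler 3 * w3) ^ 2)%fp; [ring | rewrite W2, W3; ring]. }
  assert (Su : summ u).
  { rewrite (quotient_eq u _ _ (w1 ^ 3 * w4 * w6 ^ 2)%fp) with (2 := un_u _ _ _ _ U).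
    - eval_tac.
    - transitivity ((euler 1 * w1) ^ 3 * (euler 4 * w4) * (euler 6 * w6) ^ 2)%fp; [ring | rewrite W1, W4, W6; ring]. }
  assert (Sp : summ (pre t)).
  { rewrite (quotient_eq (pre t) _ _ (w1 ^ 15 * w12 ^ 3)%fp) with (2 := un_pre _ _ _ _ U).
    - eval_tac.
    - transitivity ((euler 1 * w1) ^ 15 * (euler 12 * w12) ^ 3)%fp; [ring | rewrite W1, W12; ring]. }
  split; [eval_tac|].
  destruct (evalsto_exists A q SA Hq) as [a Ha]. destruct (evalsto_exists u q Su Hq) as [v Hv].
  destruct (evalsto_exists (pre t) q Sp Hq) as [p Hp].
  exists (p * v ^ j * a ^ (2 * k))%C.
  split; [eval_tac|].
  (* Values of Euler products are nonzero because the inverse series converges as well; this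
     justifies the divisions in C_(j,k). *)
  assert (NZ : forall r w e, (euler r * w)%fp = fC 1 -> summ (euler r) -> summ w -> evalsto (euler r) q e -> e <> RtoC 0).
  { intros r w e Hw Hs Hs' He E. destruct (evalsto_exists w q Hs' Hq) as [m Hm].
    assert (K := evalsto_mul _ _ _ _ _ Hs Hs' Hq He Hm). rewrite Hw in K.
    assert (K2 := cv_unique _ _ _ K (evalsto_C 1 q)). rewrite E in K2.
    replace (RtoC 0 * m)%C with (RtoC 0) in K2 by ring. apply RtoC_inj in K2. lra. }
  destruct (evalsto_exists _ q T1 Hq) as [e1 H1]. destruct (evalsto_exists _ q T2 Hq) as [e2 H2].
  destruct (evalsto_exists _ q T3 Hq) as [e3 H3]. destruct (evalsto_exists _ q T4 Hq) as [e4 H4].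
  destruct (evalsto_exists _ q T6 Hq) as [e6 H6]. destruct (evalsto_exists _ q T12 Hq) as [e12 H12].
  assert (N1 := NZ _ _ _ W1 T1 S1 H1). assert (N2 := NZ _ _ _ W2 T2 S2 H2). assert (N3 := NZ _ _ _ W3 T3 S3 H3).
  assert (N4 := NZ _ _ _ W4 T4 S4 H4). assert (N6 := NZ _ _ _ W6 T6 S6 H6). assert (N12 := NZ _ _ _ W12 T12 S12 H12).
  assert (EqE : forall f g l m, f = g -> evalsto f q l -> evalsto g q m -> l = m)
    by (intros f g l m <- K1 K2; exact (cv_unique _ _ _ K1 K2)).
  assert (EA : (a * (e2 ^ 3 * e3 ^ 2) = e1 ^ 6 * e6)%C).
  { apply (EqE _ _ _ _ (un_A _ _ _ _ U));
      eval_tac. }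
  assert (Eu : (v * (e1 ^ 3 * e4 * e6 ^ 2) = e2 ^ 2 * e3 * e12 ^ 3)%C).
  { apply (EqE _ _ _ _ (un_u _ _ _ _ U));
      eval_tac. }
  assert (Ep : (p * (e1 ^ 15 * e12 ^ 3) = e2 ^ 10 * e3 ^ 5 * e4 * e6 ^ 2)%C).
  { apply (EqE _ _ _ _ (un_pre _ _ _ _ U));
      eval_tac. }
  set (X := Cexp (PI * Ci * z / 12)). assert (X0 : X <> RtoC 0) by apply Cexp_neq_0.
  (* The prefactors cancel in the first and third bracket and leave X^24 = q in the second, the
     source of q^j. *)
  assert (Xq : (X ^ 24)%C = q).
  { unfold X, q, nome. rewrite <- Cexp_nat. f_equal. rewrite INR_IZR_INZ. simpl Z.of_nat. field. }
  assert (V1 := eta_value 1 z e1 ltac:(lia) Hz H1). assert (V2 := eta_value 2 z e2 ltac:(lia) Hz H2).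
  assert (V3 := eta_value 3 z e3 ltac:(lia) Hz H3). assert (V4 := eta_value 4 z e4 ltac:(lia) Hz H4).
  assert (V6 := eta_value 6 z e6 ltac:(lia) Hz H6). assert (V12 := eta_value 12 z e12 ltac:(lia) Hz H12).
  rewrite INR_IZR_INZ in V1, V2, V3, V4, V6, V12. simpl Z.of_nat in *.
  replace (1 * z)%C with z in V1 by ring. fold X in V1, V2, V3, V4, V6, V12.
  unfold Cjk. rewrite V1, V2, V3, V4, V6, V12.
  replace (2 * Z.of_nat k)%Z with (Z.of_nat (2 * k)) by lia. rewrite !Cpowz_nat.
  assert (Qp : p = (e2 ^ 10 * e3 ^ 5 * e4 * e6 ^ 2 / (e1 ^ 15 * e12 ^ 3))%C) by (rewrite <- Ep; field; auto).
  assert (Qv : v = (e2 ^ 2 * e3 * e12 ^ 3 / (e1 ^ 3 * e4 * e6 ^ 2))%C) by (rewrite <- Eu; field; auto).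
  assert (Qa : a = (e1 ^ 6 * e6 / (e2 ^ 3 * e3 ^ 2))%C) by (rewrite <- EA; field; auto).
  match goal with |- (?P * ?V ^ _ * ?W ^ _)%C = _ =>
    replace P with p by (rewrite Qp; field; auto);
    replace V with (q * v)%C by (rewrite Qv, <- Xq; field; auto);
    replace W with a by (rewrite Qa; field; auto) end.
  rewrite Cpow_mult_l. ring.
Qed.

Lemma nome_surj x : 0 < x < 1 -> exists z, 0 < Im z /\ nome z = RtoC x.
Proof.
  intros Hx. assert (P := PI_RGT_0). exists (0, - ln x / (2 * PI)). split.
  - simpl. apply Rdiv_lt_0_compat; [|lra]. rewrite <- Ropp_0. apply Ropp_lt_contravar.
    rewrite <- ln_1. apply ln_increasing; lra.
  - unfold nome, Cexp, Ci, Cmult, RtoC, Re, Im; simpl.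
    match goal with |- (exp ?a * cos ?b, exp ?a * sin ?b) = _ =>
      replace a with (ln x) by (field; lra); replace b with 0 by (field; lra) end.
    rewrite cos_0, sin_0, exp_ln by lra. f_equal; ring.
Qed.

Lemma cform_shift A u t k j : t = (fX 1 * u)%fp -> cform A t k j = (fX j * (pre t * u ^ j * A ^ k))%fp.
Proof.
  intros E. unfold cform. rewrite E at 2. rewrite fpow_mull, fX_pow, Nat.mul_1_l. ring.
Qed.

(** [Cjk_eval] exhibits an expansion, so the choice is one too. Uniqueness is tested at real nomes 0
    < x < 1, where real and imaginary parts of the difference are real power series with sum 0. *)
Lemma cjk_value A u t B j k n : uniformization A u t B ->
  cjk (Z.of_nat j) (2 * Z.of_nat k) (Z.of_nat n) = RtoC (cform A t (2 * k) j n).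
Proof.
  intros U. set (h := (pre t * u ^ j * A ^ (2 * k))%fp).
  set (F := Cjk (Z.of_nat j) (2 * Z.of_nat k)).
  assert (Main : forall z, 0 < Im z -> exists H, evalsto h (nome z) H /\ F z = (nome z ^ j * H)%C)
    by (intros z Hz; apply (Cjk_eval A u t B j k z U Hz)).
  assert (Ch := cform_shift A u t (2 * k) j (un_t _ _ _ _ U)). fold h in Ch. rewrite Ch, fX_mul.
  assert (Ex : exists c, is_q_expansion F (Z.of_nat j) c).
  { exists (fun m => if (m <? Z.of_nat j)%Z then RtoC 0 else RtoC (h (Z.to_nat (m - Z.of_nat j)))). split.
    - intros m Hm. destruct (Z.ltb_spec m (Z.of_nat j)); [reflexivity | lia].
    - intros z Hz. destruct (Main z Hz) as [H [E1 E2]]. rewrite E2. apply is_series_cv.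
      refine (cv_ext _ _ _ _ (cv_mult _ _ _ _ (cv_const (nome z ^ j)%C) E1)).
      assert (Tm : forall m, ((if (Z.of_nat j + Z.of_nat m <? Z.of_nat j)%Z then RtoC 0
          else RtoC (h (Z.to_nat (Z.of_nat j + Z.of_nat m - Z.of_nat j)))) *
          Cpowz (nome z) (Z.of_nat j + Z.of_nat m))%C = (RtoC (h m) * (nome z ^ j * nome z ^ m))%C).
      { intros m. destruct (Z.ltb_spec (Z.of_nat j + Z.of_nat m) (Z.of_nat j)); [lia|].
        rewrite <- Nat2Z.inj_add, Cpowz_nat, Cpow_add_r.
        replace (Z.to_nat (Z.of_nat (j + m) - Z.of_nat j)) with m by lia. reflexivity. }
      intros N. induction N as [|N IH].
      + rewrite sum_O. cbv zeta. fold (nome z). rewrite Tm. simpl. ring.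
      + rewrite sum_Sn, <- IH, pev_last. cbv zeta. fold (nome z). rewrite Tm.
        change plus with Cplus. simpl. ring. }
  assert (Sp : is_q_expansion F (Z.of_nat j) (cjk (Z.of_nat j) (2 * Z.of_nat k))).
  { unfold cjk. apply epsilon_spec. exact Ex. }
  destruct Sp as [Sp1 Sp2]. set (c := cjk (Z.of_nat j) (2 * Z.of_nat k)) in *.
  destruct (Nat.ltb_spec n j) as [Ln|Ln]; [apply Sp1; lia|].
  set (d := fun m => (c (Z.of_nat j + Z.of_nat m)%Z - RtoC (h m))%C).
  assert (Z0 : forall x, 0 < x < 1 -> cv (fun N => sum_n (G := C_AbelianMonoid) (fun m => (d m * RtoC x ^ m)%C) N) (RtoC 0)).
  { intros x Hx. destruct (nome_surj x Hx) as [z [Hz Ez]]. destruct (Main z Hz) as [H [E1 E2]].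
    assert (K := proj1 (is_series_cv _ _) (Sp2 z Hz)). cbv zeta in K. rewrite E2, Ez in K. rewrite Ez in E1.
    assert (x0 : RtoC x <> RtoC 0) by (intros E; apply RtoC_inj in E; lra).
    assert (xj : (RtoC x ^ j)%C <> RtoC 0) by (apply Cpow_nz; auto).
    assert (K2 := cv_plus _ _ _ _ (cv_mult _ _ _ _ (cv_const (/ (RtoC x ^ j))%C) K) (cv_mult _ _ _ _ (cv_const (RtoC (-1))) E1)).
    replace (/ RtoC x ^ j * (RtoC x ^ j * H) + RtoC (-1) * H)%C with (RtoC 0) in K2 by (field; auto).
    refine (cv_ext _ _ _ _ K2).
    assert (Tm : forall m, (c (Z.of_nat j + Z.of_nat m)%Z * Cpowz (Cexp (2 * PI * Ci * z)) (Z.of_nat j + Z.of_nat m))%C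
              = (RtoC x ^ j * (c (Z.of_nat j + Z.of_nat m)%Z * RtoC x ^ m))%C).
    { intros m. fold (nome z). rewrite Ez, <- Nat2Z.inj_add, Cpowz_nat, Cpow_add_r. ring. }
    intros N. induction N as [|N IH].
    - rewrite !sum_O. rewrite Tm. unfold d. simpl. field. auto.
    - rewrite !sum_Sn, <- IH, pev_last, Tm. change plus with Cplus. unfold d. field. auto. }
  assert (part : forall p : C -> R, (forall a b, p (a + b)%C = p a + p b) -> (forall a y, p (a * RtoC y)%C = p a * y) ->
    (forall w l, cv w l -> is_lim_seq (fun n => p (w n)) (Finite (p l))) -> p (RtoC 0) = 0 -> forall m, p (d m) = 0).
  { intros p Pa Pm Pc P0. apply (zero_series (fun m => p (d m)) 1); [lra|]. intros x Hx.
    assert (K := Pc _ _ (Z0 x Hx)). rewrite P0 in K. eapply is_lim_seq_ext; [|exact K].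
    intros N. cbv beta. induction N as [|N IH].
    - rewrite sum_O. simpl. replace (d O * 1)%C with (d O) by ring. reflexivity.
    - rewrite sum_Sn, rpev_last, <- IH. change plus with Cplus. rewrite Pa, <- RtoC_pow, Pm. reflexivity. }
  assert (dm : d (n - j)%nat = RtoC 0).
  { assert (A1 := part Re ltac:(intros [? ?] [? ?]; reflexivity) ltac:(intros [? ?] y; unfold Re, Cmult, RtoC; simpl; ring)
      cv_Re eq_refl (n - j)%nat).
    assert (A2 := part Im ltac:(intros [? ?] [? ?]; reflexivity) ltac:(intros [? ?] y; unfold Im, Cmult, RtoC; simpl; ring)
      cv_Im eq_refl (n - j)%nat).
    destruct (d (n - j)%nat) as [x y]. simpl in A1, A2. rewrite A1, A2. reflexivity. }
  unfold d in dm. replace (Z.of_nat j + Z.of_nat (n - j))%Z with (Z.of_nat n) in dm by lia.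
  replace (c (Z.of_nat n)) with (c (Z.of_nat n) - RtoC (h (n - j)%nat) + RtoC (h (n - j)%nat))%C by ring.
  rewrite dm. ring.
Qed.

(** * The triangular recursion and the final identity *)

Lemma sum_n_m_RtoC (f : nat -> C) g m :
  (forall l, (1 <= l <= m)%nat -> f l = RtoC (g l)) ->
  sum_n_m (G := C_AbelianMonoid) f 1 m = RtoC (sumL (seq 1 m) g).
Proof.
  induction m as [|m IH]; intros H.
  - rewrite sum_n_m_zero by lia. reflexivity.
  - rewrite sum_n_Sm by lia. rewrite sumL_seq_S, RtoC_plus, IH by (intros; apply H; lia).
    rewrite (H (S m)) by lia. reflexivity.
Qed.

Theorem theorem2p3 (k i : nat) (hk : (2 <= k)%nat) (hi : (i <= 2 * k)%nat)
  (a : nat -> C)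
  (ha : forall j : nat, (1 <= j <= 4 * k - 5)%nat ->
     a j = (INR (Nrep (4 * k - 2 * i) (2 * i) j)
            - eisenstein_part i k j
            - sum_n_m (fun l : nat =>
                (a l * cjk (Z.of_nat l) (2 * Z.of_nat k) (Z.of_nat j))%C)
                1 (j - 1))%C)
  (n : nat) (hn : (1 <= n)%nat) :
  RtoC (INR (Nrep (4 * k - 2 * i) (2 * i) n))
  = (eisenstein_part i k n
     + sum_n_m (fun j : nat =>
         (a j * cjk (Z.of_nat j) (2 * Z.of_nat k) (Z.of_nat n))%C)
         1 (4 * k - 5))%C.
Proof.
  destruct uniformization_exists as [A [u [t [B U]]]]. destruct beta_exists as [beta Hb].
  assert (HB : bernoulli (2 * k) = INR (fact (2 * k)) * bev beta (2 * k)%nat).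
  { rewrite (bernoulli_value beta) by auto. f_equal. unfold bev, fadd. rewrite fmul_C. unfold fscal, fX.
    destruct (Nat.eqb_spec (2 * k) 1); [lia | ring]. }
  destruct (formal_main A u t B beta k i U Hb HB hk hi) as [a' Ha'].
  set (J := (4 * k - 5)%nat) in *. set (c := fun l => cform A t (2 * k) l) in *.
  assert (Hc : forall l m, cjk (Z.of_nat l) (2 * Z.of_nat k) (Z.of_nat m) = RtoC (c l m))
    by (intros; apply cjk_value with (1 := U)).
  assert (c1 : forall l, c l l = 1).
  { intros l. unfold c. rewrite (cform_shift A u t (2 * k) l (un_t _ _ _ _ U)), fX_mul.
    destruct (Nat.ltb_spec l l); [lia|]. rewrite Nat.sub_diag, !fmul_0, !fpow_0, (un_u0 _ _ _ _ U), (un_A0 _ _ _ _ U), !pow1.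
    assert (t0 : t O = 0) by (rewrite (un_t _ _ _ _ U), fX_mul; reflexivity).
    unfold pre. rewrite !fmul_0. unfold fadd. rewrite !fmul_0, t0. simpl. ring. }
  assert (c0 : forall l m, (m < l)%nat -> c l m = 0).
  { intros l m Hm. unfold c. rewrite (cform_shift A u t (2 * k) l (un_t _ _ _ _ U)), fX_mul.
    destruct (Nat.ltb_spec m l); [reflexivity | lia]. }
  assert (Key : forall m, (1 <= m)%nat -> INR (Nrep (4 * k - 2 * i) (2 * i) m) - eisenstein_part i k m
     = sumL (seq 1 J) (fun l => a' l * c l m)).
  { intros m Hm. rewrite Nrep_theta. apply Ha'; auto. }
  (* Read at n = j, the formal identity is the recursion itself: terms with l > j vanish and the
     term l = j is a'_j. So the given a_j are the coefficients already found. *)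
  assert (Ea : forall j, (1 <= j <= J)%nat -> a j = RtoC (a' j)).
  { intros j. induction j as [j IH] using (well_founded_induction lt_wf). intros Hj.
    rewrite (ha j Hj), (sum_n_m_RtoC _ (fun l => a' l * c l j)).
    - rewrite <- !RtoC_minus. f_equal. rewrite Key by lia.
      replace J with ((j - 1) + S (J - j))%nat by lia. rewrite seq_app, sumL_app.
      replace (1 + (j - 1))%nat with j by lia. cbn [seq]. rewrite sumL_cons, c1, (sumL_0 (seq (S j) (J - j))).
      + ring.
      + intros l Hl. apply in_seq in Hl. rewrite c0 by lia. ring.
    - intros l Hl. rewrite IH, Hc, <- RtoC_mult by lia. reflexivity. }
  rewrite (sum_n_m_RtoC _ (fun l => a' l * c l n)).
  - rewrite <- RtoC_plus. f_equal. rewrite <- Key by auto. ring.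
  - intros l Hl. rewrite Ea, Hc, <- RtoC_mult by auto. reflexivity.
Qed.
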